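(* Let $N\ge 3$ and $\mu\in(0,N)$. There exist constants $K=K(N,\mu)>0$ and $L=L(N,\mu)>0$ such that for every $u\in\mathcal{D}^{1,2}(\mathbb{R}^N)$ and every $v\in\widetilde{\mathcal{M}}$ with $\|u\|_{NL}=\|v\|_{NL}$, $$\|\nabla u-\nabla v\|_{L^2}^2\le K\,\widetilde\delta(u)+L\,\|u\|_{NL}\,\|u-v\|_{NL},$$ where $\widetilde\delta(u):=\int_{\mathbb{R}^N}|\nabla u|^2\,dx-S_{HL}\Big(\int_{\mathbb{R}^N}\big(|x|^{-\mu}\ast|u|^{2^*_\mu}\big)|u|^{2^*_\mu}\,dx\Big)^{1/2^*_\mu}$.
   Context: $2^*_\mu=\frac{2N-\mu}{N-2}$. $\mathcal{D}^{1,2}(\mathbb{R}^N)$ is the completion of $C_c^\infty(\mathbb{R}^N)$ under $\|\nabla u\|_{L^2}$. For measurable $u$, $\|u\|_{NL}:=\Big(\int_{\mathbb{R}^N}\big(|x|^{-\mu}\ast|u|^{2^*_\mu}\big)|u|^{2^*_\mu}dx\Big)^{\frac{1}{2\cdot 2^*_\mu}}$. $S_{HL}=S_{HL}(N,\mu)$ is the optimal (largest) constant in the nonlocal Sobolev inequality $S_{HL}\big(\int_{\mathbb{R}^N}(|x|^{-\mu}\ast|u|^{2^*_\mu})|u|^{2^*_\mu}dx\big)^{1/2^*_\mu}\le\int_{\mathbb{R}^N}|\nabla u|^2dx$ for all $u\in\mathcal{D}^{1,2}(\mathbb{R}^N)$. For $\xi\in\mathbb{R}^N,\lambda>0$, $W[\xi,\lambda](x)=c_{N,\mu}\big(\frac{\lambda}{1+\lambda^2|x-\xi|^2}\big)^{\frac{N-2}{2}}$,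 where $c_{N,\mu}>0$ is the unique constant for which $W[\xi,\lambda]$ solves $\Delta u+(|x|^{-\mu}\ast|u|^{2^*_\mu})|u|^{2^*_\mu-2}u=0$ in $\mathbb{R}^N$ (''Talenti bubble''). $\widetilde{\mathcal{M}}=\{cW[\xi,\lambda]: c\in\mathbb{R},\ \xi\in\mathbb{R}^N,\ \lambda>0\}$. *)

(* Defs.v *)
From HB Require Import structures.
From mathcomp Require Import all_boot all_order all_algebra.
From mathcomp Require Import all_classical all_reals all_analysis.
Set Implicit Arguments. Unset Strict Implicit. Unset Printing Implicit Defensive.
Import Order.TTheory GRing.Theory Num.Theory.
Import numFieldNormedType.Exports.
Local Open Scope classical_set_scope.
Local Open Scope ring_scope.

Section Defs.
Variable R : realType.

(* Euclidean norm |x| on R^N (mathcomp's matrix norm is the sup norm). *)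
Definition enorm (N : nat) (x : 'rV[R]_N) : R :=
  Num.sqrt (\sum_(i < N) x ord0 i ^+ 2).

(* Lebesgue integral on R^N of a nonnegative extended function, computed as
   the iterated integral with respect to the 1-d Lebesgue measure
   (equal to the N-dimensional Lebesgue integral by Tonelli for measurable f). *)
Fixpoint iint (n : nat) : ('rV[R]_n -> \bar R) -> \bar R :=
  match n return ('rV[R]_n -> \bar R) -> \bar R with
  | 0 => fun f => f 0
  | n'.+1 => fun f =>
      (\int[@lebesgue_measure R]_(t in setT)
         iint (fun y : 'rV[R]_n' => f (row_mx (\row_(j < 1) t) y)))%E
  end.

Definition rint (N : nat) (f : 'rV[R]_N -> R) : \bar R :=
  (iint (fun x => (Num.max (f x) 0)%:E) - iint (fun x => (Num.max (- f x) 0)%:E))%E.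

Definition borel_fun (N : nat) (f : 'rV[R]_N -> R) : Prop :=
  forall B : set R, measurable B ->
    <<s setT, (@open 'rV[R]_N) >> (f @^-1` B).

Definition evec (N : nat) (i : 'I_N) : 'rV[R]_N := delta_mx ord0 i.

Fixpoint dpart (N : nat) (l : seq 'I_N) (f : 'rV[R]_N -> R) : 'rV[R]_N -> R :=
  match l with
  | [::] => f
  | i :: l' => fun x => 'D_(evec i) (dpart l' f) x
  end.

Definition smooth (N : nat) (f : 'rV[R]_N -> R) : Prop :=
  forall l : seq 'I_N,
    continuous (dpart l f) /\ forall (i : 'I_N) x, derivable (dpart l f) x (evec i).

Definition test_fun (N : nat) (phi : 'rV[R]_N -> R) : Prop :=
  smooth phi /\ exists r : R, forall x, r < enorm x -> phi x = 0.

Definition two_star (N : nat) : R := (2 * N%:R) / (N%:R - 2).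
Definition two_star_mu (N : nat) (mu : R) : R := (2 * N%:R - mu) / (N%:R - 2).

Definition D12 (N : nat) (u : 'rV[R]_N -> R) (g : 'I_N -> 'rV[R]_N -> R) : Prop :=
  [/\ borel_fun u,
      (iint (fun x => (`|u x| `^ two_star N)%:E) < +oo)%E,
      (forall i, borel_fun (g i)),
      (iint (fun x => (\sum_(i < N) g i x ^+ 2)%:E) < +oo)%E &
      forall phi, test_fun phi -> forall i : 'I_N,
        rint (fun x => u x * dpart [:: i] phi x)
        = (- rint (fun x => (g i x * phi x)%R))%E ].

Definition dirichlet (N : nat) (g : 'I_N -> 'rV[R]_N -> R) : R :=
  fine (iint (fun x => (\sum_(i < N) g i x ^+ 2)%:E)).

Definition choquard (N : nat) (mu : R) (u : 'rV[R]_N -> R) : R :=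
  fine (iint (fun x => iint (fun y =>
     ((`|u y| `^ two_star_mu N mu) * (enorm (x - y) `^ (- mu))
       * (`|u x| `^ two_star_mu N mu))%:E))).

Definition NLnorm (N : nat) (mu : R) (u : 'rV[R]_N -> R) : R :=
  choquard mu u `^ (1 / (2 * two_star_mu N mu)).

Definition S_HL (N : nat) (mu : R) : R :=
  sup [set S : R | forall (u : 'rV[R]_N -> R) (g : 'I_N -> 'rV[R]_N -> R), D12 u g ->
         S * choquard mu u `^ (1 / two_star_mu N mu) <= dirichlet g].

Definition deficit (N : nat) (mu : R) (u : 'rV[R]_N -> R)
    (g : 'I_N -> 'rV[R]_N -> R) : R :=
  dirichlet g - S_HL N mu * choquard mu u `^ (1 / two_star_mu N mu).

(* bubble profile without the normalising constant c_{N,mu} *)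
Definition bubble0 (N : nat) (xi : 'rV[R]_N) (lam : R) (x : 'rV[R]_N) : R :=
  (lam / (1 + lam ^+ 2 * enorm (x - xi) ^+ 2)) `^ ((N%:R - 2) / 2).

(* M~ = { c W[xi,lam] }; since c ranges over all of R, the positive
   constant c_{N,mu} can be absorbed into c. *)
Definition Mtilde (N : nat) : set ('rV[R]_N -> R) :=
  [set v | exists (c : R) (xi : 'rV[R]_N) (lam : R),
     0 < lam /\ v = fun x => c * bubble0 xi lam x].

End Defs.

(* Main.v *)
(* Write [g], [h] for the gradients of [u] and of the bubble [v], and [w = u - v].
   Then [|g - h|^2 = |g|^2 - |h|^2 - 2 <g - h, h>].  Since [v] has the same
   nonlocal norm as [u], the definition of [S_HL] gives
   [|g|^2 - |h|^2 <= deficit u], so K = 1 works and only the pairing has to be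
   bounded.  With [rho = l / (1 + l^2 |x - xi|^2)] and [v = c rho^((N-2)/2)],
   integration by parts turns it into [N (N-2) c] times the integral of
   [w rho^((N+2)/2)].  The nonlocal norm controls this integral: the inequality
   [rho(x) rho(y) <= |x - y|^-2] shows that the double integral of [w] is at
   least the square of the integral of [|w|^p rho^(mu/2)], and Hoelder's
   inequality with the integral of [rho^N], which is bounded above and below
   independently of [xi] and [l], gives
   [int |w| rho^((N+2)/2) <= b |w|_NL].  The same lower bound applied to [v]
   yields [|c| <= |v|_NL / a = |u|_NL / a].

   Two analytic facts enter: the double integral is finite (a weak form of the
   Hardy-Littlewood-Sobolev inequality), so that it is not truncated to 0 by
   [fine]; and the weak gradient of [v] is a.e. its classical gradient. *)

Require Import Defs.
From HB Require Import structures.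
From mathcomp Require Import all_boot all_order all_algebra.
From mathcomp Require Import all_classical all_reals all_analysis.
From mathcomp Require Import measurable_realfun ring lra.
Import Order.TTheory GRing.Theory Num.Theory.
Import numFieldNormedType.Exports.
Local Open Scope classical_set_scope.
Local Open Scope ring_scope.

Set Implicit Arguments.
Unset Strict Implicit.
Unset Printing Implicit Defensive.

(** * Lebesgue measure on the Borel sets of R^n *)

(** The integrals of the statement are iterated one-dimensional integrals, whereas Tonelli, Hoelder
    and dominated convergence need a measure on R^N. A sigma-finite measure on the Borel sets is
    therefore built whose integral agrees with [iint] on nonnegative measurable functions. Uniform
    bounds over R^N are obtained without polar coordinates: integrands depending on |x - y| or |x -
    xi| are compared with products of functions of single coordinates. The weight rho^(mu/2) is
    dictated by conformal invariance. For p = (2N - mu)/(N - 2) one has p (N - 2)/2 + mu/2 = N, so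
    |v|^p rho^(mu/2) = |c|^p rho^N; and the weight left over in Hoelder's inequality, raised to the
    exponent conjugate to p, is again rho^N. The integral of rho^N is invariant under translation
    and dilation, which is why no constant depends on xi or l. Integration by parts pairs u with a
    function that is not compactly supported, hence the cut-offs, and the decay estimates that make
    their error vanish. *)

Definition Bor (R : realType) (n : nat) :=
  g_sigma_algebraType (@open 'rV[R]_n).

Lemma measurable_coord (R : realType) n (i : 'I_n) :
  measurable_fun setT (fun x : Bor R n => (x : 'rV[R]_n) ord0 i).
Proof.
apply: (measurability _ (RGenOInfty.measurableE R)) => _ [_ [a ->] <-].
rewrite setTI; apply: sub_sigma_algebra.
apply: open_comp; last exact: interval_open.
by move=> x _; exact: coord_continuous.
Qed.

(* Every open subset of R^n is a countable union of rational cubes. *)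
Lemma measurable_to_Bor d (T : measurableType d) (R : realType) n
    (phi : T -> 'rV[R]_n) :
  (forall i, measurable_fun setT (fun t => phi t ord0 i)) ->
  measurable_fun setT (phi : T -> Bor R n).
Proof.
move=> mphi; apply: (@measurability _ _ T (Bor R n) setT phi (@open _) erefl).
move=> _ [U oU <-]; rewrite setTI.
pose Q (p : 'rV[rat]_n * rat) : set T :=
  [set t | forall i, `|phi t ord0 i - ratr (p.1 ord0 i)| < ratr p.2].
pose J := [set p : 'rV[rat]_n * rat | Q p `<=` phi @^-1` U].
have -> : phi @^-1` U = \bigcup_(p in J) Q p.
  apply/seteqP; split => [t Ut|t [p Jp Qp]]; last exact: Jp.
  have /nbhs_ballP[e /= e0 eU] : nbhs (phi t) U by exact: open_nbhs_nbhs.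
  have [r /andP[r0 re]] : exists r : rat, (0 : R) < ratr r < e / 2.
    have [r] := rat_in_itvoo (divr_gt0 e0 (ltr0n R 2)).
    by rewrite in_itv/= => H; exists r.
  have Hq (i : 'I_n) : exists q : rat, `|phi t ord0 i - ratr q| < ratr r.
    have : phi t ord0 i - ratr r < phi t ord0 i + ratr r by lra.
    move=> /rat_in_itvoo[q]; rewrite in_itv/= => H; exists q.
    by rewrite ltr_norml; lra.
  pose q := \row_i sval (cid (Hq i)).
  exists (q, r) => [|i] /=; last by rewrite mxE; exact: svalP (cid (Hq i)).
  move=> s Hs; apply: eU; split=> // k i; rewrite ord1 /ball/=.
  have := svalP (cid (Hq i)); have := Hs i; rewrite /= mxE !ltr_norml.
  by move=> *; lra.
rewrite bigcup_mkcond; apply: countable_bigcupT_measurable => [|p].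
  exact: countableP.
case: ifPn => // _.
have -> : Q p = \bigcap_(i in [set: 'I_n])
    ((fun t => `|phi t ord0 i - ratr (p.1 ord0 i)|) @^-1` `]-oo, (ratr p.2)[%classic).
  by apply/seteqP; split => [t Ht i _|t Ht i]; rewrite /= ?in_itv/= ?Ht//;
    have := Ht i I; rewrite /= in_itv.
apply: fin_bigcap_measurable => // i _; rewrite -[X in measurable X]setTI.
by apply: measurableT_comp => //; apply: measurable_funB.
Qed.

Section product_construction.
Context {R : realType}.
Local Notation mu := (@lebesgue_measure R).

(** Prepends the coordinate [p.1], in exactly the form in which [iint] splits off the first
    variable. *)
Definition rcons_pt n (p : R * Bor R n) : Bor R n.+1 :=
  row_mx (\row_(j < 1) p.1) (p.2 : 'rV[R]_n).

Lemma rcons_pt0 n p : (@rcons_pt n p : 'rV_n.+1) ord0 ord0 = p.1.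
Proof.
transitivity (row_mx (\row_(j < 1) p.1) (p.2 : 'rV[R]_n) ord0 (lshift n ord0)).
  by congr (fun_of_matrix _ _ _); apply: val_inj.
by rewrite row_mxEl mxE.
Qed.

Lemma rcons_ptS n p (i : 'I_n) :
  (@rcons_pt n p : 'rV_n.+1) ord0 (lift ord0 i) = (p.2 : 'rV_n) ord0 i.
Proof.
transitivity (row_mx (\row_(j < 1) p.1) (p.2 : 'rV[R]_n) ord0 (rshift 1 i)).
  by congr (fun_of_matrix _ _ _); apply: val_inj.
by rewrite row_mxEr.
Qed.

Lemma measurable_rcons_pt n : measurable_fun setT (@rcons_pt n).
Proof.
apply: measurable_to_Bor => i; case: (unliftP ord0 i) => [j ->|->].
- under eq_fun do rewrite rcons_ptS.
  exact: (measurableT_comp (measurable_coord j) measurable_snd).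
- by under eq_fun do rewrite rcons_pt0; exact: measurable_fst.
Qed.

Lemma measurable_tail n :
  measurable_fun setT ((fun x => \row_i (x : 'rV_n.+1) ord0 (lift ord0 i))
    : Bor R n.+1 -> Bor R n).
Proof.
apply: measurable_to_Bor => i.
by under eq_fun do rewrite mxE; exact: measurable_coord.
Qed.

(** Induction on the dimension: the measure on R^(n+1) is the image under [rcons_pt] of Lebesgue
    measure times the measure on R^n, and Tonelli turns its integral into the recursion of [iint].
    Sigma-finiteness belongs to the induction hypothesis because the product measure and Tonelli
    require it. *)
Lemma bor_measure_ex n : exists m : {sigma_finite_measure set (Bor R n) -> \bar R},
  forall F : Bor R n -> \bar R, measurable_fun setT F -> (forall x, 0 <= F x)%E ->
  iint (F : 'rV[R]_n -> \bar R) = (\int[m]_x F x)%E.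
Proof.
elim: n => [|n [m Hm]].
  exists (dirac ((0 : 'rV[R]_0) : Bor R 0) : {sigma_finite_measure set (Bor R 0) -> \bar R}) => F mF F0 /=.
  by rewrite integral_dirac// diracT mul1e.
have mr := @measurable_rcons_pt n.
pose m1 := measure_function_pushforward__canonical__measure_function_Measure
  (mu \x m)%E mr.
have sf : sigma_finite setT m1.
  have /sigma_finiteP[A [AT And Afin]] := sigma_finiteT mu.
  have /sigma_finiteP[B [BT Bnd Bfin]] := sigma_finiteT m.
  pose t0 (x : Bor R n.+1) : R := (x : 'rV_n.+1) ord0 ord0.
  pose tl (x : Bor R n.+1) : Bor R n := \row_i (x : 'rV_n.+1) ord0 (lift ord0 i).
  (* Products of exhausting sets of the two factors, pulled back along head and tail. Both sequences
     are nondecreasing, so the larger of two indices serves both factors. *)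
  exists (fun k => (t0 @^-1` A k) `&` (tl @^-1` B k)).
    apply/seteqP; split => // x _.
    have [i _ Ai] : (\bigcup_i A i) (t0 x) by rewrite -AT.
    have [j _ Bj] : (\bigcup_i B i) (tl x) by rewrite -BT.
    exists (maxn i j) => //; split => /=.
      by have /subsetPset := And _ _ (leq_maxl i j); exact.
    by have /subsetPset := Bnd _ _ (leq_maxr i j); exact.
  move=> k; split.
    apply: measurableI; rewrite -[X in measurable X]setTI.
      by apply: (measurable_coord ord0) => //; have [] := Afin k.
    by apply: (@measurable_tail n) => //; have [] := Bfin k.
  have [mA Ak] := Afin k; have [mB Bk] := Bfin k.
  rewrite /m1 /= /pushforward (_ : _ @^-1` _ = A k `*` B k).
    by rewrite product_measure1E// lte_mul_pinfty// ge0_fin_numE.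
  apply/seteqP; split => [[t y]|[t y]] /=; rewrite /t0 /tl rcons_pt0.
    move=> [? H]; split => //; move: H; rewrite (_ : \row_i _ = y)//.
    by apply/rowP => i; rewrite mxE rcons_ptS.
  move=> [? H]; split => //; rewrite (_ : \row_i _ = y)//.
  by apply/rowP => i; rewrite mxE rcons_ptS.
pose sfm := @Measure_isSigmaFinite.Build _ _ _ m1 sf.
pose m2 : {sigma_finite_measure set (Bor R n.+1) -> \bar R} := HB.pack (m1 : set _ -> \bar R) (Measure.class m1) sfm.
exists m2 => F mF F0.
have mFr : measurable_fun setT (F \o @rcons_pt n).
  by apply: measurableT_comp => //; exact: measurable_rcons_pt.
transitivity (\int[m1]_x F x)%E; last by [].
rewrite /m1 ge0_integral_pushforward//.
rewrite preimage_setT (fubini_tonelli1 (m1 := mu) (m2 := m) (F \o @rcons_pt n))//; last by move=> ?; exact: F0.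
rewrite /=; apply: eq_integral => t _.
apply: (Hm (fun y => F (rcons_pt (t, y)))) => //.
by apply: (measurableT_comp mFr); exact: measurable_pair1.
Qed.

End product_construction.

(** Beyond sigma-finiteness, all later facts about this measure go through [iintE]. *)
Definition bor_measure (R : realType) (n : nat) :
  {sigma_finite_measure set (Bor R n) -> \bar R} := sval (cid (@bor_measure_ex R n)).

Lemma iintE (R : realType) n (F : Bor R n -> \bar R) :
  measurable_fun setT F -> (forall x, 0 <= F x)%E ->
  iint (F : 'rV[R]_n -> \bar R) = (\int[bor_measure R n]_x F x)%E.
Proof. exact: (svalP (cid (@bor_measure_ex R n))). Qed.

(** * Integrals of products of functions of single coordinates *)

Section product_integrals.
Context {R : realType}.
Local Notation mu := (@lebesgue_measure R).
Local Notation lam := (bor_measure R).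
Local Open Scope ereal_scope.

Lemma mule_prod_ge0 n (f : 'I_n -> \bar R) :
  (forall i, 0 <= f i) -> 0 <= \big[*%E/1]_(i < n) f i.
Proof. by move=> f0; elim/big_ind : _ => // x y; exact: mule_ge0. Qed.

Lemma measurable_fun_prod_coord d (T : measurableType d) n (f : 'I_n -> T -> \bar R) :
  (forall i, measurable_fun setT (f i)) ->
  measurable_fun setT (fun x => \big[*%E/1]_(i < n) f i x).
Proof.
elim: n f => [|n IH] f mf.
  by under eq_fun do rewrite big_ord0; exact: measurable_cst.
by under eq_fun do rewrite big_ord_recl; apply: emeasurable_funM => //; exact: IH.
Qed.

Lemma measurable_coord_comp n (f : R -> \bar R) (i : 'I_n) :
  measurable_fun setT f ->
  measurable_fun setT (fun x : Bor R n => f ((x : 'rV[R]_n) ord0 i)).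
Proof. by move=> mf; apply: measurableT_comp => //; exact: measurable_coord. Qed.

(** Going through [iint] makes the induction step a one-dimensional integral with a constant factor.
    The bounds on the weight and on the singular kernel below are reduced to dimension one by this
    identity. *)
Lemma integral_bor_prod n (f : 'I_n -> R -> \bar R) :
  (forall i, measurable_fun setT (f i)) -> (forall i t, 0 <= f i t) ->
  \int[lam n]_x \big[*%E/1]_(i < n) f i ((x : 'rV[R]_n) ord0 i) =
  \big[*%E/1]_(i < n) \int[mu]_t f i t.
Proof.
move=> mf f0; rewrite -iintE; last 2 first.
- by apply: measurable_fun_prod_coord => i; exact: measurable_coord_comp.
- by move=> x; apply: mule_prod_ge0.
elim: n f mf f0 => [|n IH] f mf f0; first by rewrite /= !big_ord0.
have P0 : 0 <= \big[*%E/1]_(i < n) \int[mu]_t f (lift ord0 i) t.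
  by apply: mule_prod_ge0 => i; apply: integral_ge0 => t _; exact: f0.
have mf0 : measurable_fun setT (f ord0 : measurableTypeR R -> \bar R) := mf ord0.
rewrite big_ord_recl -(ge0_integralZr mu measurableT mf0 _ P0)//.
apply: eq_integral => t _.
rewrite -IH//.
transitivity (iint (fun y : 'rV_n => f ord0 t * \big[*%E/1]_(i < n) f (lift ord0 i) (y ord0 i))).
  congr iint; apply/funext => y; rewrite big_ord_recl.
  rewrite -[row_mx _ _]/(rcons_pt (t, y)) rcons_pt0.
  by congr (_ * _); apply: eq_bigr => i _; rewrite rcons_ptS.
rewrite iintE; last 2 first.
- apply: measurable_funeM.
  by apply: measurable_fun_prod_coord => i; exact: measurable_coord_comp.
- by move=> y; rewrite mule_ge0//; apply: mule_prod_ge0.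
rewrite iintE; last 2 first.
- by apply: measurable_fun_prod_coord => i; exact: measurable_coord_comp.
- by move=> y; apply: mule_prod_ge0.
rewrite ge0_integralZl//.
- by apply: measurable_fun_prod_coord => i; exact: measurable_coord_comp.
- by move=> y _; apply: mule_prod_ge0.
Qed.

Lemma mule_prod_EFin n (f : 'I_n -> R) :
  \big[*%E/1]_(i < n) (f i)%:E = (\prod_(i < n) f i)%:E.
Proof. by elim/big_rec2 : _ => // i x y _ ->; rewrite EFinM. Qed.

Lemma integral_bor_prodr n (f : 'I_n -> R -> R) :
  (forall i, measurable_fun setT (f i)) -> (forall i t, (0 <= f i t)%R) ->
  \int[lam n]_x (\prod_(i < n) f i ((x : 'rV[R]_n) ord0 i))%:E =
  \big[*%E/1]_(i < n) \int[mu]_t (f i t)%:E.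
Proof.
move=> mf f0; rewrite -integral_bor_prod.
- by apply: eq_integral => x _; rewrite mule_prod_EFin.
- by move=> i; exact/measurable_EFinP.
- by move=> i t; rewrite lee_fin.
Qed.

Lemma integral_bor_prod_le n (f : 'I_n -> R -> R) (c : R) :
  (forall i, measurable_fun setT (f i)) -> (forall i t, (0 <= f i t)%R) ->
  (forall i, \int[mu]_t (f i t)%:E <= c%:E) ->
  \int[lam n]_x (\prod_(i < n) f i ((x : 'rV[R]_n) ord0 i))%:E <= (c ^+ n)%:E.
Proof.
move=> mf f0 fc; rewrite integral_bor_prodr//.
rewrite -[X in (c ^+ X)%:E]card_ord -prodr_const -mule_prod_EFin.
have H i : 0 <= \int[mu]_t (f i t)%:E by apply: integral_ge0 => t _; rewrite lee_fin.
(* The sign is carried along because multiplication in [\bar R] is monotone only for nonnegative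
   factors. *)
pose P (x y : \bar R) := 0 <= x <= y.
suff /andP[] : P (\big[*%E/1]_(i < n) \int[mu]_t (f i t)%:E)
   (\big[*%E/1]_(i < n) c%:E) by [].
elim/big_ind2 : _ => [|x1 x2 y1 y2 /andP[? ?] /andP[? ?]|i _]; rewrite /P.
- by rewrite lee01 lexx.
- by rewrite mule_ge0//= lee_pmul.
- by rewrite H fc.
Qed.

Lemma integral_bor_prod_ge n (f : 'I_n -> R -> R) (c : R) : (0 <= c)%R ->
  (forall i, measurable_fun setT (f i)) -> (forall i t, (0 <= f i t)%R) ->
  (forall i, c%:E <= \int[mu]_t (f i t)%:E) ->
  (c ^+ n)%:E <= \int[lam n]_x (\prod_(i < n) f i ((x : 'rV[R]_n) ord0 i))%:E.
Proof.
move=> c0 mf f0 fc; rewrite integral_bor_prodr//.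
rewrite -[X in (c ^+ X)%:E]card_ord -prodr_const -mule_prod_EFin.
pose P (x y : \bar R) := 0 <= x <= y.
suff /andP[] : P (\big[*%E/1]_(i < n) c%:E)
   (\big[*%E/1]_(i < n) \int[mu]_t (f i t)%:E) by [].
elim/big_ind2 : _ => [|x1 x2 y1 y2 /andP[? ?] /andP[? ?]|i _]; rewrite /P.
- by rewrite lee01 lexx.
- by rewrite mule_ge0//= lee_pmul.
- by rewrite lee_fin c0 fc.
Qed.

(** The indicator of the hyperplane is a product with one factor of integral 0; the other factors
    have infinite integral, and [0 * +oo = 0] absorbs them. *)
Lemma bor_hyperplane0 n (i : 'I_n) (a : R) :
  lam n [set x | (x : 'rV[R]_n) ord0 i = a] = 0.
Proof.
have mS : measurable ([set x | (x : 'rV[R]_n) ord0 i = a] : set (Bor R n)).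
  rewrite (_ : [set _ | _] = (fun x : Bor R n => (x : 'rV[R]_n) ord0 i) @^-1` [set a]) //.
  rewrite -[X in measurable X]setTI.
  by apply: (measurable_coord i) => //; exact: measurable_set1.
rewrite -[X in lam n X]setIT -integral_indic//=.
pose f (j : 'I_n) (t : R) : \bar R := if j == i then (\1_[set a] t)%:E else 1.
transitivity (\int[lam n]_x \big[*%E/1]_(j < n) f j ((x : 'rV[R]_n) ord0 j)).
  apply: eq_integral => x _.
  by rewrite /f -big_mkcond (big_pred1 i)//= !indicE.
rewrite integral_bor_prod; last 2 first.
- move=> j; rewrite /f; case: (j == i); last exact: measurable_cst.
  by apply/measurable_EFinP; exact: measurable_indic.
- by move=> j t; rewrite /f; case: (j == i) => //; rewrite lee_fin.
have Hi : \int[mu]_t f i t = 0.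
  by rewrite /f eqxx integral_indic//= setIT lebesgue_measure_set1.
have : exists j, \int[mu]_t f j t = 0 by exists i.
move: f Hi => f _; move=> {i mS}.
elim: n f => [|n IH] f [j Hj]; first by case: j {Hj}.
rewrite big_ord_recl; case: (unliftP ord0 j) Hj => [k ->|->] Hj; last by rewrite Hj mul0e.
by rewrite (IH (fun k => f (lift ord0 k))) ?mule0//; exists k.
Qed.

Lemma lebesgue_integral_shift (a : R) (f : R -> \bar R) :
  measurable_fun setT f -> (forall t, 0 <= f t) ->
  \int[mu]_t f (t + a)%R = \int[mu]_t f t.
Proof.
move=> mf f0.
have ms : measurable_fun setT (fun t : measurableTypeR R => (t + a)%R : measurableTypeR R).
  exact: measurable_funD.
transitivity (\int[pushforward mu (fun t : measurableTypeR R => (t + a)%R : measurableTypeR R)]_t f t).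
  by rewrite ge0_integral_pushforward.
apply: eq_measure_integral => A mA _; apply/esym.
apply: (@lebesgue_measure_unique _
  (measure_function_pushforward__canonical__measure_function_Measure mu ms)) => // X [[u v] _ <-].
rewrite /= /pushforward (_ : _ @^-1` _ = `](u - a)%R, (v - a)%R]%classic).
  by rewrite !lebesgue_measure_itv/= !lte_fin ltrD2r -!EFinB; case: ifP => // _; congr EFin; ring.
by apply/seteqP; split => t /=; rewrite !in_itv/= ltrBlDr lerBrDr.
Qed.

End product_integrals.

(** * One-dimensional integrals *)

Section one_dimensional_bounds.
Context {R : realType}.
Local Notation mu := (@lebesgue_measure R).
Local Open Scope ereal_scope.

Lemma lebesgue_integral_opp (f : R -> \bar R) :
  measurable_fun setT f -> (forall t, 0 <= f t) ->
  \int[mu]_t f (- t)%R = \int[mu]_t f t.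
Proof.
move=> mf f0.
have ms : measurable_fun setT (fun t : measurableTypeR R => (- t)%R : measurableTypeR R).
  exact: oppr_measurable.
transitivity (\int[pushforward mu (fun t : measurableTypeR R => (- t)%R : measurableTypeR R)]_t f t).
  by rewrite ge0_integral_pushforward.
apply: eq_measure_integral => A mA _; apply/esym.
apply: (@lebesgue_measure_unique _
  (measure_function_pushforward__canonical__measure_function_Measure mu ms)) => // X [[u v] _ <-].
(* Reflection exchanges the open and the closed end of the interval, which leaves its length
   unchanged. *)
rewrite /= /pushforward (_ : _ @^-1` _ = `[(- v)%R, (- u)%R[%classic).
  rewrite !lebesgue_measure_itv/= !lte_fin ltrN2 -!EFinB.
  by case: ifP => // _; congr EFin; ring.
by apply/seteqP; split => t /=; rewrite !in_itv/= lerNl ltrNr andbC.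
Qed.

Lemma integral_is_derive (f F : R -> R) (a b : R) : (a < b)%R ->
  (forall x, (a <= x <= b)%R -> is_derive x 1%R F (f x)) ->
  (forall x, (a <= x <= b)%R -> derivable f x 1%R) ->
  \int[mu]_(x in `[a, b]) (f x)%:E = (F b - F a)%:E.
Proof.
move=> ab dF df; rewrite EFinB.
have cF x : (a <= x <= b)%R -> {for x, continuous F}.
  move=> xab; apply: differentiable_continuous; apply/derivable1_diffP.
  by have := dF x xab => /@ex_derive.
apply: continuous_FTC2 => //.
- by apply: derivable_within_continuous => x; rewrite in_itv; exact: df.
- split.
  + move=> x; rewrite in_itv/= => /andP[ax xb].
    by apply: ex_derive; apply: dF; rewrite !ltW.
  + by apply: cvg_at_right_filter; apply: cF; rewrite lexx ltW.
  + by apply: cvg_at_left_filter; apply: cF; rewrite lexx ltW.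
- move=> x; rewrite in_itv/= => /andP[ax xb]; rewrite derive1E.
  by have := dF x; rewrite !ltW// => /(_ isT) ?; exact: derive_val.
Qed.

(** Monotone convergence along the sets [A n]. They only have to cover the points where [f] is
    nonzero, so that integrals over a half line and integrals near a singularity are treated
    alike. *)
Lemma ge0_integral_exhaust_le (f : R -> R) (A : nat -> set R) (C : R) :
  measurable_fun setT f -> (forall t, (0 <= f t)%R) ->
  (forall n, measurable (A n)) -> nondecreasing_seq A ->
  (forall t, (f t != 0)%R -> exists n, A n t) ->
  (forall n, \int[mu]_(t in A n) (f t)%:E <= C%:E) ->
  \int[mu]_t (f t)%:E <= C%:E.
Proof.
move=> mf f0 mA ndA fA fC.
have mfe : measurable_fun setT (EFin \o f : measurableTypeR R -> \bar R).
  exact/measurable_EFinP.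
have -> : \int[mu]_t (f t)%:E = \int[mu]_(t in \bigcup_n A n) (f t)%:E.
  rewrite [RHS]integral_mkcond; apply: eq_integral => t _.
  rewrite patchE; case: ifPn => // /negP tA; congr EFin; apply/eqP/negPn/negP => ft.
  by apply: tA; apply/mem_set; have [n An] := fA _ ft; exists n.
have mU : measurable (\bigcup_n A n : set (measurableTypeR R)) by apply: bigcup_measurable => k _; exact: mA.
have cvgA : \int[mu]_(t in A n) (f t)%:E @[n --> \oo] --> \int[mu]_(t in \bigcup_n A n) (f t)%:E.
  apply: ge0_nondecreasing_set_cvg_integral => //.
  - by move=> i; apply: (measurable_funS measurableT (@subsetT _ _) mfe).
  - by move=> i x _; rewrite lee_fin.
rewrite -(cvg_lim _ cvgA)//; apply: lime_le; first by apply/cvg_ex; eexists; exact: cvgA.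
exact: nearW.
Qed.

(** The primitive [atan (l * (t - c))] stays between -pi/2 and pi/2, so the bound depends on neither
    [l] nor [c]. This is the origin of [pi] in the final constant. *)
Lemma integral_cauchy_le (l c : R) : (0 < l)%R ->
  \int[mu]_t (l / (1 + l ^+ 2 * (t - c) ^+ 2))%:E <= pi%:E.
Proof.
move=> l0.
have den t : (0 < 1 + l ^+ 2 * (t - c) ^+ 2)%R.
  by rewrite ltr_wpDr// mulr_ge0// sqr_ge0.
have dh t : derivable (fun t => (l / (1 + l ^+ 2 * (t - c) ^+ 2))%R) t 1%R.
  apply: derivableM => //; apply: derivableV; first by rewrite gt_eqF// den.
  exact: ex_derive.
pose A n := `[(- n.+1%:R)%R, n.+1%:R]%classic : set R.
apply: (@ge0_integral_exhaust_le _ A).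
- apply: continuous_measurable_fun => t.
  by apply: differentiable_continuous; apply/derivable1_diffP; exact: dh.
- by move=> t; rewrite divr_ge0// ltW.
- by move=> n; exact: measurable_itv.
- move=> m n mn; apply/subsetPset => t; rewrite /A /= !in_itv/= => /andP[mt tm].
  have : (m.+1%:R <= n.+1%:R :> R)%R by rewrite ler_nat.
  by lra.
- move=> t _; have [n nt] : exists n : nat, (`|t| <= n.+1%:R)%R.
    exists (Num.truncn `|t|); apply: ltW; exact: truncnS_gt.
  by exists n; rewrite /A /= in_itv/= -ler_norml.
- move=> n; have nn : (- n.+1%:R < n.+1%:R :> R)%R.
    by rewrite (lt_trans (y := 0%R)) ?oppr_lt0// ltr0n.
  have dF (t : R) : is_derive t 1%R (fun t => atan (l * (t - c)))
      (l / (1 + l ^+ 2 * (t - c) ^+ 2))%R.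
    by apply: is_derive_eq; rewrite subr0 exprMn /GRing.scale/= mulr1 mulrC.
  rewrite (integral_is_derive nn (fun t _ => dF t) (fun t _ => dh t)).
  have := atan_ltpi2 (l * (n.+1%:R - c)); have := atan_gtNpi2 (l * (- n.+1%:R - c)).
  by rewrite lee_fin; lra.
Qed.

(** The integrand is dominated by the restriction of [h] to the half line plus the reflection of
    that restriction; the origin is counted twice. *)
Lemma integral_even_le (h : R -> R) (C : R) :
  measurable_fun setT h -> (forall t, (0 <= h t)%R) ->
  \int[mu]_t (h t * (0 <= t)%R%:R)%:E <= C%:E ->
  \int[mu]_t (h `|t|)%:E <= (2 * C)%:E.
Proof.
move=> mh h0 hC.
pose k t := (h t * (0 <= t)%R%:R)%R.
have k0 t : (0 <= k t)%R by rewrite mulr_ge0.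
have mk : measurable_fun setT k.
  apply: measurable_funM => //.
  have -> : (fun t : R => (0 <= t)%R%:R : R) = \1_(`[0%R, +oo[%classic).
    by apply/funext => t; rewrite indicE mem_setE in_itv/= andbT.
  exact: measurable_indic.
have mke : measurable_fun setT (EFin \o k : measurableTypeR R -> \bar R) by exact/measurable_EFinP.
have mkN : measurable_fun setT (EFin \o (k \o -%R) : measurableTypeR R -> \bar R).
  by apply/measurable_EFinP; apply: measurableT_comp => //; exact: oppr_measurable.
apply: (@le_trans _ _ (\int[mu]_t ((k t)%:E + (k (- t)%R)%:E))).
  apply: ge0_le_integral => //.
  - by move=> t _; rewrite lee_fin.
  - apply/measurable_EFinP; apply: measurableT_comp => //.
  - exact: emeasurable_funD.
  - move=> t _; rewrite -EFinD lee_fin /k.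
    have [t0|t0] := leP 0%R t.
      by rewrite ger0_norm// mulr1 lerDl mulr_ge0.
    by rewrite ltr0_norm// mulr0 add0r oppr_ge0 (ltW t0) mulr1.
rewrite ge0_integralD//; last 2 first.
- by move=> t _; rewrite lee_fin.
- by move=> t _; rewrite lee_fin.
rewrite (@lebesgue_integral_opp (EFin \o k))//.
by rewrite mulr_natl mulr2n EFinD; exact: leeD.
Qed.

Lemma integral_powR_near0_le (al r : R) : (0 < al < 1)%R -> (0 < r)%R ->
  \int[mu]_t (`|t| `^ (- al) * (`|t| < r)%R%:R)%:E <= (2 * (r `^ (1 - al) / (1 - al)))%:E.
Proof.
move=> /andP[al0 al1] r0.
pose h t := (t `^ (- al) * (t < r)%R%:R)%R.
have mh : measurable_fun setT h.
  apply: measurable_funM; first exact: measurable_powR.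
  have -> : (fun t : R => (t < r)%R%:R : R) = \1_(`]-oo, r[%classic).
    by apply/funext => t; rewrite indicE mem_setE in_itv.
  exact: measurable_indic.
have h0 t : (0 <= h t)%R by rewrite mulr_ge0// powR_ge0.
apply: (@integral_even_le h) => //.
(* The index [n.+2] keeps the left end strictly below [r], as [integral_is_derive] requires. *)
pose A n := `[(r / n.+2%:R)%R, r]%classic : set R.
have mi : measurable_fun setT (fun t : R => (0 <= t)%R%:R : R).
  have -> : (fun t : R => (0 <= t)%R%:R : R) = \1_(`[0%R, +oo[%classic).
    by apply/funext => t; rewrite indicE mem_setE in_itv/= andbT.
  exact: measurable_indic.
apply: (@ge0_integral_exhaust_le _ A).
- exact: measurable_funM.
- by move=> t; rewrite mulr_ge0.
- by move=> n; exact: measurable_itv.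
- move=> m n mn; apply/subsetPset => t; rewrite /A /= !in_itv/= => /andP[mt ->].
  rewrite andbT (le_trans _ mt)// ler_pM2l// lef_pV2 ?posrE ?ltr0n// ler_nat.
  by rewrite !ltnS.
- move=> t; rewrite /h; have [t0|t0] := ltP 0%R t; last first.
    have [->|tn0] := eqVneq t 0%R.
      (* A nonzero power of 0 is 0 by convention, so the singular point need not be covered by the
         sets [A n]. *)
      have -> : (0 `^ (- al) = 0 :> R)%R by rewrite powR0// oppr_eq0 gt_eqF.
      by rewrite !mul0r eqxx.
    have tl : (t < 0)%R by rewrite lt_neqAle tn0 t0.
    by rewrite [(0 <= t)%R]leNgt tl mulr0 eqxx.
  have [tr _|tr] := ltP t r; last by rewrite mulr0 mul0r eqxx.
  have [n nt] : exists n : nat, (r / t <= n.+1%:R)%R.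
    by exists (Num.truncn (r / t)); apply: ltW; exact: truncnS_gt.
  exists n; rewrite /A /= in_itv/= (ltW tr) andbT ler_pdivrMr ?ltr0n//.
  move: nt; rewrite ler_pdivrMr// => /le_trans; apply.
  by rewrite mulrC ler_pM2l// ler_nat.
- move=> n; have rn : (0 < r / n.+2%:R)%R by rewrite divr_gt0// ltr0n.
  have rnr : (r / n.+2%:R < r)%R.
    by rewrite ltr_pdivrMr ?ltr0n// ltr_pMr// ltr1n.
  apply: (@le_trans _ _ (\int[mu]_(t in A n) (t `^ (- al))%:E)).
    apply: ge0_le_integral; first exact: measurable_itv.
    - by move=> t _; rewrite lee_fin mulr_ge0.
    - by apply/measurable_EFinP; apply: measurable_funTS; apply: measurable_funM.
    - by apply/measurable_EFinP; apply: measurable_funTS; exact: measurable_powR.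
    - move=> t _; rewrite lee_fin /h -mulrA ler_piMr ?powR_ge0//.
      by case: (t < r)%R; case: (0 <= t)%R; rewrite ?mulr0 ?mulr1 ?mul0r ?ler01 ?lexx.
  have a1 : (0 < 1 - al)%R by lra.
  have dF (t : R) : (r / n.+2%:R <= t <= r)%R ->
      is_derive t 1%R (fun t => (1 - al)^-1 * t `^ (1 - al))%R (t `^ (- al))%R.
    move=> /andP[t0 _]; have t1 : (0 < t)%R by exact: lt_le_trans t0.
    have := is_derive1_powR (1 - al) t1 => ?.
    apply: is_derive_eq; rewrite /GRing.scale/= mulrA mulVf ?gt_eqF// mul1r.
    by congr powR; ring.
  rewrite (integral_is_derive rnr dF).
  + rewrite lee_fin mulrC lerBlDr lerDl mulr_ge0 ?powR_ge0// invr_ge0; exact: ltW.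
  + move=> t /andP[t0 _]; have t1 : (0 < t)%R by exact: lt_le_trans t0.
    by have ? := is_derive1_powR (- al) t1; exact: ex_derive.
Qed.

(** For t >= 0 one has (1 + t)^2 <= 2 (1 + t^2), so the integrand is at most 2^s (1 + t)^(-2s),
    which has an explicit primitive because 2s > 1. *)
Lemma integral_powR_decay (s : R) : (1 / 2 < s)%R ->
  exists C : R, \int[mu]_t ((1 + t ^+ 2) `^ (- s))%:E <= C%:E.
Proof.
move=> s2; exists (2 * (2 `^ s / (2 * s - 1)))%R.
pose h (t : R) := ((1 + t ^+ 2) `^ (- s))%R.
have mh : measurable_fun setT h.
  apply: (measurableT_comp (measurable_powR _)) => //.
  by apply: measurable_funD => //; exact: exprn_measurable.
have -> : \int[mu]_t ((1 + t ^+ 2) `^ (- s))%:E = \int[mu]_t (h `|t|)%:E.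
  by apply: eq_integral => t _; rewrite /h real_normK// num_real.
apply: (@integral_even_le h) => //.
  by move=> t; exact: powR_ge0.
pose A n := `[0%R, n.+1%:R]%classic : set R.
have mi : measurable_fun setT (fun t : R => (0 <= t)%R%:R : R).
  have -> : (fun t : R => (0 <= t)%R%:R : R) = \1_(`[0%R, +oo[%classic).
    by apply/funext => t; rewrite indicE mem_setE in_itv/= andbT.
  exact: measurable_indic.
have s1 : (0 < 2 * s - 1)%R by lra.
apply: (@ge0_integral_exhaust_le _ A).
- exact: measurable_funM.
- by move=> t; rewrite mulr_ge0// powR_ge0.
- by move=> n; exact: measurable_itv.
- move=> m n mn; apply/subsetPset => t; rewrite /A /= !in_itv/= => /andP[-> mt]/=.
  by rewrite (le_trans mt)// ler_nat.
- move=> t; have [t0 _|t0] := leP 0%R t; last by rewrite mulr0 eqxx.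
  exists (Num.truncn t); rewrite /A /= in_itv/= t0; apply: ltW; exact: truncnS_gt.
- move=> n.
  apply: (@le_trans _ _ (\int[mu]_(t in A n) (2 `^ s * (1 + t) `^ (- (2 * s)))%:E)).
    apply: ge0_le_integral; first exact: measurable_itv.
    - by move=> t _; rewrite lee_fin mulr_ge0// powR_ge0.
    - by apply/measurable_EFinP; apply: measurable_funTS; apply: measurable_funM.
    - apply/measurable_EFinP; apply: measurable_funTS; apply: measurable_funM => //.
      by apply: (measurableT_comp (measurable_powR _)) => //; apply: measurable_funD.
    - move=> t; rewrite /A /= in_itv/= => /andP[t0 _]; rewrite t0 mulr1 lee_fin /h.
      rewrite !powRN ler_pdivlMr; last by rewrite powR_gt0// ltr_wpDr.
      rewrite mulrC ler_pdivrMr; last by rewrite powR_gt0// ltr_wpDr// sqr_ge0.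
      rewrite -powRM ?ler0n// ?addr_ge0// ?sqr_ge0// powRrM powR_mulrn ?addr_ge0//.
      apply: ge0_ler_powR; rewrite ?nnegrE ?mulr_ge0 ?addr_ge0 ?sqr_ge0//; first by lra.
      by have := sqr_ge0 (1 - t); nra.
  have n0 : (0 < n.+1%:R :> R)%R by rewrite ltr0n.
  have dt : forall p u : R, (0 <= u)%R ->
      is_derive u 1%R (fun t => (1 + t) `^ p)%R (p * (1 + u) `^ (p - 1))%R.
    move=> p u u0; have u1 : (0 < 1 + u)%R by rewrite ltr_wpDr.
    have := is_derive1_powR p u1 => ?.
    rewrite -[X in is_derive _ _ _ X]mulr1.
    apply: (@is_derive1_comp _ (fun u => u `^ p)%R (fun t => 1 + t)%R).
    apply: is_derive_eq. by rewrite add0r mulr1.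
  have dF (t : R) : (0 <= t <= n.+1%:R)%R ->
      is_derive t 1%R (fun t => 2 `^ s * (- (2 * s - 1)^-1 * (1 + t) `^ (1 - 2 * s)))%R
        (2 `^ s * (1 + t) `^ (- (2 * s)))%R.
    move=> /andP[t0 _]; have ? := dt (1 - 2 * s)%R t t0.
    apply: is_derive_eq; rewrite /GRing.scale/=; congr (_ * _)%R.
    rewrite mulrA (_ : - _ * _ = 1)%R ?mul1r; first by congr powR; ring.
    by field; rewrite gt_eqF.
  rewrite (integral_is_derive n0 dF).
  + rewrite lee_fin addr0 powR1 -mulrBr ler_pM2l ?powR_gt0// mulNr mulr1 opprK gerDr.
    by rewrite oppr_le0 mulr_ge0 ?powR_ge0// invr_ge0 ltW.
  + move=> t /andP[t0 _]; have ? := dt (- (2 * s))%R t t0.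
    exact: ex_derive.
Qed.

End one_dimensional_bounds.

(** * The Euclidean norm *)

Section euclidean_measurability.
Context {R : realType}.

Lemma measurable_sqrtr : measurable_fun setT (@Num.sqrt R).
Proof. by apply: continuous_measurable_fun; exact: sqrt_continuous. Qed.

Lemma measurable_enorm d (T : measurableType d) n (f : T -> 'rV[R]_n) :
  (forall i, measurable_fun setT (fun t => f t ord0 i)) ->
  measurable_fun setT (fun t => enorm (f t)).
Proof.
move=> mf; apply: (measurableT_comp measurable_sqrtr).
by apply: measurable_sum => i; apply: measurable_funX.
Qed.

Lemma measurable_enorm_sub n (a : 'rV[R]_n) :
  measurable_fun setT (fun x : Bor R n => enorm ((x : 'rV[R]_n) - a)).
Proof.
apply: measurable_enorm => i.
have -> : (fun x : Bor R n => ((x : 'rV[R]_n) - a) ord0 i) =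
   (fun x : Bor R n => (x : 'rV[R]_n) ord0 i - a ord0 i).
  by apply/funext => x; rewrite !mxE.
by apply: measurable_funB => //; exact: measurable_coord.
Qed.

Lemma measurable_enorm_pair n :
  measurable_fun setT
    (fun z : Bor R n * Bor R n => enorm ((z.1 : 'rV[R]_n) - (z.2 : 'rV[R]_n))).
Proof.
apply: measurable_enorm => i.
have -> : (fun z : Bor R n * Bor R n => ((z.1 : 'rV[R]_n) - (z.2 : 'rV[R]_n)) ord0 i) =
   (fun z : Bor R n * Bor R n => (z.1 : 'rV[R]_n) ord0 i - (z.2 : 'rV[R]_n) ord0 i).
  by apply/funext => x; rewrite !mxE.
apply: measurable_funB.
- exact: (measurableT_comp (measurable_coord i) (@measurable_fst _ _ (Bor R n) (Bor R n))).
- exact: (measurableT_comp (measurable_coord i) (@measurable_snd _ _ (Bor R n) (Bor R n))).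
Qed.

Lemma enorm_ge0 n (x : 'rV[R]_n) : 0 <= enorm x.
Proof. exact: sqrtr_ge0. Qed.

Lemma enorm_sqr n (x : 'rV[R]_n) : enorm x ^+ 2 = \sum_(i < n) x ord0 i ^+ 2.
Proof. by rewrite sqr_sqrtr// sumr_ge0// => i _; exact: sqr_ge0. Qed.

Lemma enormN n (x : 'rV[R]_n) : enorm (- x) = enorm x.
Proof. by congr Num.sqrt; apply: eq_bigr => i _; rewrite mxE sqrrN. Qed.

Lemma coord_le_enorm n (x : 'rV[R]_n) i : `|x ord0 i| <= enorm x.
Proof.
rewrite -sqrtr_sqr ler_sqrt ?sqr_ge0 ?sumr_ge0// => [|j _]; last exact: sqr_ge0.
by rewrite (bigD1 i)//= lerDl sumr_ge0// => j _; exact: sqr_ge0.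
Qed.

Lemma enorm_eq0 n (x : 'rV[R]_n) : enorm x = 0 -> x = 0.
Proof.
move=> x0; apply/rowP => i; rewrite mxE; apply/eqP; rewrite -normr_le0 -x0.
exact: coord_le_enorm.
Qed.

End euclidean_measurability.

(** Keeps almost every point off the diagonal, where a negative power of the distance is 0 by
    convention and lower bounds for the kernel fail. *)
Lemma ae_coord_neq (R : realType) n (i : 'I_n) (a : R) :
  {ae bor_measure R n, forall y : Bor R n, a != (y : 'rV[R]_n) ord0 i}.
Proof.
exists [set y : Bor R n | (y : 'rV[R]_n) ord0 i = a]; split => //=.
- rewrite (_ : [set _ | _] = (fun y : Bor R n => (y : 'rV[R]_n) ord0 i) @^-1` [set a])//.
  rewrite -[X in measurable X]setTI.
  by apply: (measurable_coord i) => //; exact: measurable_set1.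
- exact: bor_hyperplane0.
- by move=> y /= /negP; rewrite negbK => /eqP <-.
Qed.

(** * Finiteness of the nonlocal energy *)

Section hardy_littlewood_sobolev.
Context {R : realType}.
Local Notation mu1 := (@lebesgue_measure R).

(* With [s = |x - y|^N]: the part of the interaction of densities [a] and [b]
   that is not dominated by [a * b] is controlled by the larger one alone. *)
Definition hls_kernel (al a s : R) : R :=
  if a * s < 1 then a `^ (2 - al) * s `^ (- al) else s ^- 2.

Lemma hls_kernel_ge0 al a s : 0 <= hls_kernel al a s.
Proof.
rewrite /hls_kernel; case: ifP => _; first by rewrite mulr_ge0// powR_ge0.
by rewrite invr_ge0 sqr_ge0.
Qed.

(** Assume b <= a. The left side equals ab (ab s^2)^(-al/2), hence is at most ab when ab s^2 >= 1.
    Otherwise ab is bounded both by a^2 and by s^(-2), and inserting one or the other produces the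
    two branches of [hls_kernel al a s]. *)
Lemma hls_kernel_pointwise al a b s : 0 < al < 1 -> 0 <= a -> 0 <= b -> 0 < s ->
  (a * b) `^ (1 - al / 2) * s `^ (- al) <=
  a * b + hls_kernel al a s + hls_kernel al b s.
Proof.
move=> /andP[al0 al1].
wlog ba : a b / b <= a => [wl a0 b0 s0|a0 b0 s0].
  have [/wl|/ltW/wl] := leP b a; first exact.
  move=> /(_ b0 a0 s0); rewrite mulrC (mulrC b a) addrAC.
  by rewrite [s `^ _ * _]mulrC.
have ab0 : 0 <= a * b by rewrite mulr_ge0.
have k0 c := hls_kernel_ge0 al c s.
have e0 : 0 <= 1 - al / 2 by lra.
have s2 : s ^- 2 = s `^ (- 2) by rewrite powR_invn// ltW.
have [ge1|lt1] := leP 1 (a * b * s ^+ 2).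
  apply: (@le_trans _ _ (a * b)); last by rewrite -addrA lerDl addr_ge0.
  have abp : 0 < a * b.
    rewrite lt_neqAle ab0 andbT; apply/eqP => ab; move: ge1.
    by rewrite -ab mul0r leNgt ltr01.
  rewrite powRD; last by rewrite (gt_eqF abp) implybT.
  rewrite powRr1// -mulrA ler_piMr//.
  rewrite (_ : - al = 2 * (- (al / 2))); last by field.
  rewrite powRrM powR_mulrn ?(ltW s0)// -powRM ?sqr_ge0//.
  rewrite -[leRHS](powRr0 (a * b * s ^+ 2)); apply: ler_powR => //.
  by rewrite oppr_le0 divr_ge0// ltW.
apply: (@le_trans _ _ (hls_kernel al a s)); last first.
  by rewrite addrAC lerDr addr_ge0.
rewrite /hls_kernel; case: ltP => as1.
  rewrite ler_wpM2r ?powR_ge0// (_ : 2 - al = 2 * (1 - al / 2)); last by field.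
  rewrite powRrM powR_mulrn// ge0_ler_powR ?nnegrE ?sqr_ge0//.
  by rewrite expr2 ler_wpM2l.
apply: (@le_trans _ _ ((s ^- 2) `^ (1 - al / 2) * s `^ (- al))).
  rewrite ler_wpM2r ?powR_ge0// ge0_ler_powR ?nnegrE ?invr_ge0 ?sqr_ge0//.
  by rewrite -[_ ^-1]mul1r ler_pdivlMr ?exprn_gt0// ltW.
rewrite s2 -powRrM -powRD; last by rewrite (gt_eqF s0) implybT.
by rewrite le_eqVlt; apply/orP; left; apply/eqP; congr powR; field.
Qed.

Context {n : nat} (mu : R).
Hypotheses (n0 : (0 < n)%N) (mu0 : 0 < mu) (mun : mu < n%:R).
Local Notation al := (mu / n%:R).
Local Notation lam := (bor_measure R n).

Let n0R : 0 < n%:R :> R. Proof. by rewrite ltr0n. Qed.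

Let al01 : 0 < al < 1.
Proof. by rewrite divr_gt0//= ltr_pdivrMr// mul1r. Qed.

(** Each of the n factors |z|^(-mu/n) is at most |z_i|^(-mu/n). Spreading the singularity over the
    coordinates leaves the exponent mu/n < 1, which is integrable in dimension one. A vanishing
    coordinate would make the right side 0. *)
Lemma enorm_powRN_le (z : 'rV[R]_n) : (forall i, z ord0 i != 0) ->
  enorm z `^ (- mu) <= \prod_(i < n) `|z ord0 i| `^ (- al).
Proof.
move=> z0; have ez : 0 < enorm z.
  by apply: lt_le_trans (coord_le_enorm z (Ordinal n0)); rewrite normr_gt0.
apply: (@le_trans _ _ (\prod_(i < n) enorm z `^ (- al))).
  rewrite prodr_const card_ord -powR_mulrn ?powR_ge0// -powRrM.
  by rewrite (_ : - al * n%:R = - mu)//; field; rewrite gt_eqF.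
apply: ler_prod => i _; rewrite powR_ge0/= !powRN lef_pV2 ?posrE ?powR_gt0 ?normr_gt0//.
have /andP[a0 _] := al01.
by rewrite ge0_ler_powR ?nnegrE ?(ltW a0) ?(ltW ez) ?coord_le_enorm.
Qed.

(** A majorant, by products over the coordinates, of the kernel with a = r^(-n) and s = |x - y|^n,
    whose two branches meet at |x - y| = r: a truncated singular power for the near part, Cauchy
    profiles of width r for the far part. *)
Definition near_far (r : R) (x y : 'rV[R]_n) : R :=
  r `^ (- n%:R * (2 - al)) *
     \prod_(i < n) (`|x ord0 i - y ord0 i| `^ (- al) * (`|x ord0 i - y ord0 i| < r)%R%:R)
  + 2 ^+ n * r ^- n *
     \prod_(i < n) (r^-1 / (1 + r^-1 ^+ 2 * (y ord0 i - x ord0 i) ^+ 2)).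

Lemma sum_prod_le (f : 'I_n -> R) (c : R) : 0 < c -> (forall i, 0 <= f i) ->
  \prod_(i < n) (c + f i) <= (c + \sum_(i < n) f i) ^+ n.
Proof.
move=> c0 f0; rewrite -[X in _ <= _ ^+ X]card_ord -prodr_const.
apply: ler_prod => i _; rewrite addr_ge0 ?(ltW c0)//= lerD2l.
by rewrite (bigD1 i)//= lerDl sumr_ge0.
Qed.

Lemma hls_kernel_le_near_far (r : R) (x y : 'rV[R]_n) : 0 < r ->
  (forall i, x ord0 i != y ord0 i) ->
  hls_kernel al (r ^- n) (enorm (x - y) ^+ n) <= near_far r x y.
Proof.
move=> r0 xy.
have z0 i : (x - y) ord0 i != 0 by rewrite !mxE subr_eq0.
have ez : 0 < enorm (x - y).
  by apply: lt_le_trans (coord_le_enorm (x - y) (Ordinal n0)); rewrite normr_gt0.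
have rn : 0 < r ^+ n by rewrite exprn_gt0.
have near0 : 0 <= r `^ (- n%:R * (2 - al)) * \prod_(i < n)
    (`|x ord0 i - y ord0 i| `^ (- al) * (`|x ord0 i - y ord0 i| < r)%R%:R).
  by rewrite mulr_ge0 ?powR_ge0// prodr_ge0// => i _; rewrite mulr_ge0 ?powR_ge0.
have den t : 0 < 1 + r^-1 ^+ 2 * t ^+ 2 :> R.
  by rewrite ltr_wpDr// mulr_ge0// sqr_ge0.
have far0 : 0 <= 2 ^+ n * r ^- n *
     \prod_(i < n) (r^-1 / (1 + r^-1 ^+ 2 * (y ord0 i - x ord0 i) ^+ 2)).
  rewrite !mulr_ge0 ?exprn_ge0 ?invr_ge0 ?(ltW rn)// prodr_ge0// => i _.
  by rewrite mulr_ge0 ?invr_ge0 ?(ltW r0)// ltW.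
rewrite /hls_kernel /near_far; case: ltP => H.
  have er : enorm (x - y) < r.
    move: H; rewrite mulrC ltr_pdivrMr// mul1r ltr_pXn2r// ?nnegrE ?enorm_ge0// ltW//.
  rewrite -[leLHS]addr0 lerD//.
  rewrite -(powR_mulrn n (enorm_ge0 _)) -(powRrM (enorm _)) (_ : n%:R * - al = - mu); last first.
    by field; rewrite gt_eqF.
  rewrite -powR_invn ?(ltW r0)// -powRrM ler_wpM2l ?powR_ge0//.
  apply: (le_trans (enorm_powRN_le z0)).
  rewrite le_eqVlt; apply/orP; left; apply/eqP/eq_bigr => i _; rewrite !mxE.
  rewrite (_ : (`|_| < r) = true) ?mulr1//.
  by apply: le_lt_trans er; have := coord_le_enorm (x - y) i; rewrite !mxE.
rewrite -[leLHS]add0r lerD//.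
have er : r <= enorm (x - y).
  move: H; rewrite mulrC ler_pdivlMr// mul1r ler_pXn2r// ?nnegrE ?enorm_ge0// ltW//.
(* With z = x - y, the product of the (r^2 + z_i^2)/2 is at most ((r^2 + |z|^2)/2)^n, and this is at
   most |z|^(2n) as soon as r <= |z|. *)
have -> : 2 ^+ n * r ^- n *
     \prod_(i < n) (r^-1 / (1 + r^-1 ^+ 2 * (y ord0 i - x ord0 i) ^+ 2)) =
  (\prod_(i < n) ((r ^+ 2 + (x ord0 i - y ord0 i) ^+ 2) / 2))^-1.
  rewrite -prodfV -[X in 2 ^+ X]card_ord -[X in r ^- X]card_ord -exprVn -!prodr_const.
  rewrite -!big_split/=; apply: eq_bigr => i _; rewrite -(sqrrN (y ord0 i - _)) opprB.
  have : 0 < r ^+ 2 + (x ord0 i - y ord0 i) ^+ 2.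
    by rewrite ltr_wpDr ?sqr_ge0 ?exprn_gt0.
  by move=> ?; field; rewrite !gt_eqF.
rewrite -exprM mulnC exprM lef_pV2 ?posrE; last 2 first.
- by rewrite exprn_gt0// exprn_gt0.
- by apply: prodr_gt0 => i _; rewrite divr_gt0// ltr_wpDr ?sqr_ge0 ?exprn_gt0.
under eq_bigr do rewrite mulrDl.
apply: le_trans (sum_prod_le _ _) _ => [|i|].
- by rewrite divr_gt0 ?exprn_gt0.
- by rewrite divr_ge0 ?sqr_ge0.
rewrite -mulr_suml -mulrDl ler_pXn2r// ?nnegrE.
- rewrite ler_pdivrMr// mulr_natr mulr2n lerD//.
    by rewrite ler_pXn2r// ?nnegrE ltW.
  by rewrite enorm_sqr; apply: ler_sum => i _; rewrite !mxE.
- by rewrite divr_ge0// addr_ge0 ?sqr_ge0// sumr_ge0// => i _; exact: sqr_ge0.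
- by rewrite sqr_ge0.
Qed.

Lemma lebesgue_integral_reflect_shift (a : R) (f : R -> R) :
  measurable_fun setT f -> (forall t, 0 <= f t) ->
  (\int[mu1]_t (f `|a - t|)%:E = \int[mu1]_t (f `|t|)%:E)%E.
Proof.
move=> mf f0.
rewrite -(@lebesgue_integral_shift _ (- a) (fun t => (f `|t|)%:E)).
- by apply: eq_integral => t _; rewrite distrC.
- by apply/measurable_EFinP; apply: measurableT_comp => //; exact: normr_measurable.
- by move=> t; rewrite lee_fin.
Qed.

(** For r = a^(-1/n) the near and the far part of [near_far] both integrate to a constant times
    r^(-n) = a. This linear dependence on [a] is what makes the kernel terms integrable against an
    integrable density. *)
Lemma hls_kernel_integral_le : exists2 C : R, 0 <= C &
  forall (a : R) (x : 'rV[R]_n), 0 <= a ->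
  (\int[lam]_y (hls_kernel al a (enorm (x - (y : 'rV[R]_n)) ^+ n))%:E <= (C * a)%:E)%E.
Proof.
have /andP[al0 al1] := al01.
pose C := (2 / (1 - al)) ^+ n + 2 ^+ n * pi ^+ n.
have C0 : 0 <= C.
  rewrite /C addr_ge0// ?exprn_ge0// ?divr_ge0 ?subr_ge0 ?(ltW al1)//.
  by rewrite mulr_ge0 ?exprn_ge0// pi_ge0.
exists C => // a x; rewrite le_eqVlt => /predU1P[<-|a0].
  rewrite mulr0 integral0_eq// => y _; rewrite /hls_kernel mul0r ltr01.
  by rewrite powR0 ?mul0r// gt_eqF//; lra.
pose r := a `^ (- n%:R^-1).
have r0 : 0 < r by rewrite powR_gt0.
have ran : r ^- n = a.
  by rewrite -powR_invn ?(ltW r0)// /r -powRrM mulrNN mulVf ?gt_eqF// powRr1// ltW.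
pose f1 (i : 'I_n) t := `|x ord0 i - t| `^ (- al) * (`|x ord0 i - t| < r)%R%:R.
pose f2 (i : 'I_n) t := r^-1 / (1 + r^-1 ^+ 2 * (t - x ord0 i) ^+ 2).
pose h (t : R) := t `^ (- al) * (t < r)%R%:R.
have mh : measurable_fun setT h.
  apply: measurable_funM; first exact: measurable_powR.
  have -> : (fun t : R => (t < r)%R%:R : R) = \1_(`]-oo, r[%classic).
    by apply/funext => t; rewrite indicE mem_setE in_itv.
  exact: measurable_indic.
have h0 t : 0 <= h t by rewrite mulr_ge0 ?powR_ge0.
have mf1 i : measurable_fun setT (f1 i).
  apply: (measurableT_comp mh); apply: measurableT_comp; first exact: normr_measurable.
  exact: measurable_funB.
have den t : 0 < 1 + r^-1 ^+ 2 * t ^+ 2 :> R.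
  by rewrite ltr_wpDr// mulr_ge0// sqr_ge0.
have mf2 i : measurable_fun setT (f2 i).
  apply: measurable_funM => //.
  apply: continuous_measurable_fun => t.
  apply: differentiable_continuous; apply/derivable1_diffP.
  by apply: derivableV; [rewrite gt_eqF// den|exact: ex_derive].
have f10 i t : 0 <= f1 i t by exact: h0.
have f20 i t : 0 <= f2 i t by rewrite /f2 divr_ge0 ?invr_ge0 ?(ltW r0)// ltW.
pose G1 (y : Bor R n) := \prod_(i < n) f1 i ((y : 'rV[R]_n) ord0 i).
pose G2 (y : Bor R n) := \prod_(i < n) f2 i ((y : 'rV[R]_n) ord0 i).
have mprod f : (forall i : 'I_n, measurable_fun setT (f i : R -> R)) ->
    measurable_fun setT (fun y : Bor R n => \prod_(i < n) f i ((y : 'rV[R]_n) ord0 i)).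
  move=> mf; apply: measurable_prod => i _.
  by apply: measurableT_comp => //; exact: measurable_coord.
have G10 y : 0 <= G1 y by exact: prodr_ge0.
have G20 y : 0 <= G2 y by exact: prodr_ge0.
pose c1 := r `^ (- n%:R * (2 - al)); pose c2 := 2 ^+ n * r ^- n.
have c10 : 0 <= c1 by rewrite powR_ge0.
have c20 : 0 <= c2 by rewrite mulr_ge0 ?exprn_ge0// invr_ge0 exprn_ge0// ltW.
have ms : measurable_fun setT (fun y : Bor R n => enorm (x - (y : 'rV[R]_n)) ^+ n).
  apply: measurable_funX; have := measurable_enorm_sub x.
  by congr measurable_fun; apply/funext => y; rewrite -enormN opprB.
have mk : measurable_fun setT (fun y : Bor R n =>
    (hls_kernel al a (enorm (x - (y : 'rV[R]_n)) ^+ n))%:E).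
  apply/measurable_EFinP; rewrite /hls_kernel; apply: measurable_fun_ifT.
  - by apply: measurable_fun_ltr => //; apply: measurable_funM.
  - by apply: measurable_funM => //; apply: (measurableT_comp (measurable_powR _)).
  - under eq_fun do rewrite -(powR_invn 2 (exprn_ge0 _ (enorm_ge0 _))).
    by apply: (measurableT_comp (measurable_powR _)).
have -> : C * a = c1 * (2 * (r `^ (1 - al) / (1 - al))) ^+ n + c2 * pi ^+ n.
  have E : c1 * (r `^ (1 - al)) ^+ n = r ^- n.
    rewrite /c1 -powR_mulrn ?powR_ge0// -powRrM -powRD ?(gt_eqF r0) ?implybT//.
    rewrite -powR_invn ?(ltW r0)//; congr powR; field.
    by rewrite gt_eqF.
  rewrite mulrDl /c2 -ran; congr (_ + _); last by ring.
  by rewrite -E !exprMn; ring.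
apply: (@le_trans _ _ (\int[lam]_y ((c1 * G1 y)%:E + (c2 * G2 y)%:E))%E).
  apply: ae_ge0_le_integral => //.
  - by move=> y _; rewrite lee_fin hls_kernel_ge0.
  - by move=> y _; rewrite -EFinD lee_fin addr_ge0// mulr_ge0.
  - apply: emeasurable_funD; apply/measurable_EFinP; apply: measurable_funM => //; exact: mprod.
  (* The majorant is available only where all coordinates of x and y differ, which excludes finitely
     many null hyperplanes. *)
  - have aeN : {ae lam, forall y : Bor R n, forall i, x ord0 i != (y : 'rV[R]_n) ord0 i}.
      by apply: filter_forall => i; exact: ae_coord_neq.
    apply: filterS aeN => y xy _; rewrite -EFinD lee_fin -ran.
    exact: hls_kernel_le_near_far.
rewrite ge0_integralD//; last 4 first.
- by move=> y _; rewrite lee_fin mulr_ge0.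
- by apply/measurable_EFinP; apply: measurable_funM => //; exact: mprod.
- by move=> y _; rewrite lee_fin mulr_ge0.
- by apply/measurable_EFinP; apply: measurable_funM => //; exact: mprod.
rewrite EFinD; apply: leeD.
  under eq_integral do rewrite EFinM.
  rewrite ge0_integralZl_EFin//; last 2 first.
  - by move=> y _; rewrite lee_fin.
  - by apply/measurable_EFinP; exact: mprod.
  rewrite EFinM lee_wpmul2l ?lee_fin//; apply: integral_bor_prod_le => // i.
  rewrite (@lebesgue_integral_reflect_shift _ h)//.
  exact: integral_powR_near0_le.
under eq_integral do rewrite EFinM.
rewrite ge0_integralZl_EFin//; last 2 first.
- by move=> y _; rewrite lee_fin.
- by apply/measurable_EFinP; exact: mprod.
rewrite [leRHS]EFinM lee_wpmul2l ?lee_fin//; apply: integral_bor_prod_le => // i.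
by apply: integral_cauchy_le; rewrite invr_gt0.
Qed.

(** Apply [hls_kernel_pointwise] with a = f x, b = f y, s = |x - y|^n. The product term integrates
    to the square of the integral of f; each kernel term, integrated first in the variable that its
    density does not contain, is at most C times the integral of f. *)
Lemma hls_finite (f : Bor R n -> R) :
  measurable_fun setT f -> (forall x, 0 <= f x) ->
  (\int[lam]_x (f x)%:E < +oo)%E ->
  (\int[lam]_x \int[lam]_y
     (f y `^ (1 - al / 2) * enorm ((x : 'rV[R]_n) - (y : 'rV[R]_n)) `^ (- mu)
      * f x `^ (1 - al / 2))%:E < +oo)%E.
Proof.
move=> mf f0 foo; have [C C0 HC] := hls_kernel_integral_le.
pose I := (\int[lam]_x (f x)%:E)%E.
have I0 : (0 <= I)%E by apply: integral_ge0 => x _; rewrite lee_fin.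
have Ifin : I \is a fin_num by rewrite ge0_fin_numE.
pose s (z : Bor R n * Bor R n) := enorm ((z.1 : 'rV[R]_n) - (z.2 : 'rV[R]_n)) ^+ n.
have ms : measurable_fun setT s by apply: measurable_funX; exact: measurable_enorm_pair.
have mf1 : measurable_fun setT (fun z : Bor R n * Bor R n => f z.1).
  by apply: measurableT_comp => //; exact: measurable_fst.
have mf2 : measurable_fun setT (fun z : Bor R n * Bor R n => f z.2).
  by apply: measurableT_comp => //; exact: measurable_snd.
have s0 z : 0 <= s z by rewrite exprn_ge0// enorm_ge0.
have mk (h : Bor R n * Bor R n -> R) : measurable_fun setT h ->
    measurable_fun setT (fun z => (hls_kernel al (h z) (s z))).
  move=> mh; rewrite /hls_kernel; apply: measurable_fun_ifT.
  - by apply: measurable_fun_ltr => //; apply: measurable_funM.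
  - by apply: measurable_funM; apply: (measurableT_comp (measurable_powR _)).
  - under eq_fun do rewrite -(powR_invn 2 (s0 _)).
    by apply: (measurableT_comp (measurable_powR _)).
pose k1 z := hls_kernel al (f z.1) (s z); pose k2 z := hls_kernel al (f z.2) (s z).
have mk1 : measurable_fun setT k1 by exact: mk.
have mk2 : measurable_fun setT k2 by exact: mk.
have k10 z : 0 <= k1 z by exact: hls_kernel_ge0.
have k20 z : 0 <= k2 z by exact: hls_kernel_ge0.
pose J (h : Bor R n * Bor R n -> R) := (\int[lam \x lam]_z (h z)%:E)%E.
have JE (h : Bor R n * Bor R n -> R) : measurable_fun setT h -> (forall z, 0 <= h z) ->
    (\int[lam]_x \int[lam]_y (h (x, y))%:E)%E = J h.
  move=> mh h0; rewrite /J (fubini_tonelli1 (EFin \o h))//; exact/measurable_EFinP.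
have JE2 (h : Bor R n * Bor R n -> R) : measurable_fun setT h -> (forall z, 0 <= h z) ->
    (\int[lam]_y \int[lam]_x (h (x, y))%:E)%E = J h.
  move=> mh h0; rewrite /J (fubini_tonelli2 (EFin \o h))//; exact/measurable_EFinP.
have Jadd (g h : Bor R n * Bor R n -> R) : measurable_fun setT g -> measurable_fun setT h ->
    (forall z, 0 <= g z) -> (forall z, 0 <= h z) -> J (fun z => g z + h z) = (J g + J h)%E.
  move=> mg mh g0 h0; rewrite /J; under eq_integral do rewrite EFinD.
  rewrite ge0_integralD//.
  - by move=> z _; rewrite lee_fin.
  - exact/measurable_EFinP.
  - by move=> z _; rewrite lee_fin.
  - exact/measurable_EFinP.
pose g (z : Bor R n * Bor R n) := f z.2 `^ (1 - al / 2) * enorm ((z.1 : 'rV[R]_n) - (z.2 : 'rV[R]_n)) `^ (- mu)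
      * f z.1 `^ (1 - al / 2).
have g0 z : 0 <= g z by rewrite !mulr_ge0// powR_ge0.
have mg : measurable_fun setT g.
  apply: measurable_funM; last by apply: (measurableT_comp (measurable_powR _)).
  apply: measurable_funM; apply: (measurableT_comp (measurable_powR _)) => //.
  exact: measurable_enorm_pair.
have mff : measurable_fun setT (fun z : Bor R n * Bor R n => f z.1 * f z.2).
  exact: measurable_funM.
have ff0 (z : Bor R n * Bor R n) : 0 <= f z.1 * f z.2 by rewrite mulr_ge0.
rewrite (JE g)//; apply: (@le_lt_trans _ _ (J (fun z => f z.1 * f z.2 + k1 z + k2 z))).
  apply: ge0_le_integral => //.
  - by move=> z _; rewrite lee_fin.
  - exact/measurable_EFinP.
  - apply/measurable_EFinP; apply: measurable_funD => //; exact: measurable_funD.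
  - move=> [x y] _; rewrite lee_fin /g /k1 /k2 /s/=.
    (* On the diagonal the left side is 0, since a nonzero power of 0 is 0. *)
    have [d0|d0] := eqVneq (enorm ((x : 'rV[R]_n) - (y : 'rV[R]_n))) 0.
      rewrite d0 powR0 ?mulr0 ?mul0r ?oppr_eq0 ?(gt_eqF mu0)//.
      by rewrite !addr_ge0 ?mulr_ge0 ?hls_kernel_ge0.
    have d1 : 0 < enorm ((x : 'rV[R]_n) - (y : 'rV[R]_n)) by rewrite lt_neqAle eq_sym d0 enorm_ge0.
    have := hls_kernel_pointwise al01 (f0 x) (f0 y) (exprn_gt0 n d1).
    apply: le_trans; rewrite -(powR_mulrn n (enorm_ge0 _)) -(powRrM (enorm _)).
    rewrite (_ : n%:R * - al = - mu); last by field; rewrite gt_eqF.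
    by rewrite powRM// mulrC mulrA [X in X * _]mulrC mulrAC.
have J1 : (J (fun z : Bor R n * Bor R n => (f z.1 * f z.2)%R) < +oo)%E.
  rewrite -JE//.
  have -> : (\int[lam]_x \int[lam]_y (f (x, y).1 * f (x, y).2)%:E =
      \int[lam]_x ((f x)%:E * I))%E.
    apply: eq_integral => x _ /=; rewrite -ge0_integralZl_EFin//.
    - by move=> y _; rewrite lee_fin.
    - exact/measurable_EFinP.
  rewrite ge0_integralZr//; last 2 first.
  - exact/measurable_EFinP.
  - by move=> y _; rewrite lee_fin.
  by rewrite lte_mul_pinfty.
have J2 : (J (k1) < +oo)%E.
  rewrite -JE//; apply: (@le_lt_trans _ _ (\int[lam]_x (C%:E * (f x)%:E))%E).
    apply: ge0_le_integral => //.
    - by move=> x _; apply: integral_ge0 => y _; rewrite lee_fin.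
    - apply: (measurable_fun_fubini_tonelli_F (EFin \o k1)); first exact/measurable_EFinP.
      by move=> z; rewrite lee_fin.
    - by apply: measurable_funeM; exact/measurable_EFinP.
    - by move=> x _; rewrite -EFinM; apply: (HC (f x) x (f0 x)).
  rewrite ge0_integralZl_EFin//; last 2 first.
  - by move=> y _; rewrite lee_fin.
  - exact/measurable_EFinP.
  by rewrite lte_mul_pinfty// lee_fin.
have J3 : (J (k2) < +oo)%E.
  rewrite -JE2//; apply: (@le_lt_trans _ _ (\int[lam]_x (C%:E * (f x)%:E))%E).
    apply: ge0_le_integral => //.
    - by move=> x _; apply: integral_ge0 => y _; rewrite lee_fin.
    - apply: (measurable_fun_fubini_tonelli_G (EFin \o k2)); first exact/measurable_EFinP.
      by move=> z; rewrite lee_fin.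
    - by apply: measurable_funeM; exact/measurable_EFinP.
    - move=> y _; rewrite -EFinM; apply: le_trans (HC _ y (f0 y)).
      rewrite le_eqVlt; apply/orP; left; apply/eqP; apply: eq_integral => x _.
      by rewrite /k2 /s/= -enormN opprB.
  rewrite ge0_integralZl_EFin//; last 2 first.
  - by move=> y _; rewrite lee_fin.
  - exact/measurable_EFinP.
  by rewrite lte_mul_pinfty// lee_fin.
rewrite Jadd//; last 2 first.
- exact: measurable_funD.
- by move=> z; rewrite addr_ge0.
rewrite Jadd//; apply: lte_add_pinfty => //; exact: lte_add_pinfty.
Qed.

End hardy_littlewood_sobolev.

(** * The weight rho *)

Section hoelder_bounds.
Local Open Scope ereal_scope.

Lemma hoelder_le d (T : measurableType d) (R : realType) (m : {measure set T -> \bar R})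
    (f g : T -> R) (p q a b : R) :
  measurable_fun setT f -> measurable_fun setT g ->
  (forall x, (0 <= f x)%R) -> (forall x, (0 <= g x)%R) ->
  (0 < p)%R -> (0 < q)%R -> (p^-1 + q^-1 = 1)%R -> (0 <= a)%R -> (0 <= b)%R ->
  \int[m]_x (f x `^ p)%:E <= a%:E -> \int[m]_x (g x `^ q)%:E <= b%:E ->
  \int[m]_x (f x * g x)%:E <= (a `^ p^-1 * b `^ q^-1)%:E.
Proof.
move=> mf mg f0 g0 p0 q0 pq a0 b0 fa gb.
have := hoelder m mf mg p0 q0 pq; rewrite Lnorm1.
have -> : \int[m]_x `|(EFin \o (f \* g)%R) x| = \int[m]_x (f x * g x)%:E.
  by apply: eq_integral => x _; rewrite /= ger0_norm// mulr_ge0.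
move=> /le_trans; apply.
have N (h : T -> R) (r c : R) : (forall x, (0 <= h x)%R) -> (0 < r)%R -> (0 <= c)%R ->
    \int[m]_x (h x `^ r)%:E <= c%:E -> 'N[m]_r%:E[EFin \o h] <= (c `^ r^-1)%:E.
  move=> h0 r0 c0 hc; rewrite unlock /Lnorm/= -poweR_EFin.
  have -> : \int[m]_x (`|(h x)%:E| `^ r) = \int[m]_x (h x `^ r)%:E.
    by apply: eq_integral => x _; rewrite /= ger0_norm.
  apply: gt0_ler_poweR => //.
  - by rewrite invr_ge0 ltW.
  - by rewrite in_itv/= leey andbT integral_ge0// => x _; rewrite lee_fin powR_ge0.
  - by rewrite in_itv/= lee_fin c0 leey.
by rewrite EFinM; apply: lee_pmul; rewrite ?Lnorm_ge0//; exact: N.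
Qed.

End hoelder_bounds.

Section density.
Context {R : realType} {n : nat}.
Local Notation mu1 := (@lebesgue_measure R).
Local Notation lam := (bor_measure R n).

Lemma cauchy_schwarz_sum (a b : 'I_n -> R) :
  (\sum_i a i * b i) ^+ 2 <= (\sum_i a i ^+ 2) * (\sum_i b i ^+ 2).
Proof.
pose A := \sum_i a i ^+ 2; pose B := \sum_i b i ^+ 2; pose S := \sum_i a i * b i.
have B0 : 0 <= B by apply: sumr_ge0 => i _; exact: sqr_ge0.
have E : \sum_i (B * a i - S * b i) ^+ 2 = B * (A * B - S ^+ 2).
  have -> : \sum_i (B * a i - S * b i) ^+ 2 =
      \sum_i (B ^+ 2 * a i ^+ 2 + ((- 2 * B * S) * (a i * b i) + S ^+ 2 * b i ^+ 2)).
    by apply: eq_bigr => i _; ring.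
  rewrite big_split/= big_split/= -!mulr_sumr -/A -/B -/S; ring.
have E0 : 0 <= B * (A * B - S ^+ 2).
  by rewrite -E; apply: sumr_ge0 => i _; exact: sqr_ge0.
rewrite -/A -/B -/S; move: B0; rewrite le_eqVlt => /predU1P[B0|B0]; last first.
  by move: E0; rewrite pmulr_rge0// subr_ge0.
have b0 i : b i = 0.
  have : b i ^+ 2 <= 0.
    rewrite B0 /B (bigD1 i)//= lerDl; apply: sumr_ge0 => j _; exact: sqr_ge0.
  by move=> H; apply/eqP; rewrite -sqrf_eq0; apply/eqP/le_anti; rewrite H sqr_ge0.
rewrite -B0 mulr0 /S big1 ?expr0n// => i _; by rewrite b0 mulr0.
Qed.

Variables (xi : 'rV[R]_n) (l : R).
Hypothesis l0 : 0 < l.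

(** Half the conformal factor of the stereographic projection, centred at [xi] and dilated by [l];
    the bubble profile is its power (n - 2)/2. *)
Definition dens (x : 'rV[R]_n) : R := l / (1 + l ^+ 2 * enorm (x - xi) ^+ 2).

Lemma dens_den_gt0 t : 0 < 1 + l ^+ 2 * t ^+ 2 :> R.
Proof. by rewrite ltr_wpDr// mulr_ge0// sqr_ge0. Qed.

Lemma dens_gt0 x : 0 < dens x.
Proof. by rewrite divr_gt0// dens_den_gt0. Qed.

Lemma measurable_cauchy (c : R) :
  measurable_fun setT (fun t : R => l / (1 + l ^+ 2 * (t - c) ^+ 2)).
Proof.
apply: measurable_funM => //; apply: continuous_measurable_fun => t.
apply: differentiable_continuous; apply/derivable1_diffP.
by apply: derivableV; [rewrite gt_eqF// dens_den_gt0|exact: ex_derive].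
Qed.

Lemma measurable_dens : measurable_fun setT (dens : Bor R n -> R).
Proof.
have := measurable_cauchy 0; under eq_fun do rewrite subr0.
by move=> mc; apply: (measurableT_comp mc); exact: measurable_enorm_sub.
Qed.

Lemma dens_powR_measurable (s : R) : measurable_fun setT (fun x : Bor R n => dens x `^ s).
Proof. by apply: (measurableT_comp (measurable_powR _)); exact: measurable_dens. Qed.

(* Conformal distance identity: [l^2 |x-y|^2 <= (1 + l^2|x-xi|^2)(1 + l^2|y-xi|^2)]. *)
Lemma dens_mul_le (x y : 'rV[R]_n) : x != y ->
  dens x * dens y <= (enorm (x - y) ^+ 2)^-1.
Proof.
move=> xy.
have d0 : 0 < enorm (x - y) ^+ 2.
  rewrite exprn_gt0// lt_neqAle enorm_ge0 andbT eq_sym; apply/eqP => /enorm_eq0/eqP.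
  by rewrite subr_eq0 (negbTE xy).
pose a i := (x - xi) ord0 i; pose b i := (y - xi) ord0 i.
pose A := \sum_i a i ^+ 2; pose B := \sum_i b i ^+ 2; pose S := \sum_i a i * b i.
have dE : enorm (x - y) ^+ 2 = A + B - 2 * S.
  rewrite enorm_sqr /A /B /S mulr_sumr -big_split/= -sumrB; apply: eq_bigr => i _.
  by rewrite /a /b !mxE; ring.
have xE : enorm (x - xi) ^+ 2 = A by rewrite enorm_sqr.
have yE : enorm (y - xi) ^+ 2 = B by rewrite enorm_sqr.
have SAB : S ^+ 2 <= A * B by exact: cauchy_schwarz_sum.
rewrite -[leRHS]mul1r ler_pdivlMr// /dens xE yE.
have A0 : 0 < 1 + l ^+ 2 * A by rewrite -xE dens_den_gt0.
have B0 : 0 < 1 + l ^+ 2 * B by rewrite -yE dens_den_gt0.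
rewrite mulf_div mulrAC ler_pdivrMr ?mulr_gt0// mul1r dE.
(* The two sides differ by (1 + l^2 S)^2 + l^4 (AB - S^2). *)
have l4 : l ^+ 4 * S ^+ 2 <= l ^+ 4 * (A * B) by rewrite ler_wpM2l// exprn_ge0// ltW.
have H := sqr_ge0 (1 + l ^+ 2 * S).
rewrite -subr_ge0 in l4; rewrite -subr_ge0.
have := addr_ge0 H l4; congr (0 <= _); ring.
Qed.

Lemma dens_kernel_le (mu : R) (x y : 'rV[R]_n) : 0 < mu -> x != y ->
  (dens x * dens y) `^ (mu / 2) <= enorm (x - y) `^ (- mu).
Proof.
move=> mu0 xy.
rewrite (_ : - mu = - 2%:R * (mu / 2)); last by field.
rewrite [in leRHS]powRrM powR_invn ?enorm_ge0//.
rewrite ge0_ler_powR ?nnegrE ?divr_ge0 ?invr_ge0 ?sqr_ge0 ?(ltW mu0)//.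
- by rewrite mulr_ge0// ltW// dens_gt0.
- exact: dens_mul_le.
Qed.

(** Integrate [dens_kernel_le] against h(x) h(y); the weight on the left then splits into a product.
    [I] is an extended real so that finiteness of the right side can later be used to deduce
    finiteness of [I]. *)
Lemma double_integral_ge (mu : R) (h : Bor R n -> R) (I : \bar R) :
  (0 < n)%N -> 0 < mu ->
  measurable_fun setT h -> (forall x, 0 <= h x) ->
  I = (\int[lam]_x (h x * dens x `^ (mu / 2))%:E)%E ->
  (I * I <= \int[lam]_x \int[lam]_y
     (h y * enorm ((x : 'rV[R]_n) - (y : 'rV[R]_n)) `^ (- mu) * h x)%:E)%E.
Proof.
move=> n0 mu0 mh h0 IE.
pose k (x : Bor R n) := h x * dens x `^ (mu / 2).
have k0 x : 0 <= k x by rewrite mulr_ge0// powR_ge0.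
have mk : measurable_fun setT k.
  by apply: measurable_funM => //; exact: dens_powR_measurable.
have I0 : (0 <= I)%E by rewrite IE; apply: integral_ge0 => x _; rewrite lee_fin k0.
have -> : (I * I = \int[lam]_x ((k x)%:E * I))%E.
  rewrite ge0_integralZr//; last 2 first.
  - exact/measurable_EFinP.
  - by move=> x _; rewrite lee_fin.
  by rewrite IE.
pose g (z : Bor R n * Bor R n) :=
  h z.2 * enorm ((z.1 : 'rV[R]_n) - (z.2 : 'rV[R]_n)) `^ (- mu) * h z.1.
have g0 z : 0 <= g z by rewrite !mulr_ge0// powR_ge0.
have mg : measurable_fun setT g.
  apply: measurable_funM; last by apply: measurableT_comp => //; exact: measurable_fst.
  apply: measurable_funM; first by apply: measurableT_comp => //; exact: measurable_snd.
  by apply: (measurableT_comp (measurable_powR _)) => //; exact: measurable_enorm_pair.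
have mge : measurable_fun setT (EFin \o g) by exact/measurable_EFinP.
apply: ge0_le_integral => //.
- by move=> x _; rewrite mule_ge0// lee_fin.
- by apply: emeasurable_funM => //; exact/measurable_EFinP.
- by apply: (measurable_fun_fubini_tonelli_F (EFin \o g)) => // z; rewrite lee_fin.
- move=> x _; rewrite IE -ge0_integralZl_EFin//; last 2 first.
  + by move=> y _; rewrite lee_fin k0.
  + exact/measurable_EFinP.
  apply: ae_ge0_le_integral => //.
  + by move=> y _; rewrite -EFinM lee_fin; exact: mulr_ge0 (k0 x) (k0 y).
  + by apply: measurable_funeM; exact/measurable_EFinP.
  + by move=> y _; rewrite lee_fin; exact: (g0 (x, y)).
  + by have := measurableT_comp mge (@measurable_pair1 _ _ (Bor R n) (Bor R n) x); exact.
  (* The kernel bound fails on the diagonal; it suffices to discard the null set of y sharing one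
     fixed coordinate with x. *)
  apply: filterS (ae_coord_neq (Ordinal n0) ((x : 'rV[R]_n) ord0 (Ordinal n0))) => y xy _.
  rewrite -EFinM lee_fin /k.
  have nxy : (x : 'rV[R]_n) != (y : 'rV[R]_n) by apply: contra xy => /eqP ->.
  have := dens_kernel_le mu0 nxy; rewrite powRM ?(ltW (dens_gt0 _))// => H.
  have hh : 0 <= h x * h y by rewrite mulr_ge0.
  have := ler_wpM2l hh H.
  by move=> HH; rewrite mulrACA [leRHS]mulrAC [X in _ <= X * _]mulrC.
Qed.

Lemma dens_expn_le x : dens x ^+ n <=
  \prod_(i < n) (l / (1 + l ^+ 2 * (x ord0 i - xi ord0 i) ^+ 2)).
Proof.
rewrite -[X in _ ^+ X]card_ord -prodr_const; apply: ler_prod => i _.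
rewrite ltW ?dens_gt0//= /dens ler_pM2l// lef_pV2 ?posrE ?dens_den_gt0//.
rewrite lerD2l ler_wpM2l ?sqr_ge0// -(real_normK (num_real (_ - _))).
rewrite ler_pXn2r ?nnegrE ?enorm_ge0//.
by have := coord_le_enorm (x - xi) i; rewrite !mxE.
Qed.

Lemma measurable_prod_coord (f : 'I_n -> R -> R) : (forall i, measurable_fun setT (f i)) ->
  measurable_fun setT (fun y : Bor R n => \prod_(i < n) f i ((y : 'rV[R]_n) ord0 i)).
Proof.
move=> mf; apply: measurable_prod => i _.
by apply: measurableT_comp => //; exact: measurable_coord.
Qed.

Lemma integral_dens_le : (\int[lam]_x (dens x ^+ n)%:E <= (pi ^+ n)%:E)%E.
Proof.
pose f (i : 'I_n) t := l / (1 + l ^+ 2 * (t - xi ord0 i) ^+ 2).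
have mf i : measurable_fun setT (f i) by exact: measurable_cauchy.
have f0 i t : 0 <= f i t by rewrite ltW// divr_gt0// dens_den_gt0.
apply: le_trans (integral_bor_prod_le mf f0 (fun i => integral_cauchy_le (xi ord0 i) l0)).
apply: ge0_le_integral => //.
- by move=> x _; rewrite lee_fin exprn_ge0// ltW// dens_gt0.
- by apply/measurable_EFinP; apply: measurable_funX; exact: measurable_dens.
- by apply/measurable_EFinP; exact: measurable_prod_coord.
- by move=> x _; rewrite lee_fin; exact: dens_expn_le.
Qed.

(** On the cube of half-side 1/l about [xi] one has l^2 |x - xi|^2 <= n, so the weight is at least
    l/(1 + n) there; the volume (2/l)^n of the cube cancels the powers of l. *)
Lemma integral_dens_ge : (((2 / (1 + n%:R)) ^+ n)%:E <= \int[lam]_x (dens x ^+ n)%:E)%E.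
Proof.
pose J (i : 'I_n) := `[xi ord0 i - l^-1, xi ord0 i + l^-1]%classic : set R.
pose f (i : 'I_n) t := l / (1 + n%:R) * \1_(J i) t.
have n1 : 0 < 1 + n%:R :> R by rewrite ltr_wpDr.
have mf i : measurable_fun setT (f i).
  by apply: measurable_funM => //; apply: measurable_indic; exact: measurable_itv.
have f0 i t : 0 <= f i t by rewrite mulr_ge0// divr_ge0// ltW.
have fi i : ((2 / (1 + n%:R))%:E <= \int[mu1]_t (f i t)%:E)%E.
  under eq_integral do rewrite EFinM.
  rewrite ge0_integralZl_EFin//; last 2 first.
  - by apply/measurable_EFinP; apply: measurable_indic; exact: measurable_itv.
  - by rewrite divr_ge0// ltW.
  have -> : (\int[mu1]_t (\1_(J i) t)%:E = (2 / l)%:E)%E.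
    rewrite integral_indic//; last exact: measurable_itv.
    rewrite setIT /J /= lebesgue_measure_itv/= lte_fin.
    have li : 0 < l^-1 by rewrite invr_gt0.
    rewrite ifT; last by lra.
    by rewrite -EFinB; congr EFin; field; rewrite gt_eqF.
  rewrite -EFinM lee_fin le_eqVlt; apply/orP; left; apply/eqP.
  by field; rewrite !gt_eqF.
have c0 : 0 <= 2 / (1 + n%:R) :> R by rewrite divr_ge0// ltW.
apply: (le_trans (integral_bor_prod_ge c0 mf f0 fi)).
apply: ge0_le_integral => //.
- by move=> x _; rewrite lee_fin prodr_ge0.
- by apply/measurable_EFinP; exact: measurable_prod_coord.
- by apply/measurable_EFinP; apply: measurable_funX; exact: measurable_dens.
move=> x _; rewrite lee_fin.
have [H|/existsNP[i Hi]] := pselect (forall i, J i ((x : 'rV[R]_n) ord0 i)); last first.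
  rewrite (bigD1 i)//= /f indicE memNset// mulr0 mul0r.
  by rewrite exprn_ge0// ltW// dens_gt0.
rewrite -[X in _ <= _ ^+ X]card_ord -prodr_const; apply: ler_prod => i _.
rewrite f0/= /f indicE mem_set// mulr1 /dens ler_pM2l// lef_pV2 ?posrE ?dens_den_gt0//.
rewrite lerD2l enorm_sqr mulr_sumr.
have -> : n%:R = \sum_(j < n) 1 :> R by rewrite sumr_const card_ord.
apply: ler_sum => j _; have := H j; rewrite /J /= in_itv/= !mxE => /andP[h1 h2].
have ll : l * l^-1 = 1 by rewrite mulfV// gt_eqF.
have h3 : l * (xi ord0 j - l^-1) <= l * (x : 'rV[R]_n) ord0 j by rewrite ler_pM2l.
have h4 : l * (x : 'rV[R]_n) ord0 j <= l * (xi ord0 j + l^-1) by rewrite ler_pM2l.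
rewrite mulrBr ll in h3; rewrite mulrDr ll in h4; rewrite -exprMn mulrBr.
set u := l * _ in h3 h4 *; set v := l * _ in h3 h4 *.
have : 0 <= (1 - (u - v)) * (1 + (u - v)) by rewrite mulr_ge0//; lra.
by move=> ?; lra.
Qed.

(** With m = min(1, l^2), the denominator 1 + l^2 |x - xi|^2 is at least m (1 + (x_i - xi_i)^2) for
    every i. Distributing the power s over the coordinates leaves one-dimensional integrals of
    exponent s/n > 1/2. *)
Lemma integral_dens_powR_fin (s : R) : (0 < n)%N -> n%:R / 2 < s ->
  (\int[lam]_x (dens x `^ s)%:E < +oo)%E.
Proof.
move=> n0 ns; have nR : 0 < n%:R :> R by rewrite ltr0n.
pose a := s / n%:R.
have a2 : 1 / 2 < a by rewrite /a ltr_pdivlMr// mulrAC mul1r.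
have [C HC] := integral_powR_decay a2.
pose m := Num.min 1 (l ^+ 2).
have m0 : 0 < m by rewrite lt_min ltr01 exprn_gt0.
pose h t := m `^ (- a) * (1 + t ^+ 2) `^ (- a) :  R.
have mh0 : measurable_fun setT (fun t : R => (1 + t ^+ 2) `^ (- a) : R).
  apply: (measurableT_comp (measurable_powR _)).
  by apply: measurable_funD => //; exact: exprn_measurable.
have mh : measurable_fun setT h by exact: measurable_funM.
have h0 t : 0 <= h t by rewrite mulr_ge0// powR_ge0.
pose f (i : 'I_n) t := h (t - xi ord0 i).
have mf i : measurable_fun setT (f i).
  by apply: (measurableT_comp mh); exact: measurable_funB.
have f0 i t : 0 <= f i t by exact: h0.
have fi i : (\int[mu1]_t (f i t)%:E <= (m `^ (- a) * C)%:E)%E.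
  rewrite (lebesgue_integral_shift (- xi ord0 i) (f := EFin \o h))//; last first.
    exact/measurable_EFinP.
  under eq_integral do rewrite /= EFinM.
  rewrite ge0_integralZl_EFin ?powR_ge0//; last 2 first.
  - by move=> t _; rewrite lee_fin powR_ge0.
  - exact/measurable_EFinP.
  by rewrite EFinM lee_wpmul2l// lee_fin powR_ge0.
have ls : 0 <= l `^ s by rewrite powR_ge0.
apply: (@le_lt_trans _ _ ((l `^ s)%:E * ((m `^ (- a) * C) ^+ n)%:E)%E); last by rewrite -EFinM ltry.
apply: (@le_trans _ _ ((l `^ s)%:E *
    \int[lam]_x (\prod_(i < n) f i ((x : 'rV[R]_n) ord0 i))%:E)%E); last first.
  by rewrite lee_wpmul2l ?lee_fin//; exact: integral_bor_prod_le.
rewrite -ge0_integralZl_EFin//; last 2 first.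
- by move=> x _; rewrite lee_fin prodr_ge0.
- by apply/measurable_EFinP; exact: measurable_prod_coord.
apply: ge0_le_integral => //.
- by move=> x _; rewrite lee_fin powR_ge0.
- by apply/measurable_EFinP; exact: dens_powR_measurable.
- by apply: measurable_funeM; apply/measurable_EFinP; exact: measurable_prod_coord.
move=> x _; rewrite -EFinM lee_fin /dens powRM ?invr_ge0 ?(ltW l0) ?(ltW (dens_den_gt0 _))//.
rewrite ler_wpM2l// -powR_inv1 ?(ltW (dens_den_gt0 _))// -powRrM mulN1r.
rewrite (_ : - s = - a * n%:R); last by rewrite /a; field; rewrite gt_eqF.
rewrite [in leLHS]powRrM powR_mulrn ?powR_ge0// -[X in _ ^+ X]card_ord -prodr_const.
apply: ler_prod => i _; rewrite powR_ge0/= /f /h -powRM ?(ltW m0) ?addr_ge0 ?sqr_ge0//.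
have z0 : 0 < 1 + ((x : 'rV[R]_n) ord0 i - xi ord0 i) ^+ 2 by rewrite ltr_wpDr ?sqr_ge0.
rewrite !powRN lef_pV2 ?posrE ?powR_gt0 ?mulr_gt0 ?dens_den_gt0//.
rewrite ge0_ler_powR ?nnegrE ?mulr_ge0 ?(ltW m0) ?(ltW z0) ?(ltW (dens_den_gt0 _))//; first by lra.
rewrite mulrDr mulr1 lerD//; first by rewrite ge_min lexx.
apply: ler_pM; rewrite ?(ltW m0) ?sqr_ge0//; first by rewrite ge_min lexx orbT.
rewrite -(real_normK (num_real (_ - _))) ler_pXn2r ?nnegrE ?enorm_ge0//.
by have := coord_le_enorm ((x : 'rV[R]_n) - xi) i; rewrite !mxE.
Qed.

(* The exponents are conformally matched: the dual weight integrates [dens ^ n]. *)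
Lemma weighted_hoelder (mu H : R) (w : Bor R n -> R) : (2 < n)%N -> 0 < mu -> mu < n%:R ->
  measurable_fun setT w -> 0 <= H ->
  let p := (2 * n%:R - mu) / (n%:R - 2) in
  (\int[lam]_x (`|w x| `^ p * dens x `^ (mu / 2))%:E <= H%:E)%E ->
  (\int[lam]_x (`|w x| * dens x `^ ((n%:R + 2) / 2))%:E <=
    (H `^ p^-1 * (pi ^+ n) `^ (1 - p^-1))%:E)%E.
Proof.
move=> n2 mu0 mun mw H0 p Hw.
have n2R : 2 < n%:R :> R by rewrite ltr_nat.
have d0 : 0 < 2 * n%:R - mu by lra.
have p0 : 0 < p by rewrite divr_gt0// subr_gt0.
pose q := (2 * n%:R - mu) / (n%:R + 2 - mu).
have e0 : 0 < n%:R + 2 - mu by lra.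
have q0 : 0 < q by rewrite divr_gt0.
have pq : p^-1 + q^-1 = 1 by rewrite /p /q; field; rewrite !gt_eqF//; lra.
have -> : 1 - p^-1 = q^-1 by rewrite -pq; ring.
pose f x := `|w x| * dens x `^ (mu / (2 * p)).
pose g x := dens x `^ ((n%:R + 2) / 2 - mu / (2 * p)).
have mw1 : measurable_fun setT (fun x => `|w x|).
  by apply: measurableT_comp => //; exact: normr_measurable.
have -> : (\int[lam]_x (`|w x| * dens x `^ ((n%:R + 2) / 2))%:E =
    \int[lam]_x (f x * g x)%:E)%E.
  apply: eq_integral => x _; congr EFin; rewrite /f /g -mulrA; congr (_ * _).
  rewrite -powRD; last by rewrite (gt_eqF (dens_gt0 _)) implybT.
  by congr powR; ring.
apply: hoelder_le => //.
- by apply: measurable_funM => //; exact: dens_powR_measurable.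
- exact: dens_powR_measurable.
- by move=> x; rewrite mulr_ge0// powR_ge0.
- by move=> x; rewrite powR_ge0.
- by rewrite exprn_ge0// pi_ge0.
- apply: le_trans Hw; rewrite le_eqVlt; apply/orP; left; apply/eqP.
  apply: eq_integral => x _; congr EFin; rewrite /f powRM ?powR_ge0// -powRrM.
  by congr (_ * powR _ _); field; rewrite gt_eqF.
- apply: le_trans integral_dens_le; rewrite le_eqVlt; apply/orP; left; apply/eqP.
  apply: eq_integral => x _; congr EFin; rewrite /g -powRrM -powR_mulrn ?(ltW (dens_gt0 _))//.
  by congr powR; rewrite /p /q; field; rewrite !gt_eqF//; lra.
Qed.

End density.

(** * Smooth functions and bumps *)

Section smooth_functions.
Context {R : realType} {n : nat}.
Implicit Types f g : 'rV[R]_n -> R.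

(** A version of [smooth] graded by the order of differentiation, so that closure under sums,
    products and composition can be proved by induction on [k]. *)
Fixpoint Ck (k : nat) f : Prop :=
  continuous f /\
  if k is k'.+1 then forall i : 'I_n,
    (forall x, derivable f x (evec R i)) /\ Ck k' (fun x => 'D_(evec R i) f x)
  else True.

Lemma Ck_cont k f : Ck k f -> continuous f.
Proof. by case: k => [|k] []. Qed.

Lemma CkW k f : Ck k.+1 f -> Ck k f.
Proof.
elim: k f => [|k IH] f [cf Hf]; first by split.
by split => // i; have [df Df] := Hf i; split => //; exact: IH.
Qed.

Lemma smoothP f : smooth f <-> forall k, Ck k f.
Proof.
split => [sf k|Cf l].
- have H : forall l, Ck k (dpart l f).
    elim: k => [|k IH] l; have [cl dl] := sf l; first by split.
    by split => // i; split => [x|]; [exact: dl|exact: (IH (i :: l))].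
  exact: (H [::]).
- have H : forall k, Ck k (dpart l f).
    elim: l => [//|i l IH] k /=.
    by have [_ /(_ i)[]] := IH k.+1.
  by split; [exact: Ck_cont (H 0%N)|move=> i x; have [_ /(_ i)[]] := H 1%N].
Qed.

Lemma Ck_cst k (c : R) : Ck k (fun=> c).
Proof.
elim: k c => [|k IH] c; (split; first exact: cst_continuous) => // i.
split => [x|]; first exact: derivable_cst.
rewrite (_ : (fun x => 'D_(evec R i) (fun=> c) x) = fun=> 0); first exact: IH.
by apply/funext => x; rewrite derive_cst.
Qed.

Lemma CkD k f g : Ck k f -> Ck k g -> Ck k (fun x => f x + g x).
Proof.
elim: k f g => [|k IH] f g [cf Hf] [cg Hg]; (split; first by move=> x; exact: (cvgD (cf x) (cg x))) => // i.
have [df Df] := Hf i; have [dg Dg] := Hg i; split => [x|].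
  exact: (derivableD (df x) (dg x)).
rewrite (_ : (fun _ => _) = fun x => 'D_(evec R i) f x + 'D_(evec R i) g x); first exact: IH.
by apply/funext => x; rewrite -deriveD.
Qed.

Lemma CkM k f g : Ck k f -> Ck k g -> Ck k (fun x => f x * g x).
Proof.
elim: k f g => [|k IH] f g Cf Cg; have cf := Ck_cont Cf; have cg := Ck_cont Cg;
  (split; first by move=> x; exact: (cvgM (cf x) (cg x))) => // i.
have [_ /(_ i)[df Df]] := Cf; have [_ /(_ i)[dg Dg]] := Cg; split => [x|].
  exact: (derivableM (df x) (dg x)).
rewrite (_ : (fun _ => _) = fun x => f x * 'D_(evec R i) g x + g x * 'D_(evec R i) f x).
  by apply: CkD; apply: IH => //; exact: CkW.
by apply/funext => x; rewrite -[in RHS]/(f x *: _ + g x *: _) -deriveM.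
Qed.

Lemma Ck_sum k (I : Type) (r : seq I) (F : I -> 'rV[R]_n -> R) :
  (forall j, Ck k (F j)) -> Ck k (fun x => \sum_(j <- r) F j x).
Proof.
move=> CF; elim: r => [|j r IH].
  by under eq_fun do rewrite big_nil; exact: Ck_cst.
by under eq_fun do rewrite big_cons; exact: CkD.
Qed.

Lemma Ck_prod k (I : Type) (r : seq I) (F : I -> 'rV[R]_n -> R) :
  (forall j, Ck k (F j)) -> Ck k (fun x => \prod_(j <- r) F j x).
Proof.
move=> CF; elim: r => [|j r IH].
  by under eq_fun do rewrite big_nil; exact: Ck_cst.
by under eq_fun do rewrite big_cons; exact: CkM.
Qed.

Lemma is_derive_coord (i j : 'I_n) (x : 'rV[R]_n) :
  is_derive x (evec R i) (fun y : 'rV[R]_n => y ord0 j) (i == j)%:R.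
Proof.
have -> : (i == j)%:R = (evec R i) ord0 j by rewrite mxE eqxx eq_sym.
have H : (h^-1 *: (((h *: evec R i + x) : 'rV[R]_n) ord0 j - x ord0 j))
    @[h --> (0 : R)^'] --> (evec R i ord0 j : R).
  apply: cvg_near_cst; near=> h.
  rewrite !mxE addrK /GRing.scale/= mulrA mulVf ?mul1r//.
  by near: h; exact: nbhs_dnbhs_neq.
split; first by apply/cvg_ex; eexists; exact: H.
by apply: cvg_lim.
Unshelve. all: by end_near. Qed.

Lemma Ck_coord k (j : 'I_n) : Ck k (fun x => x ord0 j).
Proof.
have c : continuous (fun x : 'rV[R]_n => x ord0 j) by move=> x; exact: coord_continuous.
case: k => [|k]; first by split.
split => // i; split => [x|].
  by have ? := is_derive_coord i j x; exact: ex_derive.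
rewrite (_ : (fun _ => _) = fun=> (i == j)%:R); first exact: Ck_cst.
by apply/funext => x; have ? := is_derive_coord i j x; exact: derive_val.
Qed.

(** Restriction to the line through [x] in direction [v] reduces this to the one-variable chain
    rule, so that derivability of [q] in that single direction suffices. *)
Lemma is_derive_comp_line (f : R -> R) (q : 'rV[R]_n -> R) (x v : 'rV[R]_n) (a b : R) :
  is_derive (q x) (1 : R) f a -> is_derive x v q b ->
  is_derive x v (fun y => f (q y)) (a * b).
Proof.
move=> df dq.
pose l (h : R) := q (h *: v + x).
have l0 : l 0 = q x by rewrite /l scale0r add0r.
have dl : is_derive (0 : R) (1 : R) l b.
  have [dq1 dq2] := dq.
  have E : (fun h : R => h^-1 *: (l (h *: (1 : R) + 0) - l 0)) =
           (fun h : R => h^-1 *: (q (h *: v + x) - q x)).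
    by apply/funext => h; rewrite l0 /l addr0 /GRing.scale/= mulr1.
  split; first by rewrite /derivable E.
  by rewrite /derive E.
have dfl : is_derive (0 : R) (1 : R) (f \o l) (a * b).
  by apply: is_derive1_comp => //; rewrite l0.
have [h1 h2] := dfl.
have E : (fun h : R => h^-1 *: ((f \o l) (h *: (1 : R) + 0) - (f \o l) 0)) =
         (fun h : R => h^-1 *: (f (q (h *: v + x)) - f (q x))).
  by apply/funext => h; rewrite /= l0 /l addr0 /GRing.scale/= mulr1.
split; first by move: h1; rewrite /derivable E.
by move: h2; rewrite /derive E.
Qed.

(** [F m] is the m-th derivative of the outer function on [D]. Carrying the whole sequence closes
    the induction on [k], because differentiating [F m (q x)] produces [F m.+1 (q x)]. *)
Lemma Ck_comp k (D : set R) (F : nat -> R -> R) (q : 'rV[R]_n -> R) :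
  (forall m t, D t -> is_derive t (1 : R) (F m) (F m.+1 t)) ->
  (forall x, D (q x)) -> Ck k q -> forall m, Ck k (fun x => F m (q x)).
Proof.
move=> dF Dq; have cF m t : D t -> {for t, continuous (F m)}.
  move=> Dt; apply: differentiable_continuous; apply/derivable1_diffP.
  by have ? := dF m t Dt; exact: ex_derive.
have cont m : continuous q -> continuous (fun x => F m (q x)).
  by move=> cq x; apply: (@continuous_comp _ _ _ q (F m)); [exact: cq|exact: cF].
elim: k => [|k IH] Cq m; have cq := Ck_cont Cq; (split; first exact: cont) => // i.
have [_ /(_ i)[dq Dqk]] := Cq.
have dc x : is_derive x (evec R i) (fun y => F m (q y)) (F m.+1 (q x) * 'D_(evec R i) q x).
  apply: is_derive_comp_line; first exact: dF.
  exact/derivableP.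
split => [x|]; first by have ? := dc x; exact: ex_derive.
rewrite (_ : (fun _ => _) = fun x => F m.+1 (q x) * 'D_(evec R i) q x).
  by apply: CkM => //; apply: IH; exact: CkW.
by apply/funext => x; have ? := dc x; exact: derive_val.
Qed.

End smooth_functions.

Section bump.
Context {R : realType}.

(* The derivatives of exp(-e/t), extended by 0 to t <= 0, are of this form with
   P = bump_poly e m. *)
Definition bump_term (e : R) (P : {poly R}) (t : R) : R :=
  if 0 < t then P.[t^-1] * expR (- (e * t^-1)) else 0.

Fixpoint bump_poly (e : R) (m : nat) : {poly R} :=
  if m is m'.+1 then 'X^2 * (e *: bump_poly e m' - (bump_poly e m')^`()) else 1.

Lemma expR_ge_pow (x : R) (k : nat) : 0 <= x -> x ^+ k / k`!%:R <= expR x.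
Proof.
move=> x0; case: k => [|k].
  by rewrite expr0 fact0 divr1 -expR0 ler_expR.
by apply: le_trans (expR_ge1Dxn k x0); rewrite lerDr.
Qed.

Lemma horner_growth (P : {poly R}) : exists A : R, exists d : nat, 0 <= A /\
  forall s, 1 <= s -> `|P.[s]| <= A * s ^+ d.
Proof.
elim/poly_ind : P => [|P c [A [d [A0 HA]]]].
  by exists 0, 0%N; split => // s _; rewrite horner0 normr0 mul0r.
exists (A + `|c|), d.+1; split => [|s s1]; first by rewrite addr_ge0.
have s0 : 0 <= s by exact: le_trans s1.
rewrite hornerMXaddC (le_trans (ler_normD _ _))// mulrDl lerD//.
  by rewrite normrM (ger0_norm s0) exprSr mulrA ler_wpM2r// HA.
by rewrite ler_peMr// exprn_ege1.
Qed.

(** Since |P(1/t)| <= A t^(-d) and exp(e/t) >= (e/t)^(d+2) / (d+2)!, two powers of t are left over: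
    one for the division in a difference quotient at 0, one to make that quotient vanish in the
    limit. *)
Lemma bump_term_decay (e : R) (P : {poly R}) : 0 < e -> exists2 C : R, 0 <= C &
  forall t, 0 < t -> t <= 1 -> `|P.[t^-1] * expR (- (e * t^-1))| <= C * t ^+ 2.
Proof.
move=> e0; have [A [d [A0 HA]]] := horner_growth P.
have f0 : 0 < (d.+2)`!%:R :> R by rewrite ltr0n fact_gt0.
have ed : 0 < e ^+ d.+2 by rewrite exprn_gt0.
exists (A * (d.+2)`!%:R / e ^+ d.+2) => [|t t0 t1].
  by apply: divr_ge0; [apply: mulr_ge0 => //|]; exact: ltW.
have s1 : 1 <= t^-1 by rewrite invf_ge1.
have s0 : 0 < t^-1 by rewrite invr_gt0.
have es0 : 0 < (e * t^-1) ^+ d.+2 by rewrite exprn_gt0// mulr_gt0.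
rewrite normrM (ger0_norm (expR_ge0 _)) expRN.
apply: (@le_trans _ _ (A * t^-1 ^+ d * (((e * t^-1) ^+ d.+2) / (d.+2)`!%:R)^-1)).
  apply: ler_pM => //; rewrite ?invr_ge0 ?expR_ge0 ?HA//.
  rewrite lef_pV2 ?posrE ?expR_gt0 ?divr_gt0//.
  by apply: expR_ge_pow; rewrite mulr_ge0// ltW.
rewrite le_eqVlt; apply/orP; left; apply/eqP.
rewrite exprMn !exprVn 2!(exprS _ d.+1) 2!(exprS _ d).
have td : t ^+ d != 0 by rewrite expf_neq0// gt_eqF.
have ed1 : e ^+ d != 0 by rewrite expf_neq0// gt_eqF.
have tn0 : t != 0 by rewrite gt_eqF.
have en0 : e != 0 by rewrite gt_eqF.
have fn0 : (d.+2)`!%:R != 0 :> R by rewrite gt_eqF.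
by field; rewrite td ed1 tn0 en0 fn0.
Qed.

(** For t > 0 the derivative is t^(-2) (e P - P')(1/t) exp(-e/t), and the factor X^2 encodes t^(-2).
    At t = 0 the difference quotient is bounded by a multiple of |h|. *)
Lemma is_derive_bump_term (e : R) (P : {poly R}) (t : R) : 0 < e ->
  is_derive t (1 : R) (bump_term e P) (bump_term e ('X^2 * (e *: P - P^`())) t).
Proof.
move=> e0; have [t0|t0|->] := ltgtP t 0.
- have E : \forall x \near t, cst 0 x = bump_term e P x.
    near=> x; rewrite /bump_term ifF//; apply/negbTE; rewrite -leNgt ltW//.
    by near: x; exact: lt_nbhsl.
  have -> : bump_term e ('X^2 * (e *: P - P^`())) t = 0.
    by rewrite /bump_term ifF//; apply/negbTE; rewrite -leNgt ltW.
  by apply: near_eq_is_derive E _; exact: is_derive_cst.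
- have E : \forall x \near t, P.[x^-1] * expR (- (e * x^-1)) = bump_term e P x.
    near=> x; rewrite /bump_term ifT//.
    by near: x; exact: lt_nbhsr.
  rewrite /bump_term t0; apply: near_eq_is_derive E _.
  have tn0 : t != 0 by rewrite gt_eqF.
  have dV : is_derive t (1 : R) (fun x : R => x^-1) (- t ^- 2).
    have := @is_deriveV R id t 1 1 tn0 (is_derive_id _ _).
    by rewrite /GRing.scale/= mulr1.
  have dP : is_derive t (1 : R) (fun x : R => P.[x^-1]) (P^`().[t^-1] * - t ^- 2).
    exact: (@is_derive1_comp _ (horner P) (fun x => x^-1)).
  have dE : is_derive t (1 : R) (fun x : R => expR (- (e * x^-1)))
      (expR (- (e * t^-1)) * (e * t ^- 2)).
    apply: (@is_derive1_comp _ expR (fun x => - (e * x^-1))).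
    apply: is_derive_eq; rewrite /GRing.scale/=; ring.
  apply: is_derive_eq; rewrite /GRing.scale/= hornerM hornerXn hornerD hornerZ hornerN exprVn.
  by ring.
- have [C C0 HC] := bump_term_decay P e0.
  have b0 Q : bump_term e Q 0 = 0 by rewrite /bump_term ltxx.
  have H : (fun h : R => h^-1 *: (bump_term e P (h *: (1 : R) + 0) - bump_term e P 0)) @ 0^' --> (0 : R).
    apply/cvgr0Pnorm_le => eps eps0; near=> h.
    rewrite b0 subr0 addr0 /GRing.scale/= mulr1 /bump_term.
    have h0 : h != 0 by near: h; exact: nbhs_dnbhs_neq.
    case: ifPn => hp; last by rewrite mulr0 normr0 ltW.
    have h1 : `|h| <= 1 by near: h; exact: dnbhs0_le.
    have hC : `|h| <= eps / (C + 1).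
      by near: h; apply: dnbhs0_le; rewrite divr_gt0// ltr_wpDl.
    rewrite (gtr0_norm hp) in h1 hC.
    rewrite normrM normfV (gtr0_norm hp) mulrC ler_pdivrMr// (le_trans (HC _ hp h1))//.
    rewrite expr2 mulrA ler_wpM2r ?(ltW hp)//.
    apply: (@le_trans _ _ (C * (eps / (C + 1)))); first by rewrite ler_wpM2l.
    rewrite mulrA ler_pdivrMr ?ltr_wpDl//; nra.
  rewrite b0; split; first by apply/cvg_ex; exists 0.
  by apply: cvg_lim.
Unshelve. all: by end_near. Qed.

Lemma Ck_bump n k (e : R) (q : 'rV[R]_n -> R) : 0 < e -> Ck k q ->
  Ck k (fun x => bump_term e 1 (q x)).
Proof.
move=> e0 Cq; apply: (@Ck_comp _ _ _ setT (fun m => bump_term e (bump_poly e m)) q _ _ Cq 0%N) => //.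
by move=> m t _; exact: is_derive_bump_term.
Qed.

End bump.

(** * Translation invariance, real-valued integrals and integrals of derivatives *)

Lemma iint_shift (R : realType) n (a : 'rV[R]_n) (F : Bor R n -> \bar R) :
  measurable_fun setT F -> (forall x, 0 <= F x)%E ->
  iint (fun x : 'rV[R]_n => F (x + a)) = iint (F : 'rV[R]_n -> \bar R).
Proof.
elim: n a F => [|n IH] a F mF F0; first by rewrite /= add0r [a]thinmx0.
pose a0 : R := a ord0 ord0; pose a' : 'rV[R]_n := \row_i a ord0 (lift ord0 i).
pose H (t : R) := iint (fun y : 'rV[R]_n => F (rcons_pt (t, y))).
have mFr : measurable_fun setT (F \o @rcons_pt R n).
  by apply: measurableT_comp => //; exact: measurable_rcons_pt.
have mFt t : measurable_fun setT (fun y : Bor R n => F (rcons_pt (t, y))).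
  by apply: (measurableT_comp mFr); exact: measurable_pair1.
transitivity (\int[@lebesgue_measure R]_t H (t + a0)%R)%E.
  apply: eq_integral => t _; rewrite /H -(IH a' (fun y => F (rcons_pt (t + a0, y))))//.
  congr iint; apply/funext => y; congr F.
  apply/rowP => i; rewrite mxE; case: (unliftP ord0 i) => [j ->|->].
    rewrite -[row_mx _ _]/(rcons_pt (t, y)).
    by rewrite (rcons_ptS (t, y)) (rcons_ptS (t + a0, y + a')) /= !mxE.
  rewrite -[row_mx _ _]/(rcons_pt (t, y)).
  by rewrite (rcons_pt0 (t, y)) (rcons_pt0 (t + a0, y + a')).
rewrite lebesgue_integral_shift//.
- have -> : H = fun t => (\int[bor_measure R n]_y F (rcons_pt (t, y)))%E.
    by apply/funext => t; rewrite /H iintE.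
  have := measurable_fun_fubini_tonelli_F (m2 := bor_measure R n)
    (F \o @rcons_pt R n) mFr (fun p => F0 _).
  exact.
- by move=> t; rewrite /H iintE// integral_ge0.
Qed.

Section integrals.
Context {R : realType} {n : nat}.
Local Notation lam := (bor_measure R n).

Implicit Types (f g : Bor R n -> R) (x : 'rV[R]_n) (r : R) (i : 'I_n).

Definition intble (f : Bor R n -> R) := lam.-integrable setT (EFin \o f).
Definition rI (f : Bor R n -> R) : R := Rintegral lam setT f.

Lemma measurable_shift (a : 'rV[R]_n) :
  measurable_fun setT (fun x : Bor R n => ((x : 'rV[R]_n) + a) : Bor R n).
Proof.
apply: measurable_to_Bor => i.
have -> : (fun x : Bor R n => ((x : 'rV[R]_n) + a) ord0 i) =
   (fun x : Bor R n => (x : 'rV[R]_n) ord0 i + a ord0 i).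
  by apply/funext => x; rewrite !mxE.
by apply: measurable_funD => //; exact: measurable_coord.
Qed.

Lemma bor_integral_shift (a : 'rV[R]_n) (F : Bor R n -> \bar R) :
  measurable_fun setT F ->
  (\int[lam]_x F ((x : 'rV[R]_n) + a)%R = \int[lam]_x F x)%E.
Proof.
move=> mF; rewrite [LHS]integralE [RHS]integralE.
have H (G : Bor R n -> \bar R) : measurable_fun setT G -> (forall x, 0 <= G x)%E ->
    (\int[lam]_x G ((x : 'rV[R]_n) + a)%R = \int[lam]_x G x)%E.
  move=> mG G0; rewrite -!iintE//; first exact: iint_shift.
  exact: (measurableT_comp mG (measurable_shift a)).
congr (_ - _)%E.
- have F0 x : (0 <= F^\+ x)%E by exact: funepos_ge0.
  by rewrite -[RHS](H _ (measurable_funepos mF) F0); apply: eq_integral => x _; rewrite !funeposE.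
- have F0 x : (0 <= F^\- x)%E by exact: funeneg_ge0.
  by rewrite -[RHS](H _ (measurable_funeneg mF) F0); apply: eq_integral => x _; rewrite !funenegE.
Qed.

Lemma intble_measurable f : intble f -> measurable_fun setT f.
Proof. by move=> /measurable_int /measurable_EFinP. Qed.

Lemma intbleP f : measurable_fun setT f ->
  intble f <-> (\int[lam]_x `|f x|%:E < +oo)%E.
Proof.
move=> mf; split=> [/integrableP[] //|H].
by apply/integrableP; split => //; exact/measurable_EFinP.
Qed.

Lemma intble_le f g : measurable_fun setT f -> (forall x, `|f x| <= g x) ->
  intble g -> intble f.
Proof.
move=> mf fg; apply: le_integrable => //; first exact/measurable_EFinP.
move=> x _; rewrite /= lee_fin (le_trans (fg x))// ler_norm//.
Qed.

Lemma intbleD f g : intble f -> intble g -> intble (fun x => f x + g x).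
Proof. by move=> If Ig; exact: (integrableD measurableT If Ig). Qed.

Lemma intbleZ c f : intble f -> intble (fun x => c * f x).
Proof. by move=> If; exact: (integrableZl measurableT c If). Qed.

Lemma intbleB f g : intble f -> intble g -> intble (fun x => f x - g x).
Proof. by move=> If Ig; exact: (integrableB measurableT If Ig). Qed.

Lemma intble_sum (I : Type) (s : seq I) (f : I -> Bor R n -> R) :
  (forall j : I, intble (f j)) -> intble (fun x => \sum_(j <- s) f j x).
Proof.
move=> If; elim: s => [|j s IH].
  by under eq_fun do rewrite big_nil; exact: integrable0.
by under eq_fun do rewrite big_cons; exact: intbleD.
Qed.

Lemma rI_E f : intble f -> (\int[lam]_x (f x)%:E = (rI f)%:E)%E.
Proof.
by move=> If; rewrite /rI /Rintegral fineK//; exact: (integrable_fin_num measurableT If).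
Qed.

Lemma rID f g : intble f -> intble g -> rI (fun x => f x + g x) = rI f + rI g.
Proof. by move=> If Ig; rewrite /rI RintegralD. Qed.

Lemma rIB f g : intble f -> intble g -> rI (fun x => f x - g x) = rI f - rI g.
Proof. by move=> If Ig; rewrite /rI RintegralB. Qed.

Lemma rIZ c f : intble f -> rI (fun x => c * f x) = c * rI f.
Proof. by move=> If; rewrite /rI RintegralZl. Qed.

Lemma rI_sum (I : Type) (s : seq I) (f : I -> Bor R n -> R) :
  (forall j : I, intble (f j)) ->
  rI (fun x => \sum_(j <- s) f j x) = \sum_(j <- s) rI (f j).
Proof.
move=> If; elim: s => [|j s IH].
  under eq_fun do rewrite big_nil; rewrite big_nil /rI /Rintegral.
  by rewrite integral0.
under eq_fun do rewrite big_cons; rewrite big_cons rID// ?IH//.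
exact: intble_sum.
Qed.

Lemma intble_shift f (a : 'rV[R]_n) : intble f ->
  intble (fun x => f (a + (x : 'rV[R]_n))) /\ rI (fun x => f (a + (x : 'rV[R]_n))) = rI f.
Proof.
move=> If; have mf := intble_measurable If.
have E (F : Bor R n -> \bar R) : measurable_fun setT F ->
    (\int[lam]_x F (a + (x : 'rV[R]_n))%R = \int[lam]_x F x)%E.
  move=> mF; rewrite -[RHS](bor_integral_shift a mF).
  by apply: eq_integral => x _; rewrite addrC.
have ma : measurable_fun setT (fun x : Bor R n => f (a + (x : 'rV[R]_n))).
  have := measurableT_comp mf (measurable_shift a).
  by congr measurable_fun; apply/funext => x /=; rewrite addrC.
split; last by congr fine; apply: (E (EFin \o f)); exact/measurable_EFinP.
apply/(intbleP ma); rewrite (E (fun x => `|f x|%:E)).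
  by have /(intbleP mf) := If.
by apply/measurable_EFinP; apply: measurableT_comp => //; exact: normr_measurable.
Qed.

Lemma rI_norm_le f g : measurable_fun setT f -> (forall x, `|f x| <= g x) -> intble g ->
  `|rI f| <= rI g.
Proof.
move=> mf fg Ig; have If := intble_le mf fg Ig.
rewrite -lee_fin -(rI_E Ig) -[X in (X <= _)%E]abse_EFin -(rI_E If).
apply: le_trans (le_abse_integral _ _ _) _ => //; first exact/measurable_EFinP.
apply: ge0_le_integral => //.
- by apply/measurable_EFinP; apply: measurableT_comp => //; exact: normr_measurable.
- by apply/measurable_EFinP; exact: intble_measurable.
- by move=> x _; rewrite lee_fin.
Qed.

Lemma rI_ge0 f : (forall x, 0 <= f x) -> 0 <= rI f.
Proof. by move=> f0; apply: fine_ge0; apply: integral_ge0 => x _; rewrite lee_fin. Qed.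

Lemma rI_dominated (f_ : nat -> Bor R n -> R) f g :
  (forall k, measurable_fun setT (f_ k)) -> measurable_fun setT f ->
  (forall x, f_ k x @[k --> \oo] --> f x) -> intble g ->
  (forall k x, `|f_ k x| <= g x) ->
  intble f /\ rI (f_ k) @[k --> \oo] --> rI f.
Proof.
move=> mf_ mf cf Ig fg.
have [] := @dominated_convergence _ _ _ lam setT measurableT (fun k => EFin \o f_ k)
    (EFin \o f) (EFin \o g) _ _ _ Ig _.
- by move=> k; exact/measurable_EFinP.
- exact/measurable_EFinP.
- by apply: aeW => x _; apply: cvg_EFin; [exact: nearW|exact: cf].
- by apply: aeW => x k _; rewrite lee_fin.
move=> If _ cI; split => //.
have E k : (\int[lam]_x (EFin \o f_ k) x = (rI (f_ k))%:E)%E.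
  by apply: rI_E; apply: intble_le (fg k) Ig.
have cI' : (rI (f_ k))%:E @[k --> \oo] --> (rI f)%:E.
  by rewrite -(rI_E If); apply: cvg_trans cI; under eq_fun do rewrite -E.
exact: (fine_cvg cI').
Qed.

Lemma continuous_measurable_bor (f : 'rV[R]_n -> R) : continuous f ->
  measurable_fun setT (f : Bor R n -> R).
Proof.
move=> cf; apply: (measurability _ (RGenOInfty.measurableE R)) => _ [_ [a ->] <-].
rewrite setTI; apply: sub_sigma_algebra.
by apply: open_comp; last exact: interval_open.
Qed.

(** The indicator of [-r, r]^n, written as a product so that its integral factors. *)
Definition cube (r : R) (x : 'rV[R]_n) : R := \prod_(i < n) \1_(`[- r, r]%classic) (x ord0 i).

Lemma cube_ge0 r x : 0 <= cube r x.
Proof. by apply: prodr_ge0. Qed.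

Lemma cube1 r x : (forall i, `|x ord0 i| <= r) -> cube r x = 1.
Proof.
by move=> H; apply: big1 => i _; rewrite indicE mem_set//= in_itv/= -ler_norml.
Qed.

Lemma cube0 r x i : r < `|x ord0 i| -> cube r x = 0.
Proof.
move=> H; rewrite /cube (bigD1 i)//= indicE memNset ?mul0r//=.
by rewrite in_itv/= -ler_norml leNgt H.
Qed.

Lemma cubeP r x : (forall i, `|x ord0 i| <= r) \/ exists i, r < `|x ord0 i|.
Proof.
have [H|/existsNP[i /negP]] := pselect (forall i, `|x ord0 i| <= r); first by left.
by rewrite -ltNge => H; right; exists i.
Qed.

Lemma cube_intble r : intble (cube r).
Proof.
pose f (i : 'I_n) (t : R) := \1_(`[- r, r]%classic : set R) t : R.
have mf i : measurable_fun setT (f i) by apply: measurable_indic; exact: measurable_itv.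
have mc : measurable_fun setT (cube r : Bor R n -> R) by exact: (@measurable_prod_coord _ _ f).
apply/intbleP => //; under eq_integral do rewrite ger0_norm ?cube_ge0//.
apply: (@le_lt_trans _ _ (((`|2 * r|) ^+ n)%:E)); last exact: ltry.
apply: (@integral_bor_prod_le _ n f) => // i.
rewrite /f integral_indic//= setIT lebesgue_measure_itv/= lte_fin.
case: ifPn => _; last by rewrite lee_fin.
rewrite -EFinB lee_fin; apply: le_trans (ler_norm _); lra.
Qed.

Lemma continuous_cube_bounded (f : 'rV[R]_n -> R) (r : R) : continuous f ->
  exists2 M : R, 0 <= M & forall x, (forall i, `|x ord0 i| <= r) -> `|f x| <= M.
Proof.
move=> cf; pose A := [set v : 'rV[R]_n | forall i, `[- r, r]%classic (v ord0 i)].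
have cA : compact A by apply: (@rV_compact _ n (fun=> `[- r, r]%classic)) => i; exact: segment_compact.
have /compact_bounded[M [_ HM]] : compact (f @` A).
  by apply: continuous_compact => //; exact: continuous_subspaceT.
exists (`|M| + 1) => [|x Hx]; first by rewrite addr_ge0.
apply: (HM (`|M| + 1)); first by rewrite (le_lt_trans (ler_norm M))// ltrDl.
by exists x => // i; rewrite /= in_itv/= -ler_norml.
Qed.

Definition bdd_supp (f : 'rV[R]_n -> R) := exists r : R, forall x i, r < `|x ord0 i| -> f x = 0.

Lemma cont_bdd_supp_le f : continuous f -> bdd_supp f ->
  exists M r : R, [/\ 0 <= M & forall x, `|f x| <= M * cube r x].
Proof.
move=> cf [r Hr]; have [M M0 HM] := continuous_cube_bounded r cf.
exists M, r; split => // x; have [H|[i Hi]] := cubeP r x.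
  by rewrite (cube1 H) mulr1 HM.
by rewrite (Hr _ _ Hi) normr0 (cube0 Hi) mulr0.
Qed.

Lemma cont_bdd_supp_intble f : continuous f -> bdd_supp f -> intble f.
Proof.
move=> cf bf; have [M [r [M0 H]]] := cont_bdd_supp_le cf bf.
apply: intble_le H _; first exact: continuous_measurable_bor.
by apply: intbleZ; exact: cube_intble.
Qed.

(* |f| <= 1 + |f|^q makes an L^q function locally integrable. *)
Lemma powR_loc_intble (f : Bor R n -> R) (psi : 'rV[R]_n -> R) (q : R) :
  1 <= q -> measurable_fun setT f -> (\int[lam]_x (`|f x| `^ q)%:E < +oo)%E ->
  continuous psi -> bdd_supp psi -> intble (fun x => f x * psi x).
Proof.
move=> q1 mf fq cp bp; have [M [r [M0 H]]] := cont_bdd_supp_le cp bp.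
have Iq : intble (fun x => `|f x| `^ q).
  have mq : measurable_fun setT (fun x : Bor R n => `|f x| `^ q).
    apply: (measurableT_comp (measurable_powR _)).
    by apply: measurableT_comp => //; exact: normr_measurable.
  apply/intbleP => //; under eq_integral do rewrite ger0_norm ?powR_ge0//.
  exact: fq.
apply: (@intble_le _ (fun x => M * cube r x + M * `|f x| `^ q)).
- by apply: measurable_funM => //; exact: continuous_measurable_bor.
- move=> x; rewrite normrM.
  have c0 := cube_ge0 r x.
  have c1 : cube r x <= 1.
    by have [h|[i h]] := cubeP r x; rewrite ?(cube1 h) ?(cube0 h).
  have p0 : 0 <= `|f x| `^ q by exact: powR_ge0.
  have [f1|f1] := leP `|f x| 1.
    apply: (@le_trans _ _ (1 * `|psi x|)); first by rewrite ler_wpM2r.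
    by rewrite mul1r (le_trans (H x))// lerDl mulr_ge0.
  have fle : `|f x| <= `|f x| `^ q by rewrite le1r_powR// ltW.
  apply: (@le_trans _ _ (`|f x| `^ q * (M * cube r x))); first exact: ler_pM.
  apply: (@le_trans _ _ (`|f x| `^ q * M)); last by rewrite mulrC lerDr mulr_ge0.
  by rewrite ler_wpM2l// ler_piMr.
- by apply: intbleD; apply: intbleZ => //; exact: cube_intble.
Qed.

Lemma is_derive_along (psi : 'rV[R]_n -> R) (x v : 'rV[R]_n) (t : R) :
  derivable psi (t *: v + x) v ->
  is_derive t (1 : R) (fun h : R => psi (h *: v + x)) ('D_v psi (t *: v + x)).
Proof.
move=> dp.
have E : (fun h : R => h^-1 *: (psi ((h *: (1 : R) + t) *: v + x) - psi (t *: v + x))) =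
         (fun h : R => h^-1 *: (psi (h *: v + (t *: v + x)) - psi (t *: v + x))).
  by apply/funext => h; rewrite [h *: (1 : R)](mulr1 h) scalerDl addrA.
split; first by move: dp; rewrite /derivable /= E.
by rewrite /derive /= E.
Qed.

(** Difference quotients of [psi] integrate to 0 by translation invariance. The mean value theorem
    bounds them by a multiple of the indicator of a cube, so dominated convergence passes to the
    derivative. *)
Lemma integral_derive_eq0 (psi : 'rV[R]_n -> R) (i : 'I_n) :
  continuous psi -> (forall x, derivable psi x (evec R i)) ->
  continuous (fun x => 'D_(evec R i) psi x) -> bdd_supp psi ->
  rI (fun x => 'D_(evec R i) psi x) = 0.
Proof.
move=> cp dp cdp [r Hr]; pose e := evec R i.
have bp : bdd_supp psi by exists r.
have Ip := cont_bdd_supp_intble cp bp.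
have mp := continuous_measurable_bor cp.
(* A step of length at most 1 leads from the cube of half-side r + 1 into that of half-side r + 2;
   outside the former the difference quotients vanish. *)
have [M M0 HM] := continuous_cube_bounded (r + 2) cdp.
pose h (k : nat) : R := k.+1%:R^-1.
have h0 k : 0 < h k by rewrite invr_gt0.
have h1 k : h k <= 1 by rewrite invf_le1// ler1n.
pose f_ k (x : Bor R n) := (h k)^-1 * (psi (h k *: e + (x : 'rV[R]_n)) - psi x).
have eh (t : R) (x : 'rV[R]_n) j : `|t| <= 1 -> `|(t *: e + x) ord0 j| <= `|x ord0 j| + 1.
  move=> t1; rewrite !mxE (le_trans (ler_normD _ _))// addrC lerD2l.
  rewrite normrM; apply: le_trans (_ : `|t| * 1 <= _); last by rewrite mulr1.
  by rewrite ler_wpM2l//; case: (_ && _); rewrite ?normr1 ?normr0.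
have bound k x : `|f_ k x| <= M * cube (r + 1) x.
  have [H|[j Hj]] := cubeP (r + 1) x; last first.
    rewrite (cube0 Hj) mulr0 /f_ (Hr x j); last by lra.
    rewrite (Hr (h k *: e + (x : 'rV[R]_n)) j) ?subrr ?mulr0 ?normr0//.
    have hk : `|- h k| <= 1 by rewrite normrN gtr0_norm.
    have := eh (- h k) (h k *: e + (x : 'rV[R]_n)) j hk.
    by rewrite addrA -scalerDl addNr scale0r add0r; lra.
  rewrite (cube1 H) mulr1.
  have dl t : is_derive t (1 : R) (fun u : R => psi (u *: e + (x : 'rV[R]_n)))
      ('D_e psi (t *: e + (x : 'rV[R]_n))).
    by apply: is_derive_along; exact: dp.
  have [|c] := @MVT R (fun u : R => psi (u *: e + (x : 'rV[R]_n)))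
    (fun u => 'D_e psi (u *: e + (x : 'rV[R]_n))) 0 (h k) (h0 k).
    by apply: derivable_within_continuous => t _; have ? := dl t; exact: ex_derive.
  rewrite in_itv/= scale0r add0r subr0 => /andP[c0 ck] E.
  rewrite /f_ E mulrCA mulVf ?gt_eqF// mulr1; apply: HM => j.
  apply: le_trans (eh _ _ _ _) _; first by rewrite gtr0_norm// (le_trans (ltW ck)).
  by have := H j; lra.
have lim x : f_ k x @[k --> \oo] --> 'D_e psi x.
  have /cvgr_dnbhsP H : (fun t : R => t^-1 * (psi (t *: e + x) - psi x)) @ 0^' --> 'D_e psi x.
    exact: (dp x).
  apply: (H h); split; first by move=> k; rewrite gt_eqF.
  exact: cvg_harmonic.
have Ish k := intble_shift (h k *: e) Ip.
have mf k : measurable_fun setT (f_ k).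
  by apply: measurable_funM => //; apply: measurable_funB => //; exact: intble_measurable (Ish k).1.
have [] := rI_dominated mf (continuous_measurable_bor cdp) lim
  (intbleZ M (cube_intble (r + 1))) bound.
have I0 k : rI (f_ k) = 0.
  have [I1 I2] := Ish k.
  by rewrite /f_ rIZ ?rIB ?I2 ?subrr ?mulr0//; exact: intbleB.
rewrite (_ : (fun k => rI (f_ k)) = fun=> 0); last exact/funext.
by move=> _ /(cvg_unique _ (cvg_cst (0 : R))) => <-.
Qed.

End integrals.

(** * Integration by parts and the fundamental lemma *)

Section test_functions.
Context {R : realType} {n : nat}.
Local Notation lam := (bor_measure R n).
Implicit Types (x : 'rV[R]_n).

Lemma enorm_continuous : continuous (@enorm R n).
Proof.
move=> x; apply: (@continuous_comp _ _ _ (fun y : 'rV[R]_n => \sum_(i < n) y ord0 i ^+ 2) Num.sqrt).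
  have := @Ck_cont R n 0 (fun y : 'rV[R]_n => \sum_(i < n) y ord0 i * y ord0 i).
  move=> H; have {H} := H (Ck_sum _ (fun i => CkM (Ck_coord 0 i) (Ck_coord 0 i))).
  by apply.
exact: sqrt_continuous.
Qed.

Lemma test_fun_bdd_supp (phi : 'rV[R]_n -> R) : test_fun phi -> bdd_supp phi.
Proof.
move=> [_ [r Hr]]; exists r => x i xi; apply: Hr.
exact: lt_le_trans xi (coord_le_enorm x i).
Qed.

Lemma derive_supp (phi : 'rV[R]_n -> R) (r : R) (v : 'rV[R]_n) :
  (forall x, r < enorm x -> phi x = 0) -> forall x, r < enorm x -> 'D_v phi x = 0.
Proof.
move=> H x rx; rewrite -[RHS](derive_cst (0 : R) x v); apply: near_eq_derive.
have : \forall y \near x, r < enorm y by exact: (@enorm_continuous x _ (lt_nbhsr rx)).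
by apply: filterS => y ry; rewrite H.
Qed.

Lemma test_fun_derive_bdd_supp (phi : 'rV[R]_n -> R) (i : 'I_n) : test_fun phi ->
  bdd_supp (fun x => 'D_(evec R i) phi x).
Proof.
move=> [_ [r Hr]]; exists r => x j xj; apply: derive_supp Hr _ _.
exact: lt_le_trans xj (coord_le_enorm x j).
Qed.

Lemma rintE (f : Bor R n -> R) : intble f -> rint (f : 'rV[R]_n -> R) = (rI f)%:E.
Proof.
move=> If; have mf := intble_measurable If; rewrite -rI_E// integralE.
have E1 : (fun x : Bor R n => (Num.max (f x) 0)%:E) = ((EFin \o f)^\+)%E.
  by apply/funext => x; rewrite funeposE /= EFin_max.
have E2 : (fun x : Bor R n => (Num.max (- f x) 0)%:E) = ((EFin \o f)^\-)%E.
  by apply/funext => x; rewrite funenegE /= EFin_max.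
have me : measurable_fun setT (EFin \o f) by exact/measurable_EFinP.
rewrite /rint -[X in (X - _)%E]/(iint (fun x : Bor R n => (Num.max (f x) 0)%:E)).
rewrite -[X in (_ - X)%E]/(iint (fun x : Bor R n => (Num.max (- f x) 0)%:E)) E1 E2.
congr (_ - _)%E; apply: iintE.
- exact: measurable_funepos.
- by move=> x; exact: funepos_ge0.
- exact: measurable_funeneg.
- by move=> x; exact: funeneg_ge0.
Qed.

Lemma Ck1P (f : 'rV[R]_n -> R) i : Ck 1 f ->
  (forall x, derivable f x (evec R i)) /\ continuous (fun x => 'D_(evec R i) f x).
Proof. by move=> [_ /(_ i)[df Df]]; split => //; case: Df. Qed.

Lemma integration_by_parts_C1 (v phi : 'rV[R]_n -> R) i : Ck 1 v -> test_fun phi ->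
  rI (fun x => v x * 'D_(evec R i) phi x) = - rI (fun x => 'D_(evec R i) v x * phi x).
Proof.
move=> Cv tp; have Cp : Ck 1 phi by have [/smoothP] := tp.
have [dv cdv] := Ck1P i Cv; have [dp cdp] := Ck1P i Cp.
have [r Hr] := test_fun_bdd_supp tp; have [r' Hr'] := test_fun_derive_bdd_supp i tp.
have cv := Ck_cont Cv; have cp := Ck_cont Cp.
have D x : 'D_(evec R i) (fun y => v y * phi y) x =
    v x * 'D_(evec R i) phi x + 'D_(evec R i) v x * phi x.
  by rewrite [LHS](deriveM (dv x) (dp x)) /GRing.scale/= [phi x * _]mulrC.
have c1 : continuous (fun x => v x * 'D_(evec R i) phi x).
  by move=> x; exact: (cvgM (cv x) (cdp x)).
have c2 : continuous (fun x => 'D_(evec R i) v x * phi x).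
  by move=> x; exact: (cvgM (cdv x) (cp x)).
have I1 := cont_bdd_supp_intble c1; have I2 := cont_bdd_supp_intble c2.
apply/eqP; rewrite -addr_eq0 -rID; last 2 first.
- by apply: I1; exists r' => x j h; rewrite (Hr' x j h) mulr0.
- by apply: I2; exists r => x j h; rewrite (Hr x j h) mulr0.
under [X in rI X]eq_fun do rewrite -D; apply/eqP.
apply: integral_derive_eq0.
- by move=> x; exact: (cvgM (cv x) (cp x)).
- by move=> x; exact: (derivableM (dv x) (dp x)).
- by under eq_fun do rewrite D; move=> x; exact: (cvgD (c1 x) (c2 x)).
- by exists r => x j h; rewrite (Hr x j h) mulr0.
Qed.

Definition box (a b : 'I_n -> R) : set (Bor R n) :=
  [set x | forall i, a i < (x : 'rV[R]_n) ord0 i < b i].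

Lemma bump_term1E (e t : R) : bump_term e 1 t = if 0 < t then expR (- (e / t)) else 0.
Proof. by rewrite /bump_term hornerC mul1r. Qed.

Lemma bump_term1_le1 (e t : R) : 0 < e -> 0 <= bump_term e 1 t <= 1.
Proof.
move=> e0; rewrite bump_term1E; case: ifPn => t0; last by rewrite lexx ler01.
by rewrite expR_ge0/= -[leRHS]expR0 ler_expR oppr_le0 divr_ge0// ltW.
Qed.

Lemma cvg_bigprod (I : Type) (s : seq I) (f : I -> nat -> R) (l : I -> R) :
  (forall j, f j k @[k --> \oo] --> l j) ->
  \prod_(j <- s) f j k @[k --> \oo] --> \prod_(j <- s) l j.
Proof.
move=> fl; elim: s => [|j s IH].
  rewrite (_ : (fun k => _) = fun=> 1); first by rewrite big_nil; exact: cvg_cst.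
  by apply/funext => k; rewrite big_nil.
rewrite (_ : (fun k => _) = fun k => f j k * \prod_(j <- s) f j k).
  by rewrite big_cons; apply: cvgM.
by apply/funext => k; rewrite big_cons.
Qed.

Lemma bump_term1_cvg (t : R) :
  bump_term k.+1%:R^-1 1 t @[k --> \oo] --> ((0 < t)%R%:R : R).
Proof.
have [t0|t0] := ltP 0 t; last first.
  rewrite (_ : (fun k : nat => _) = fun=> 0); first exact: cvg_cst.
  by apply/funext => k; rewrite bump_term1E ltNge t0.
rewrite (_ : (fun k : nat => _) = fun k => expR (- (k.+1%:R^-1 * t^-1))); last first.
  by apply/funext => k; rewrite bump_term1E t0.
have c : - (k.+1%:R^-1 * t^-1) @[k --> \oo] --> - (0 * t^-1).
  by apply: cvgN; apply: cvgMl; exact: cvg_harmonic.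
have := cvg_comp _ _ c (@continuous_expR R _).
by rewrite mul0r oppr0 expR0.
Qed.

(** Test functions lying below the indicator of the open box and converging to it pointwise as [e]
    tends to 0; this is why the bump carries the parameter [e]. *)
Definition box_bump (a b : 'I_n -> R) (e : R) (x : 'rV[R]_n) : R :=
  \prod_(i < n) (bump_term e 1 (x ord0 i - a i) * bump_term e 1 (b i - x ord0 i)).

Lemma box_bump_test a b (e : R) : 0 < e -> test_fun (box_bump a b e).
Proof.
move=> e0; split.
  apply/smoothP => k; apply: Ck_prod => i; apply: CkM; apply: Ck_bump => //.
  - by apply: CkD; [exact: Ck_coord|exact: Ck_cst].
  - apply: CkD; first exact: Ck_cst.
    have := CkM (@Ck_cst R n k (-1)) (Ck_coord k i).
    by under eq_fun do rewrite mulN1r.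
exists (Num.sqrt (\sum_(i < n) (`|a i| + `|b i|) ^+ 2)) => x H.
apply/eqP; apply: contraTT H => nz; rewrite -leNgt ler_sqrt; last first.
  by apply: sumr_ge0 => i _; exact: sqr_ge0.
apply: ler_sum => i _; rewrite -(real_normK (num_real (x ord0 i))).
rewrite ler_pXn2r ?nnegrE ?addr_ge0//.
have : bump_term e 1 (x ord0 i - a i) * bump_term e 1 (b i - x ord0 i) != 0.
  by move: nz; rewrite /box_bump (bigD1 i)//= mulf_eq0 negb_or => /andP[].
rewrite !bump_term1E mulf_eq0 negb_or; case: ifPn; last by rewrite eqxx.
move=> h1 /andP[_]; case: ifPn; last by rewrite eqxx.
move=> h2 _; have := ler_norm (b i); have := ler_norm (- a i); rewrite normrN => ha hb.
have a0 := normr_ge0 (a i); have b0 := normr_ge0 (b i).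
by rewrite ler_norml; lra.
Qed.

Lemma box_bump_cvg a b x : box_bump a b k.+1%:R^-1 x @[k --> \oo] --> (\1_(box a b) x : R).
Proof.
have -> : (\1_(box a b) x : R) =
    \prod_(i < n) ((0 < x ord0 i - a i)%R%:R * (0 < b i - x ord0 i)%R%:R).
  rewrite indicE; have [H|/existsNP[i Hi]] := pselect (box a b x).
    rewrite mem_set// big1// => i _; have /andP[h1 h2] := H i.
    by rewrite !subr_gt0 h1 h2 mulr1.
  rewrite memNset; last by move=> /(_ i).
  rewrite (bigD1 i)//= !subr_gt0 -natrM mulnb.
  by move/negP/negbTE: Hi => ->; rewrite mul0r.
by apply: cvg_bigprod => i; apply: cvgM; exact: bump_term1_cvg.
Qed.

Lemma box_measurable a b : measurable (box a b).
Proof.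
have -> : box a b = \bigcap_(i in [set: 'I_n])
    ((fun x : Bor R n => (x : 'rV[R]_n) ord0 i) @^-1` `]a i, b i[%classic).
  apply/seteqP; split => [x H i _|x H i]; rewrite /= ?in_itv/=; first exact: H.
  by have := H i Logic.I; rewrite /= in_itv.
apply: fin_bigcap_measurable => // i _; rewrite -[X in measurable X]setTI.
by apply: measurable_coord => //; exact: measurable_itv.
Qed.

Definition boxes : set (set (Bor R n)) := [set A | exists a b, A = box a b].

Lemma boxes_setI : setI_closed boxes.
Proof.
move=> _ _ [a [b ->]] [c [d ->]].
exists (fun i => Num.max (a i) (c i)), (fun i => Num.min (b i) (d i)).
apply/seteqP; split => [x [H1 H2] i|x H].
  have /andP[h1 h2] := H1 i; have /andP[h3 h4] := H2 i.
  by rewrite gt_max h1 h3 lt_min h2 h4.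
by split=> i; have := H i; rewrite gt_max lt_min => /andP[/andP[h1 h2] /andP[h3 h4]];
  rewrite ?h1 ?h2 ?h3 ?h4.
Qed.

(** The identity from R^n with the sigma-algebra of the boxes to [Bor] is measurable, because every
    half space {x_i > c} is a countable union of boxes. *)
Lemma boxes_generate (A : set (Bor R n)) : measurable A -> <<s boxes >> A.
Proof.
move=> mA; pose T := g_sigma_algebraType boxes.
have mid : measurable_fun setT ((fun x : T => x) : T -> Bor R n).
  apply: measurable_to_Bor => i.
  apply: (measurability _ (RGenOInfty.measurableE R)) => _ [_ [c ->] <-].
  rewrite setTI.
  pose B (k : nat) := box (fun j => if j == i then c else - k%:R) (fun=> k%:R).
  have -> : (fun x : T => (x : 'rV[R]_n) ord0 i) @^-1` `]c, +oo[%classic = \bigcup_k B k.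
    apply/seteqP; split => [x|x [k _ /(_ i)]]; rewrite /= in_itv/= andbT; last first.
      by rewrite eqxx => /andP[].
    move=> cx; pose K := (Num.truncn (\sum_(j < n) `|(x : 'rV[R]_n) ord0 j|)).+1.
    have HK j : `|(x : 'rV[R]_n) ord0 j| < K%:R.
      apply: le_lt_trans (truncnS_gt _).
      by rewrite (bigD1 j)//= lerDl sumr_ge0.
    exists K => // j; have := HK j; rewrite ltr_norml => /andP[h1 h2].
    by rewrite h2 andbT; case: eqP => [->|].
  apply: bigcup_measurable => k _; apply: sub_sigma_algebra.
  by exists (fun j => if j == i then c else - k%:R), (fun=> k%:R).
by have := mid measurableT A mA; rewrite setTI.
Qed.

(** A pi-lambda argument: boxes are stable under intersection, and the sets over which the integral
    of [f] vanishes form a lambda system. The whole space and increasing unions are handled by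
    dominated convergence with majorant |f|. *)
Lemma integral_boxes_eq0 (f : Bor R n -> R) : intble f ->
  (forall a b, (\int[lam]_(x in box a b) (f x)%:E = 0)%E) ->
  forall A, measurable A -> (\int[lam]_(x in A) (f x)%:E = 0)%E.
Proof.
move=> If H A /boxes_generate.
have mf := intble_measurable If.
pose q (A : set (Bor R n)) := rI (fun x => f x * \1_A x).
have IA (B : set (Bor R n)) : measurable B -> intble (fun x => f x * \1_B x).
  move=> mB; apply: (@intble_le _ _ _ (fun x => `|f x|)).
  - by apply: measurable_funM => //; exact: measurable_indic.
  - by move=> x; rewrite indicE; case: (_ \in _); rewrite ?mulr1 ?mulr0 ?normr0.
  - exact: (integrable_abse If).
have qE (B : set (Bor R n)) : measurable B -> (\int[lam]_(x in B) (f x)%:E = (q B)%:E)%E.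
  move=> mB; rewrite -rI_E; last exact: IA.
  rewrite integral_mkcond; apply: eq_integral => x _.
  by rewrite patchE indicE; case: ifPn => _; rewrite ?mulr1 ?mulr0.
pose HH : set (set (Bor R n)) := [set B | measurable B /\ q B = 0].
have boxHH : boxes `<=` HH.
  move=> _ [a [b ->]]; split; first exact: box_measurable.
  by have := H a b; rewrite qE; [case|exact: box_measurable].
have LHH : lambda_system setT HH.
  split => //.
  - split; first exact: measurableT.
    pose Q (k : nat) := box (fun=> - k.+1%:R) (fun=> k.+1%:R).
    have [] := @rI_dominated R n (fun k x => f x * \1_(Q k) x) f (fun x => `|f x|).
    + by move=> k; apply: intble_measurable; apply: IA; exact: box_measurable.
    + exact: mf.
    + move=> x; rewrite -[X in _ --> X]mulr1; apply: cvgMr; apply: cvg_near_cst.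
      pose K := (Num.truncn (\sum_(j < n) `|(x : 'rV[R]_n) ord0 j|)).
      near=> k; rewrite indicE mem_set// => j.
      rewrite -ltr_norml; apply: (@le_lt_trans _ _ (\sum_(j < n) `|(x : 'rV[R]_n) ord0 j|)).
        by rewrite (bigD1 j)//= lerDl sumr_ge0.
      apply: (lt_le_trans (truncnS_gt _)); rewrite ler_nat ltnS.
      by near: k; exact: nbhs_infty_ge.
    + exact: (integrable_abse If).
    + by move=> k x; rewrite indicE; case: (_ \in _); rewrite ?mulr1 ?mulr0 ?normr0.
    move=> _; rewrite (_ : (fun k => rI _) = fun=> 0); last first.
      by apply/funext => k; have [_] := boxHH _ (ex_intro _ _ (ex_intro _ _ erefl) : boxes (Q k)).
    move=> cI; have E : 0 = rI f by move: cI => /(cvg_unique _ (cvg_cst (0 : R))) <-.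
    rewrite /q /= [RHS]E.
    by congr rI; apply/funext => x; rewrite indicT mulr1.
  - move=> B C CB [mB qB] [mC qC]; split; first exact: measurableD.
    rewrite /q -[RHS](subrr 0) -{1}qB -qC -rIB; [|exact: IA|exact: IA].
    congr rI; apply/funext => x; rewrite -mulrBr; congr (_ * _).
    rewrite !indicE; have [xC|xC] := pselect (C x).
      by rewrite memNset ?mem_set// ?subrr//; [exact: CB|move=> []].
    rewrite (memNset xC) subr0; have [xB|xB] := pselect (B x).
      by rewrite !mem_set.
    by rewrite !memNset// => -[].
  - move=> F ndF HF; split; first by apply: bigcup_measurable => k _; have [] := HF k.
    have [] := @rI_dominated R n (fun k x => f x * \1_(F k) x)
      (fun x => f x * \1_(\bigcup_k F k) x) (fun x => `|f x|).
    + by move=> k; apply: intble_measurable; apply: IA; have [] := HF k.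
    + apply: intble_measurable; apply: IA.
      by apply: bigcup_measurable => k _; have [] := HF k.
    + move=> x; apply: cvgMr; apply: cvg_near_cst.
      have [[K _ FK]|nF] := pselect ((\bigcup_k F k) x).
        have FU : (\bigcup_k F k) x by exists K.
        near=> k; rewrite !indicE (mem_set FU) mem_set//.
        have /subsetPset : (F K <= F k)%O by apply: ndF; near: k; exact: nbhs_infty_ge.
        exact.
      by near=> k; rewrite !indicE !memNset// => Fk; apply: nF; exists k.
    + exact: (integrable_abse If).
    + by move=> k x; rewrite indicE; case: (_ \in _); rewrite ?mulr1 ?mulr0 ?normr0.
    move=> _; rewrite (_ : (fun k => rI _) = fun=> 0); last first.
      by apply/funext => k; have [] := HF k.
    by rewrite /q; move=> /(cvg_unique _ (cvg_cst (0 : R))) <-.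
move=> /(lambda_system_subset boxes_setI LHH boxHH (fun _ _ _ _ => Logic.I))[mA qA].
by rewrite qE// qA.
Unshelve. all: by end_near. Qed.

(** The fundamental lemma of the calculus of variations. Bumps tending to indicators show that [h]
    has integral 0 over every box. Since [h] is only locally integrable, the passage to measurable
    sets is made on each cube [Q k], and countably many null sets are then combined. *)
Lemma ae_eq0_of_test (h : Bor R n -> R) : measurable_fun setT h ->
  (forall psi : 'rV[R]_n -> R, continuous psi -> bdd_supp psi -> intble (fun x => h x * psi x)) ->
  (forall phi, test_fun phi -> rI (fun x => h x * phi x) = 0) ->
  {ae lam, forall x, h x = 0}.
Proof.
move=> mh Lh Hh.
have mbox a b := @box_measurable a b.
have bump0 a b (e : R) x : 0 < e -> 0 <= box_bump a b e x.
  move=> e0; apply: prodr_ge0 => i _; apply: mulr_ge0.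
    by have /andP[] := bump_term1_le1 (x ord0 i - a i) e0.
  by have /andP[] := bump_term1_le1 (b i - x ord0 i) e0.
have bump_le a b (e : R) x : 0 < e -> box_bump a b e x <= \1_(box a b) x.
  move=> e0; rewrite indicE; have [H|/existsNP[i Hi]] := pselect (box a b x).
    rewrite mem_set//; apply: prodr_ile1 => i _.
    have /andP[h1 h2] := bump_term1_le1 (x ord0 i - a i) e0.
    have /andP[h3 h4] := bump_term1_le1 (b i - x ord0 i) e0.
    by rewrite mulr_ge0//= mulr_ile1.
  rewrite memNset; last by move=> /(_ i).
  rewrite /box_bump (bigD1 i)//= !bump_term1E !subr_gt0.
  by move/negP: Hi; rewrite negb_and => /orP[] /negbTE ->; rewrite ?mul0r ?mulr0 ?mul0r.
have bump_psi a b (e : R) : 0 < e -> intble (fun x => h x * box_bump a b e x).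
  move=> e0; have tb := box_bump_test a b e0.
  apply: Lh; last exact: test_fun_bdd_supp.
  by have [/smoothP/(_ 0%N)] := tb => /Ck_cont.
have boxI a b : intble (fun x => h x * \1_(box a b) x).
  (* Integrability is assumed only against continuous functions. The bump of the box enlarged by 1
     on every side exceeds the constant [c] on the original box, so it dominates the indicator up to
     the factor 1/c. *)
  pose a' i := a i - 1; pose b' i := b i + 1.
  pose c : R := (expR (-1) * expR (-1)) ^+ n.
  have c0 : 0 < c by rewrite exprn_gt0// mulr_gt0// expR_gt0.
  have bI := bump_psi a' b' 1 ltr01.
  apply: (@intble_le _ _ _ (fun x => c^-1 * `|h x * box_bump a' b' 1 x|)).
  - by apply: measurable_funM => //; exact: measurable_indic.
  - move=> x; rewrite !normrM mulrCA ler_wpM2l// indicE.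
    have [H|H] := pselect (box a b x); last first.
      by rewrite memNset// normr0 mulr_ge0// invr_ge0 ltW.
    rewrite mem_set// normr1 ger0_norm ?bump0// mulrC ler_pdivlMr// mul1r.
    rewrite /c -[X in _ ^+ X]card_ord -prodr_const; apply: ler_prod => i _.
    have /andP[h1 h2] := H i.
    have t1 : 1 < x ord0 i - a' i by rewrite /a'; lra.
    have t2 : 1 < b' i - x ord0 i by rewrite /b'; lra.
    have tb (t : R) : 1 < t -> expR (-1) <= bump_term 1 1 t.
      move=> t1'; have t0 : 0 < t by exact: lt_trans t1'.
      by rewrite bump_term1E t0 ler_expR lerN2 mul1r invf_le1// ltW.
    by rewrite mulr_ge0 ?expR_ge0//= ler_pM ?expR_ge0// tb.
  - by apply: intbleZ; exact: (integrable_abse bI).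
have box0 a b : rI (fun x => h x * \1_(box a b) x) = 0.
  have e0 (k : nat) : 0 < k.+1%:R^-1 :> R by rewrite invr_gt0.
  have [] := @rI_dominated R n (fun k x => h x * box_bump a b k.+1%:R^-1 x)
    (fun x => h x * \1_(box a b) x) (fun x => `|h x * \1_(box a b) x|).
  - by move=> k; apply: intble_measurable; exact: bump_psi.
  - by apply: intble_measurable; exact: boxI.
  - by move=> x; apply: cvgMr; exact: box_bump_cvg.
  - exact: (integrable_abse (boxI a b)).
  - move=> k x; rewrite !normrM ler_wpM2l// !ger0_norm ?bump0//; exact: bump_le.
  move=> _; rewrite (_ : (fun k => rI _) = fun=> 0); last first.
    by apply/funext => k; apply: Hh; exact: box_bump_test.
  by move=> /(cvg_unique _ (cvg_cst (0 : R))) <-.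
pose Q (k : nat) := box (fun=> - k%:R) (fun=> k%:R).
have aeQ k : {ae lam, forall x, h x * \1_(Q k) x = 0}.
  have Ik := boxI (fun=> - k%:R) (fun=> k%:R).
  have : ae_eq lam setT (EFin \o (fun x => h x * \1_(Q k) x)) (cst 0%E).
    apply: (@integral_ae_eq _ _ _ lam setT measurableT (cst 0%E) _ Ik) => //.
    move=> E _ mE; rewrite integral_cst// mul0e.
    apply: (integral_boxes_eq0 Ik) => // a b.
    have [c [d cd]] : boxes (Q k `&` box a b).
      by apply: boxes_setI; [exists (fun=> - k%:R), (fun=> k%:R)|exists a, b].
    rewrite integral_mkcond; transitivity (\int[lam]_x (h x * \1_(box c d) x)%:E)%E.
      apply: eq_integral => x _; rewrite patchE -cd.
      have [xb|xb] := pselect (box a b x).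
        rewrite mem_set// !indicE; congr ((_ * (nat_of_bool _)%:R)%:E)%R.
        by apply/idP/idP => /set_mem; [move=> H; apply/mem_set; split|move=> [H _]; exact/mem_set].
      by rewrite memNset// indicE memNset ?mulr0// => -[].
    by rewrite (rI_E (boxI c d)) box0.
  by apply: filterS => x /(_ Logic.I) [].
have := ae_foralln aeQ; apply: filterS => x Hx.
pose K := (Num.truncn (\sum_(j < n) `|(x : 'rV[R]_n) ord0 j|)).+1.
have := Hx K; rewrite indicE mem_set ?mulr1// => j; rewrite -ltr_norml.
apply: le_lt_trans (truncnS_gt _).
by rewrite (bigD1 j)//= lerDl sumr_ge0.
Qed.

End test_functions.

(** * The gradient of a bubble *)

Section bubble_calculus.
Context {R : realType} {n : nat}.
Local Notation lam := (bor_measure R n).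
Variables (xi : 'rV[R]_n) (l : R).
Hypotheses (l0 : 0 < l) (n2 : (2 < n)%N).
Implicit Types (x : 'rV[R]_n) (i : 'I_n).

Let n2R : 2 < n%:R :> R. Proof. by rewrite ltr_nat. Qed.

Definition sqdist x : R := \sum_(i < n) (x ord0 i - xi ord0 i) ^+ 2.
Definition bden x : R := 1 + l ^+ 2 * sqdist x.

Lemma sqdistE x : enorm (x - xi) ^+ 2 = sqdist x.
Proof. by rewrite enorm_sqr; apply: eq_bigr => i _; rewrite !mxE. Qed.

Lemma sqdist_ge0 x : 0 <= sqdist x.
Proof. by apply: sumr_ge0 => i _; exact: sqr_ge0. Qed.

Lemma sqcoord_le x i : (x ord0 i - xi ord0 i) ^+ 2 <= sqdist x.
Proof.
by rewrite /sqdist (bigD1 i)//= lerDl; apply: sumr_ge0 => j _; exact: sqr_ge0.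
Qed.

Lemma bden_ge1 x : 1 <= bden x.
Proof. by rewrite lerDl mulr_ge0 ?sqr_ge0// sqdist_ge0. Qed.

Lemma bden_gt0 x : 0 < bden x.
Proof. exact: lt_le_trans ltr01 (bden_ge1 x). Qed.

Lemma densE x : dens xi l x = l / bden x.
Proof. by rewrite /dens sqdistE. Qed.

Lemma is_derive_bigsum (I : Type) (s : seq I) (x v : 'rV[R]_n) (f : I -> 'rV[R]_n -> R) (df : I -> R) :
  (forall j, is_derive x v (f j) (df j)) ->
  is_derive x v (fun y => \sum_(j <- s) f j y) (\sum_(j <- s) df j).
Proof.
move=> H; elim: s => [|j s IH].
  rewrite big_nil (_ : (fun _ => _) = cst 0); first exact: is_derive_cst.
  by apply/funext => y; rewrite big_nil.
rewrite big_cons (_ : (fun _ => _) = f j + (fun y => \sum_(j <- s) f j y)).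
  exact: is_deriveD.
by apply/funext => y; rewrite big_cons.
Qed.

Lemma is_derive_sqdist i x :
  is_derive x (evec R i) sqdist (2 * (x ord0 i - xi ord0 i)).
Proof.
have -> : 2 * (x ord0 i - xi ord0 i) =
    \sum_(j < n) (2 * (x ord0 j - xi ord0 j) * (i == j)%:R).
  rewrite (bigD1 i)//= eqxx mulr1 big1 ?addr0// => j ji.
  by rewrite eq_sym (negbTE ji) mulr0.
apply: is_derive_bigsum => j.
apply: (@is_derive_comp_line _ _ (fun t => (t - xi ord0 j) ^+ 2)); last exact: is_derive_coord.
by apply: is_derive_eq; rewrite /GRing.scale/=; ring.
Qed.

Lemma is_derive_bden i x :
  is_derive x (evec R i) bden (l ^+ 2 * (2 * (x ord0 i - xi ord0 i))).
Proof.
apply: (@is_derive_comp_line _ _ (fun t => 1 + l ^+ 2 * t)); last exact: is_derive_sqdist.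
by apply: is_derive_eq; rewrite /GRing.scale/=; ring.
Qed.

Lemma is_derive_bden_powR i x (a : R) :
  is_derive x (evec R i) (fun y => bden y `^ a)
    (a * bden x `^ (a - 1) * (l ^+ 2 * (2 * (x ord0 i - xi ord0 i)))).
Proof.
apply: (@is_derive_comp_line _ _ (fun t => t `^ a)); last exact: is_derive_bden.
exact: is_derive1_powR (bden_gt0 x).
Qed.

Lemma Ck_sqdist k : Ck k sqdist.
Proof.
rewrite /sqdist; apply: Ck_sum => j.
have C : Ck k (fun x => x ord0 j - xi ord0 j).
  by apply: CkD; [exact: Ck_coord|exact: Ck_cst].
exact: (CkM C C).
Qed.

Lemma Ck_bden k : Ck k bden.
Proof.
apply: CkD; first exact: Ck_cst.
by apply: CkM; [exact: Ck_cst|exact: Ck_sqdist].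
Qed.

Lemma Ck_bden_powR k (a : R) : Ck k (fun x => bden x `^ a).
Proof.
(* The m-th derivative of t^a: a falling factorial times t^(a - m). *)
pose F (m : nat) (t : R) := (\prod_(j < m) (a - j%:R)) * t `^ (a - m%:R).
have -> : (fun x => bden x `^ a) = (fun x => F 0%N (bden x)).
  by apply/funext => x; rewrite /F big_ord0 mul1r subr0.
apply: (@Ck_comp _ _ _ [set t | 0 < t] F bden _ _ (Ck_bden k)).
- move=> m t /= t0; have ? := is_derive1_powR (a - m%:R) t0.
  rewrite /F big_ord_recr/=; apply: is_derive_eq; rewrite /GRing.scale/= mulrA.
  by congr (_ * powR _ _); rewrite -natr1; ring.
- by move=> x; exact: bden_gt0.
Qed.

(** Up to a constant factor, the i-th partial derivative of every bubble with parameters [xi] and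
    [l]. *)
Definition grad_profile i x : R := (x ord0 i - xi ord0 i) * bden x `^ (- (n%:R / 2)).

Lemma Ck_grad_profile k i : Ck k (grad_profile i).
Proof.
apply: CkM; last exact: Ck_bden_powR.
by apply: CkD; [exact: Ck_coord|exact: Ck_cst].
Qed.

Lemma is_deriveM_fun (f g : 'rV[R]_n -> R) x v (a b : R) :
  is_derive x v f a -> is_derive x v g b ->
  is_derive x v (fun y => f y * g y) (f x * b + g x * a).
Proof. by move=> hf hg; exact: (is_deriveM hf hg). Qed.

Lemma derive_grad_profile i x : 'D_(evec R i) (grad_profile i) x =
  bden x `^ (- (n%:R / 2) - 1) * (bden x - n%:R * l ^+ 2 * (x ord0 i - xi ord0 i) ^+ 2).
Proof.
have dc : is_derive x (evec R i) (fun y => y ord0 i - xi ord0 i) 1.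
  rewrite -[X in is_derive _ _ _ X]mulr1; apply: (@is_derive_comp_line _ _ (fun t => t - xi ord0 i)).
    by apply: is_derive_eq; rewrite subr0.
  by have := is_derive_coord i i x; rewrite eqxx.
have := is_deriveM_fun dc (is_derive_bden_powR i x (- (n%:R / 2))).
move=> H; have -> := @derive_val _ _ _ _ _ _ _ H.
have -> : bden x `^ (- (n%:R / 2)) = bden x `^ (- (n%:R / 2) - 1) * bden x.
  rewrite -{3}(powRr1 (ltW (bden_gt0 x))) -powRD; first by congr powR; ring.
  by rewrite (gt_eqF (bden_gt0 x)) implybT.
by field.
Qed.

Lemma derive_grad_profile_le i x :
  `|'D_(evec R i) (grad_profile i) x| <= (1 + n%:R) * bden x `^ (- (n%:R / 2)).
Proof.
have -> : bden x `^ (- (n%:R / 2)) = bden x `^ (- (n%:R / 2) - 1) * bden x.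
  rewrite -{3}(powRr1 (ltW (bden_gt0 x))) -powRD; first by congr powR; ring.
  by rewrite (gt_eqF (bden_gt0 x)) implybT.
rewrite derive_grad_profile normrM ger0_norm ?powR_ge0// [leRHS]mulrCA ler_wpM2l ?powR_ge0//.
have h := sqcoord_le x i; have l2 : 0 <= l ^+ 2 by exact: sqr_ge0.
have z2 := sqr_ge0 (x ord0 i - xi ord0 i).
have h1 : l ^+ 2 * (x ord0 i - xi ord0 i) ^+ 2 <= bden x.
  apply: (@le_trans _ _ (l ^+ 2 * sqdist x)); first by rewrite ler_wpM2l.
  by rewrite /bden lerDr.
have h0 : 0 <= l ^+ 2 * (x ord0 i - xi ord0 i) ^+ 2 by rewrite mulr_ge0.
have n0 : 0 <= n%:R :> R by [].
have b0 := bden_gt0 x.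
rewrite (le_trans (ler_normB _ _))// mulrDl mul1r (ger0_norm (ltW b0)) lerD2l.
by rewrite -mulrA (ger0_norm (mulr_ge0 n0 h0)) ler_wpM2l.
Qed.

(** The quadratic terms cancel on summation. Up to constants this is the bubble equation: minus the
    Laplacian of rho^((n-2)/2) is a multiple of rho^((n+2)/2). *)
Lemma sum_derive_grad_profile x : \sum_(i < n) 'D_(evec R i) (grad_profile i) x =
  n%:R * bden x `^ (- ((n%:R + 2) / 2)).
Proof.
under eq_bigr do rewrite derive_grad_profile.
rewrite -mulr_sumr sumrB -mulr_sumr -/(sqdist x) sumr_const card_ord.
rewrite (_ : - (n%:R / 2) - 1 = - ((n%:R + 2) / 2)); last by field.
rewrite mulrC; congr (_ * _); rewrite /bden -mulr_natl; ring.
Qed.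

(** The factor [expR 1] normalises the value at [xi] to 1; the function vanishes at distance at
    least r from [xi]. *)
Definition cutoff (r : R) x : R := expR 1 * bump_term 1 1 (1 - sqdist x * r^-2).

Lemma cutoff_bounds r x : 0 <= cutoff r x <= 1.
Proof.
have /andP[h1 h2] := bump_term1_le1 (1 - sqdist x * r^-2) (@ltr01 R).
rewrite mulr_ge0 ?expR_ge0//= /cutoff bump_term1E; case: ifPn => t0; last by rewrite mulr0.
rewrite -expRD -[leRHS]expR0 ler_expR mul1r subr_le0 invf_ge1//.
by rewrite lerBlDr lerDl mulr_ge0 ?sqdist_ge0// invr_ge0 sqr_ge0.
Qed.

Lemma test_fun_cutoff r (f : 'rV[R]_n -> R) : 0 < r -> (forall k, Ck k f) ->
  test_fun (fun x => f x * cutoff r x).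
Proof.
move=> r0 Cf; split.
  apply/smoothP => k; apply: CkM => //; apply: CkM; first exact: Ck_cst.
  apply: Ck_bump => //; apply: CkD; first exact: Ck_cst.
  rewrite (_ : (fun x => - (sqdist x * r^-2)) = fun x => (- r^-2) * sqdist x).
    by apply: CkM; [exact: Ck_cst|exact: Ck_sqdist].
  by apply/funext => x; rewrite mulNr mulrC.
exists (Num.sqrt (\sum_(i < n) (r + `|xi ord0 i|) ^+ 2)) => x H.
apply/eqP; apply: contraTT H; rewrite mulf_eq0 negb_or => /andP[_ nz]; rewrite -leNgt.
rewrite ler_sqrt; last by apply: sumr_ge0 => i _; exact: sqr_ge0.
have sr : sqdist x <= r ^+ 2.
  move: nz; rewrite /cutoff mulf_eq0 negb_or bump_term1E => /andP[_].
  case: ifPn; last by rewrite eqxx.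
  move=> h _; move: h; rewrite subr_gt0 ltr_pdivrMr ?exprn_gt0// mul1r; exact: ltW.
apply: ler_sum => i _; rewrite -(real_normK (num_real (x ord0 i))).
rewrite ler_pXn2r ?nnegrE ?addr_ge0 ?(ltW r0)//.
have : `|x ord0 i - xi ord0 i| <= r.
  rewrite -(ler_pXn2r (n := 2)) ?nnegrE ?(ltW r0)// real_normK ?num_real//.
  exact: le_trans (sqcoord_le x i) sr.
by move=> h; rewrite -[x ord0 i](subrK (xi ord0 i)) (le_trans (ler_normD _ _))// lerD2r.
Qed.

(** For u = 1/t > 0 the value is u^2 exp(-u), and u^2 / 2! <= exp u. *)
Lemma bump_derive_le (t : R) : `|bump_term 1 ('X^2 * (1 *: 1 - 1^`())) t| <= 2.
Proof.
rewrite /bump_term; case: ifPn => t0; last by rewrite normr0.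
have u0 : 0 <= t^-1 by rewrite invr_ge0 ltW.
have -> : ('X^2 * (1 *: 1 - 1^`()) : {poly R}).[t^-1] = t^-1 ^+ 2.
  by rewrite -[X in X^`()]polyC1 derivC subr0 scale1r mulr1 hornerXn.
rewrite mul1r expRN ger0_norm; last by rewrite mulr_ge0 ?sqr_ge0// invr_ge0 expR_ge0.
rewrite ler_pdivrMr ?expR_gt0//.
by have := expR_ge_pow 2 u0; rewrite ler_pdivrMr// mulrC.
Qed.

Lemma is_derive_cutoff r i x : is_derive x (evec R i) (cutoff r)
  (expR 1 * (bump_term 1 ('X^2 * (1 *: 1 - 1^`())) (1 - sqdist x * r^-2) * - r^-2)
     * (2 * (x ord0 i - xi ord0 i))).
Proof.
apply: (@is_derive_comp_line _ _ (fun t => expR 1 * bump_term 1 1 (1 - t * r^-2)));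
  last exact: is_derive_sqdist.
have d1 : is_derive (sqdist x) (1 : R) (fun t : R => 1 - t * r^-2) (- r^-2).
  by apply: is_derive_eq; rewrite /GRing.scale/=; ring.
have d2 := @is_derive1_comp _ (bump_term 1 1) (fun t : R => 1 - t * r^-2) (sqdist x) _ _
  (is_derive_bump_term 1 (1 - sqdist x * r^-2) ltr01) d1.
exact: (is_deriveZ (expR 1) d2).
Qed.

(** The minimum serves twice: bounded by 1 it yields a majorant independent of r, bounded by |x -
    xi|^2 / r^2 it yields the pointwise limit 0. It arises because the profile and the derivative of
    the cut-off each contribute a factor x_i - xi_i, and the latter vanishes beyond distance r. *)
Lemma profile_derive_cutoff_le r i x : 0 < r ->
  `|grad_profile i x * 'D_(evec R i) (cutoff r) x| <=
    4 * expR 1 * Num.min 1 (sqdist x * r^-2) * bden x `^ (- (n%:R / 2)).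
Proof.
move=> r0; have ri : 0 < r^-2 by rewrite invr_gt0 exprn_gt0.
have H := is_derive_cutoff r i x; have -> := @derive_val _ _ _ _ _ _ _ H.
set B := bump_term _ _ _; set z := x ord0 i - xi ord0 i; set Q := bden x `^ _.
have -> : grad_profile i x * (expR 1 * (B * - r^-2) * (2 * z)) =
   - (expR 1 * 2 * B * (z ^+ 2 * r^-2) * Q).
  by rewrite /grad_profile -/z -/Q; ring.
have Q0 : 0 <= Q by exact: powR_ge0.
rewrite normrN normrM (ger0_norm Q0) ler_wpM2r//.
have z0 : 0 <= z ^+ 2 * r^-2 by rewrite mulr_ge0 ?sqr_ge0// ltW.
have zs : z ^+ 2 * r^-2 <= sqdist x * r^-2 by rewrite ler_wpM2r ?(ltW ri)// sqcoord_le.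
rewrite normrM (ger0_norm z0) normrM ger0_norm ?mulr_ge0 ?expR_ge0//.
have B2 : `|B| <= 2 by exact: bump_derive_le.
have e0 : 0 < expR 1 :> R by exact: expR_gt0.
have [s1|s1] := leP (sqdist x * r^-2) 1.
  apply: (@le_trans _ _ (expR 1 * 2 * 2 * (z ^+ 2 * r^-2))).
    by rewrite ler_wpM2r// ler_wpM2l// mulr_ge0// ltW.
  rewrite (_ : expR 1 * 2 * 2 = 4 * expR 1); last by ring.
  by rewrite ler_wpM2l ?mulr_ge0 ?(ltW e0).
have -> : B = 0.
  by rewrite /B /bump_term ifF//; apply/negbTE; rewrite -leNgt subr_le0 ltW.
by rewrite normr0 mulr0 mul0r mulr_ge0 ?mulr_ge0 ?(ltW e0)// ltW.
Qed.

(** Young's inequality with 2n/(n - 2) and its conjugate 2n/(n + 2). The second term is a multiple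
    of rho^s with s = n^2/(n + 2), and s > n/2 precisely because n > 2. *)
Lemma powR_bden_intble (u : Bor R n -> R) : measurable_fun setT u ->
  (\int[lam]_x (`|u x| `^ (2 * n%:R / (n%:R - 2)))%:E < +oo)%E ->
  intble (fun x => `|u x| * bden x `^ (- (n%:R / 2))).
Proof.
move=> mu uL; pose ga : R := 2 * n%:R / (n%:R - 2); pose de : R := 2 * n%:R / (n%:R + 2).
have n2' : 2 < n%:R :> R by exact: n2R.
have n0 : 0 < n%:R :> R by lra.
have ga0 : 0 < ga by rewrite /ga divr_gt0//; lra.
have de0 : 0 < de by rewrite /de divr_gt0//; lra.
have cj : ga^-1 + de^-1 = 1 by rewrite /ga /de; field; rewrite !gt_eqF//; lra.
pose s : R := n%:R ^+ 2 / (n%:R + 2).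
have s2 : n%:R / 2 < s by rewrite /s ltr_pdivlMr; nra.
have mu1 : measurable_fun setT (fun x : Bor R n => `|u x|).
  by apply: measurableT_comp => //; exact: normr_measurable.
have mb : measurable_fun setT (fun x : Bor R n => bden x `^ (- (n%:R / 2))).
  exact: (continuous_measurable_bor (Ck_cont (Ck_bden_powR 0 _))).
have Iu : intble (fun x => `|u x| `^ ga).
  apply/intbleP; first by apply: (measurableT_comp (measurable_powR _)).
  by under eq_integral do rewrite ger0_norm ?powR_ge0//.
have Id : intble (fun x => dens xi l x `^ s).
  apply/intbleP; first exact: dens_powR_measurable.
  under eq_integral do rewrite ger0_norm ?powR_ge0//.
  by apply: integral_dens_powR_fin => //; exact: ltn_trans n2.
apply: (@intble_le _ _ _ (fun x => ga^-1 * `|u x| `^ ga + (de^-1 * l `^ (- s)) * dens xi l x `^ s)).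
- exact: measurable_funM.
- move=> x; rewrite ger0_norm; last by rewrite mulr_ge0 ?powR_ge0.
  have := conjugate_powR (normr_ge0 (u x)) (powR_ge0 (bden x) (- (n%:R / 2))) ga0 de0 cj.
  move=> /le_trans; apply; rewrite [_ / ga]mulrC lerD2l mulrC -mulrA ler_wpM2l//.
    by rewrite invr_ge0 ltW.
  rewrite -powRrM densE powRM ?invr_ge0 ?(ltW l0) ?(ltW (bden_gt0 x))//.
  rewrite [leRHS]mulrA -powRD; last by rewrite (gt_eqF l0) implybT.
  rewrite addNr powRr0 mul1r -(powR_inv1 (ltW (bden_gt0 x))) -powRrM.
  rewrite (_ : - (n%:R / 2) * de = -1 * s)//.
  by rewrite /de /s; field; rewrite gt_eqF//; lra.
- by apply: intbleD; apply: intbleZ.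
Qed.

Lemma sqdist_scaled_cvg x : sqdist x * k.+1%:R^-2 @[k --> \oo] --> (0 : R).
Proof.
rewrite -(mulr0 (sqdist x)); apply: cvgMr.
rewrite -[X in _ --> X](mulr0 (0 : R)); under eq_cvg do rewrite expr2 invfM.
by apply: cvgM; exact: cvg_harmonic.
Qed.

(* The cut-off error u * P_i * d_i(chi_R) is dominated by |u| bden^(-n/2), which
   is integrable since n^2/(n+2) > n/2. *)
Lemma weak_derivative_profile (u g : Bor R n -> R) i :
  measurable_fun setT u ->
  (\int[lam]_x (`|u x| `^ (2 * n%:R / (n%:R - 2)))%:E < +oo)%E ->
  measurable_fun setT g ->
  (forall phi, test_fun phi -> rI (fun x => u x * 'D_(evec R i) phi x) = - rI (fun x => g x * phi x)) ->
  intble (fun x => g x * grad_profile i x) ->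
  intble (fun x => u x * 'D_(evec R i) (grad_profile i) x) /\
  rI (fun x => g x * grad_profile i x) = - rI (fun x => u x * 'D_(evec R i) (grad_profile i) x).
Proof.
move=> mu uL mg weak Ig; pose P := grad_profile i; pose e := evec R i.
have r0 (k : nat) : 0 < k.+1%:R :> R by [].
pose chi k := cutoff k.+1%:R.
have CP k : Ck k P by exact: Ck_grad_profile.
have [dP cdP] := Ck1P i (CP 1%N).
have tP k : test_fun (fun x => P x * chi k x) by apply: test_fun_cutoff.
have dchi k x : derivable (chi k) x e by have ? := is_derive_cutoff k.+1%:R i x; exact: ex_derive.
have DE k x : 'D_e (fun y => P y * chi k y) x = P x * 'D_e (chi k) x + chi k x * 'D_e P x.
  by rewrite [LHS](deriveM (dP x) (dchi k x)).
have mP : measurable_fun setT (P : Bor R n -> R) by exact: (continuous_measurable_bor (Ck_cont (CP 0%N))).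
have mdP : measurable_fun setT ((fun x => 'D_e P x) : Bor R n -> R) by exact: continuous_measurable_bor.
have mt k : measurable_fun setT ((fun x => P x * chi k x) : Bor R n -> R).
  by have [/smoothP/(_ 0%N)/Ck_cont/continuous_measurable_bor] := tP k.
have mdt k : measurable_fun setT ((fun x => 'D_e (fun y => P y * chi k y) x) : Bor R n -> R).
  by have [/smoothP/(_ 1%N)/(Ck1P i)[_ /continuous_measurable_bor]] := tP k.
have chi_cvg x : chi k x @[k --> \oo] --> (1 : R).
  have c : 1 - sqdist x * k.+1%:R^-2 @[k --> \oo] --> (1 - 0 : R).
    by apply: cvgB; [exact: cvg_cst|exact: sqdist_scaled_cvg].
  have cB : {for (1 - 0 : R), continuous (bump_term 1 1 : R -> R)}.
    apply: differentiable_continuous; apply/derivable1_diffP.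
    by have ? := is_derive_bump_term 1 (1 - 0 : R) ltr01; exact: ex_derive.
  have := cvg_comp _ _ c cB.
  rewrite subr0 bump_term1E ltr01 divr1 => c2.
  have : expR 1 * bump_term 1 1 (1 - sqdist x * k.+1%:R^-2) @[k --> \oo] --> expR 1 * expR (-1).
    by apply: cvgMr; exact: c2.
  by rewrite -expRD subrr expR0.
(* The two summands bound the two terms of the product rule relative to [bden] to the power -n/2,
   uniformly in the radius of the cut-off. *)
pose C : R := 4 * expR 1 + (1 + n%:R).
have e1 : 0 < expR 1 :> R by exact: expR_gt0.
have Dbound k x : `|'D_e (fun y => P y * chi k y) x| <= C * bden x `^ (- (n%:R / 2)).
  rewrite DE (le_trans (ler_normD _ _))// /C mulrDl lerD//.
    apply: le_trans (profile_derive_cutoff_le i x (r0 k)) _.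
    rewrite ler_wpM2r ?powR_ge0// ler_piMr ?mulr_ge0 ?(ltW e1)//.
    by rewrite ge_min lexx.
  rewrite normrM; have /andP[c0 c1] := cutoff_bounds k.+1%:R x.
  rewrite (ger0_norm c0) -[leRHS]mul1r ler_pM//; exact: derive_grad_profile_le.
have Dcvg x : 'D_e (fun y => P y * chi k y) x @[k --> \oo] --> 'D_e P x.
  rewrite (_ : (fun k => 'D_e _ x) = fun k => P x * 'D_e (chi k) x + chi k x * 'D_e P x); last first.
    by apply/funext => k; exact: DE.
  rewrite -[X in _ --> X]add0r; apply: cvgD; last first.
    by rewrite -[X in _ --> X]mul1r; apply: cvgMl; exact: chi_cvg.
  apply/cvgr0Pnorm_le => ep ep0; pose Q := bden x `^ (- (n%:R / 2)).
  have Q0 : 0 <= Q by exact: powR_ge0.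
  have K0 : 0 < 4 * expR 1 * Q + 1 by rewrite ltr_wpDl// !mulr_ge0// ltW.
  have /cvgr0Pnorm_le/(_ (ep / (4 * expR 1 * Q + 1)) (divr_gt0 ep0 K0)) := sqdist_scaled_cvg x.
  apply: filterS => k; rewrite ger0_norm; last by rewrite mulr_ge0 ?sqdist_ge0// invr_ge0 sqr_ge0.
  rewrite ler_pdivlMr// => hk.
  apply: le_trans (profile_derive_cutoff_le i x (r0 k)) _; rewrite -/Q.
  apply: (@le_trans _ _ (4 * expR 1 * (sqdist x * k.+1%:R^-2) * Q)).
    by rewrite ler_wpM2r// ler_wpM2l ?mulr_ge0 ?(ltW e1)// ge_min lexx orbT.
  apply: le_trans hk; rewrite mulrDr mulr1 -[leLHS]addr0 lerD//.
    by rewrite le_eqVlt; apply/orP; left; apply/eqP; ring.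
  by rewrite mulr_ge0 ?sqdist_ge0// invr_ge0 sqr_ge0.
have Iu := intbleZ C (powR_bden_intble mu uL).
have [I1 c1] : intble (fun x => u x * 'D_e P x) /\
    rI (fun x => u x * 'D_e (fun y => P y * chi k y) x) @[k --> \oo] --> rI (fun x => u x * 'D_e P x).
  apply: rI_dominated Iu _.
  - by move=> k; exact: measurable_funM.
  - exact: measurable_funM.
  - by move=> x; apply: cvgMr; exact: Dcvg.
  - by move=> k x; rewrite normrM mulrCA ler_wpM2l// Dbound.
have [I2 c2] : intble (fun x => g x * P x) /\
    rI (fun x => g x * (P x * chi k x)) @[k --> \oo] --> rI (fun x => g x * P x).
  apply: rI_dominated (integrable_abse Ig) _.
  - by move=> k; exact: measurable_funM.
  - exact: measurable_funM.
  - by move=> x; apply: cvgMr; rewrite -[X in _ --> X]mulr1; apply: cvgMr; exact: chi_cvg.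
  - move=> k x; rewrite /= mulrA normrM ler_piMr//.
    by have /andP[h0 h1] := cutoff_bounds k.+1%:R x; rewrite ger0_norm.
split => //; apply/esym/eqP; rewrite eqr_oppLR; apply/eqP.
have c3 : rI (fun x => u x * 'D_e (fun y => P y * chi k y) x) @[k --> \oo] --> - rI (fun x => g x * P x).
  by under eq_cvg do rewrite weak//; exact: cvgN.
by move: c1 => /(cvg_unique _ c3) <-.
Qed.

Lemma bubble_derive (c : R) i x :
  let v := fun y => c * bubble0 xi l y in
  'D_(evec R i) v x = - (n%:R - 2) * l ^+ 2 * (c * l `^ ((n%:R - 2) / 2)) * grad_profile i x.
Proof.
move=> v; have vE : v = fun y => (c * l `^ ((n%:R - 2) / 2)) * bden y `^ (- ((n%:R - 2) / 2)).
  apply/funext => y; rewrite /v /bubble0 sqdistE -/(bden y).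
  rewrite powRM ?invr_ge0 ?(ltW l0) ?(ltW (bden_gt0 y))// mulrA; congr (_ * _).
  by rewrite -powR_inv1 ?(ltW (bden_gt0 y))// -powRrM mulN1r.
have H := is_deriveZ (c * l `^ ((n%:R - 2) / 2)) (is_derive_bden_powR i x (- ((n%:R - 2) / 2))).
rewrite vE; have -> := @derive_val _ _ _ _ _ _ _ H.
rewrite /GRing.scale/= /grad_profile (_ : - ((n%:R - 2) / 2) - 1 = - (n%:R / 2)); last by field.
by field.
Qed.

Lemma Ck_bubble k (c : R) : Ck k (fun y => c * bubble0 xi l y).
Proof.
have -> : (fun y => c * bubble0 xi l y) =
    fun y => (c * l `^ ((n%:R - 2) / 2)) * bden y `^ (- ((n%:R - 2) / 2)).
  apply/funext => y; rewrite /bubble0 sqdistE -/(bden y).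
  rewrite powRM ?invr_ge0 ?(ltW l0) ?(ltW (bden_gt0 y))// mulrA; congr (_ * _).
  by rewrite -powR_inv1 ?(ltW (bden_gt0 y))// -powRrM mulN1r.
by apply: CkM; [exact: Ck_cst|exact: Ck_bden_powR].
Qed.

End bubble_calculus.

(** * The nonlocal norm against the weight *)

Section choquard_energy.
Context {R : realType} {n : nat} (mu : R).
Hypotheses (n2 : (2 < n)%N) (mu0 : 0 < mu) (mun : mu < n%:R).
Local Notation lam := (bor_measure R n).
Local Notation p := (two_star_mu n mu).
Local Notation ga := (two_star R n).

Lemma two_star_facts : [/\ 2 < n%:R :> R, 0 < p, 1 <= ga & 1 < p].
Proof.
have n2R : 2 < n%:R :> R by rewrite ltr_nat.
have [h1 h2] := (mu0, mun); split => //.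
- by rewrite /two_star_mu; apply: divr_gt0; lra.
- by rewrite /two_star ler_pdivlMr; lra.
- by rewrite /two_star_mu ltr_pdivlMr; lra.
Qed.

Lemma measurable_normr_powR (w : Bor R n -> R) (a : R) : measurable_fun setT w ->
  measurable_fun setT (fun x => `|w x| `^ a).
Proof.
move=> mw; apply: (measurableT_comp (measurable_powR _)).
by apply: measurableT_comp => //; exact: normr_measurable.
Qed.

Lemma choquardE (w : Bor R n -> R) : measurable_fun setT w ->
  (\int[lam]_x (`|w x| `^ ga)%:E < +oo)%E ->
  ((choquard mu (w : 'rV[R]_n -> R))%:E = \int[lam]_x \int[lam]_y
     (`|w y| `^ p * enorm ((x : 'rV[R]_n) - (y : 'rV[R]_n)) `^ (- mu) * `|w x| `^ p)%:E)%E.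
Proof.
move=> mw wL; have [n2R p0 ga1 p1] := two_star_facts.
have n0 : (0 < n)%N by exact: ltn_trans n2.
pose k (z : Bor R n * Bor R n) :=
  `|w z.2| `^ p * enorm ((z.1 : 'rV[R]_n) - (z.2 : 'rV[R]_n)) `^ (- mu) * `|w z.1| `^ p.
have mwp := measurable_normr_powR p mw.
have mk : measurable_fun setT k.
  apply: measurable_funM; last by apply: (measurableT_comp mwp); exact: measurable_fst.
  apply: measurable_funM; first by apply: (measurableT_comp mwp); exact: measurable_snd.
  by apply: (measurableT_comp (measurable_powR _)) => //; exact: measurable_enorm_pair.
have mke : measurable_fun setT (EFin \o k) by exact/measurable_EFinP.
have k0 z : 0 <= k z by rewrite !mulr_ge0// powR_ge0.
have mkx x : measurable_fun setT (fun y => (k (x, y))%:E).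
  by have := measurableT_comp mke (@measurable_pair1 _ _ (Bor R n) (Bor R n) x); exact.
have E : (iint (fun x : 'rV[R]_n => iint (fun y : 'rV[R]_n =>
     ((`|w y| `^ p) * (enorm (x - y) `^ (- mu)) * (`|w x| `^ p))%:E)) =
   \int[lam]_x \int[lam]_y (k (x, y))%:E)%E.
  rewrite -iintE.
  - congr iint; apply/funext => x; apply: (iintE (F := fun y => (k (x, y))%:E)) => //.
    by move=> y; rewrite lee_fin.
  - apply: (measurable_fun_fubini_tonelli_F (EFin \o k)) => //.
  - by move=> x; apply: integral_ge0 => y _; rewrite lee_fin.
rewrite /choquard E fineK// ge0_fin_numE; last first.
  by apply: integral_ge0 => x _; apply: integral_ge0 => y _; rewrite lee_fin.
have H := hls_finite n0 mu0 mun (measurable_normr_powR ga mw) (fun x => powR_ge0 _ _) wL.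
apply: le_lt_trans H; rewrite le_eqVlt; apply/orP; left; apply/eqP.
apply: eq_integral => x _; apply: eq_integral => y _; rewrite /k /= -!powRrM.
(* [hls_finite] is applied to the integrable density |w|^ga; this identity of exponents turns its
   powers into |w|^p. *)
rewrite (_ : ga * (1 - mu / n%:R / 2) = p)//.
by rewrite /two_star /two_star_mu; field; rewrite !gt_eqF//; lra.
Qed.

Lemma choquard_ge0 (w : 'rV[R]_n -> R) : 0 <= choquard mu w.
Proof.
apply: fine_ge0.
have iint0 m (F : 'rV[R]_m -> \bar R) : (forall x, 0 <= F x)%E -> (0 <= iint F)%E.
  by elim: m F => [|m IH] F F0 //=; apply: integral_ge0 => t _; exact: IH.
by apply: (iint0 n) => x; apply: (iint0 n) => y; rewrite lee_fin !mulr_ge0// powR_ge0.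
Qed.

Variables (xi : 'rV[R]_n) (l : R).
Hypothesis l0 : 0 < l.

Lemma weighted_choquard (w : Bor R n -> R) : measurable_fun setT w ->
  (\int[lam]_x (`|w x| `^ ga)%:E < +oo)%E ->
  intble (fun x => `|w x| `^ p * dens xi l x `^ (mu / 2)) /\
  rI (fun x => `|w x| `^ p * dens xi l x `^ (mu / 2)) ^+ 2 <= choquard mu (w : 'rV[R]_n -> R).
Proof.
move=> mw wL; have n0 : (0 < n)%N by exact: ltn_trans n2.
have mwp := measurable_normr_powR p mw.
pose k (x : Bor R n) := `|w x| `^ p * dens xi l x `^ (mu / 2).
have k0 x : 0 <= k x by rewrite mulr_ge0// powR_ge0.
have mk : measurable_fun setT k by apply: measurable_funM => //; exact: dens_powR_measurable.
have := double_integral_ge (xi := xi) l0 n0 mu0 mwp (fun x => powR_ge0 _ _) erefl.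
rewrite -choquardE// -/(k _); set I := (\int[lam]_x _)%E => HI.
have I0 : (0 <= I)%E by apply: integral_ge0 => x _; rewrite lee_fin; exact: k0.
have Ik : intble k.
  apply/(intbleP mk); under eq_integral do rewrite ger0_norm//.
  (* An infinite [I] would have an infinite square, against the real upper bound in [HI]. *)
  rewrite -[X in (X < _)%E]/I; case: I I0 HI => [r|//|//] _ _; last first.
  exact: ltry.
split => //; rewrite -lee_fin; apply: le_trans HI.
by rewrite expr2 EFinM -(rI_E Ik).
Qed.

Lemma NLnorm_lower (c : R) (v : Bor R n -> R) :
  v = (fun x => c * bubble0 xi l (x : 'rV[R]_n)) ->
  (\int[lam]_x (`|v x| `^ ga)%:E < +oo)%E ->
  `|c| * ((2 / (1 + n%:R)) ^+ n) `^ p^-1 <= NLnorm mu (v : 'rV[R]_n -> R).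
Proof.
move=> vE vL; have [n2R p0 ga1 p1] := two_star_facts.
have mv : measurable_fun setT v.
  rewrite vE; exact: (continuous_measurable_bor (Ck_cont (Ck_bubble xi l0 0 c))).
have [Iv Hv] := weighted_choquard mv vL.
pose a : R := (2 / (1 + n%:R)) ^+ n.
have a0 : 0 <= a by rewrite exprn_ge0// divr_ge0.
have d0 x := dens_gt0 xi l0 x.
(* The exponents match because p (n - 2)/2 + mu/2 = n. *)
have E x : `|v x| `^ p * dens xi l x `^ (mu / 2) = `|c| `^ p * dens xi l x ^+ n.
  rewrite vE normrM powRM// -mulrA; congr (_ * _).
  rewrite /bubble0 -/(dens xi l x) ger0_norm ?powR_ge0// -powRrM -powRD; last first.
    by rewrite (gt_eqF (d0 x)) implybT.
  rewrite -powR_mulrn ?(ltW (d0 x))//; congr powR.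
  by rewrite /two_star_mu; field; rewrite gt_eqF//; lra.
have lb : `|c| `^ p * a <= rI (fun x => `|v x| `^ p * dens xi l x `^ (mu / 2)).
  rewrite -lee_fin -(rI_E Iv); under eq_integral do rewrite E EFinM.
  rewrite ge0_integralZl_EFin ?powR_ge0//; last 2 first.
  - by move=> x _; rewrite lee_fin exprn_ge0// ltW.
  - by apply/measurable_EFinP; apply: measurable_funX; exact: measurable_dens.
  by rewrite EFinM lee_wpmul2l ?lee_fin ?powR_ge0//; exact: integral_dens_ge.
have r0 : 0 <= `|c| `^ p * a by rewrite mulr_ge0// powR_ge0.
have H2 : (`|c| `^ p * a) ^+ 2 <= choquard mu (v : 'rV[R]_n -> R).
  by apply: le_trans Hv; rewrite ler_pXn2r// ?nnegrE// (le_trans r0).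
rewrite /NLnorm -/a; have -> : `|c| * a `^ p^-1 = ((`|c| `^ p * a) ^+ 2) `^ (1 / (2 * p)).
  rewrite -powR_mulrn// -powRrM (_ : 2%:R * (1 / (2 * p)) = p^-1); last first.
    by field; rewrite gt_eqF.
  by rewrite powRM ?powR_ge0// -powRrM mulfV ?gt_eqF// powRr1.
rewrite ge0_ler_powR ?nnegrE ?sqr_ge0 ?choquard_ge0//.
by rewrite divr_ge0// mulr_ge0// ltW.
Qed.

Lemma weighted_integral_le_NLnorm (w : Bor R n -> R) : measurable_fun setT w ->
  (\int[lam]_x (`|w x| `^ ga)%:E < +oo)%E ->
  intble (fun x => `|w x| * dens xi l x `^ ((n%:R + 2) / 2)) /\
  rI (fun x => `|w x| * dens xi l x `^ ((n%:R + 2) / 2)) <=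
    (pi ^+ n) `^ (1 - p^-1) * NLnorm mu (w : 'rV[R]_n -> R).
Proof.
move=> mw wL; have [n2R p0 ga1 p1] := two_star_facts.
have [Iw Hw] := weighted_choquard mw wL.
have H0 : 0 <= rI (fun x => `|w x| `^ p * dens xi l x `^ (mu / 2)).
  by apply: rI_ge0 => x; rewrite mulr_ge0// powR_ge0.
have := weighted_hoelder (xi := xi) l0 n2 mu0 mun mw H0.
rewrite -rI_E// => /(_ (lexx _)) HH.
have m1 : measurable_fun setT (fun x => `|w x| * dens xi l x `^ ((n%:R + 2) / 2)).
  apply: measurable_funM; last exact: dens_powR_measurable.
  by apply: measurableT_comp => //; exact: normr_measurable.
have I1 : intble (fun x => `|w x| * dens xi l x `^ ((n%:R + 2) / 2)).
  apply/(intbleP m1); apply: le_lt_trans (ltry _); apply: le_trans HH.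
  rewrite le_eqVlt; apply/orP; left; apply/eqP; apply: eq_integral => x _.
  by rewrite ger0_norm// mulr_ge0// powR_ge0.
split => //; move: HH; rewrite rI_E// lee_fin => /le_trans; apply.
rewrite mulrC ler_wpM2l ?powR_ge0// /NLnorm.
set h := rI _ in H0 Hw *.
have -> : h `^ p^-1 = (h ^+ 2) `^ (1 / (2 * p)).
  rewrite -powR_mulrn// -powRrM; congr powR; by field; rewrite gt_eqF.
rewrite ge0_ler_powR ?nnegrE ?sqr_ge0 ?choquard_ge0//.
by rewrite divr_ge0// mulr_ge0// ltW.
Qed.

End choquard_energy.

(** * The Dirichlet space and the pairing with a bubble *)

Section dirichlet_space.
Context {R : realType} {n : nat}.
Hypothesis n2 : (2 < n)%N.
Local Notation lam := (bor_measure R n).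
Local Notation ga := (two_star R n).

Lemma sq_loc_intble (f : Bor R n -> R) (psi : 'rV[R]_n -> R) :
  intble (fun x => f x * f x) -> measurable_fun setT f ->
  continuous psi -> bdd_supp psi -> intble (fun x => f x * psi x).
Proof.
move=> If mf cp bp; apply: (@powR_loc_intble _ _ f psi 2%:R) => //; first by rewrite ler1n.
have := (intbleP (intble_measurable If)).1 If; apply: le_lt_trans.
rewrite le_eqVlt; apply/orP; left; apply/eqP; apply: eq_integral => x _.
by rewrite powR_mulrn// real_normK ?num_real// -expr2 ger0_norm// sqr_ge0.
Qed.

(** Translates [D12] from iterated integrals to the measure on R^n. Both sides of the weak equation
    are first shown to be integrable, so that each [rint] is a genuine real integral. *)
Lemma D12P (u : 'rV[R]_n -> R) (g : 'I_n -> 'rV[R]_n -> R) : D12 u g ->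
  [/\ measurable_fun setT (u : Bor R n -> R),
    (\int[lam]_x (`|u x| `^ ga)%:E < +oo)%E,
    (forall i, measurable_fun setT (g i : Bor R n -> R)),
    (forall i j, intble (fun x => g i x * g j x)) &
    forall phi, test_fun phi -> forall i,
      rI (fun x => u x * 'D_(evec R i) phi x) = - rI (fun x => g i x * phi x)].
Proof.
have n2R : 2 < n%:R :> R by rewrite ltr_nat.
have ga1 : 1 <= ga by rewrite /two_star ler_pdivlMr; lra.
have bm (f : 'rV[R]_n -> R) : borel_fun f -> measurable_fun setT (f : Bor R n -> R).
  by move=> bf _ B mB; rewrite setTI; exact: bf.
move=> [/bm mu uL bg gL weak].
have mg i : measurable_fun setT (g i : Bor R n -> R) by exact: bm.
have mup : measurable_fun setT (fun x : Bor R n => `|u x| `^ ga).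
  apply: (measurableT_comp (measurable_powR _)).
  by apply: measurableT_comp => //; exact: normr_measurable.
have uL' : (\int[lam]_x (`|u x| `^ ga)%:E < +oo)%E.
  rewrite -(iintE (F := fun x => (`|u x| `^ ga)%:E))//.
  exact/measurable_EFinP.
have mS : measurable_fun setT ((fun x => \sum_(i < n) g i x ^+ 2) : Bor R n -> R).
  by apply: measurable_sum => i; exact: measurable_funX.
have S0 x : 0 <= \sum_(i < n) g i x ^+ 2 by apply: sumr_ge0 => i _; exact: sqr_ge0.
have IS : intble (fun x => \sum_(i < n) g i x ^+ 2).
  apply/(intbleP mS); under eq_integral do rewrite ger0_norm//.
  rewrite -(iintE (F := fun x => (\sum_(i < n) g i x ^+ 2)%:E))//.
  exact/measurable_EFinP.
have gS i x : g i x ^+ 2 <= \sum_(i < n) g i x ^+ 2.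
  by rewrite (bigD1 i)//= lerDl; apply: sumr_ge0 => j _; exact: sqr_ge0.
have Igg i j : intble (fun x => g i x * g j x).
  apply: intble_le IS; first exact: measurable_funM.
  move=> x; have h1 := gS i x; have h2 := gS j x.
  have := sqr_ge0 (`|g i x| - `|g j x|).
  rewrite normrM sqrrB !real_normK ?num_real//; lra.
split => // phi tp i.
have cp : continuous phi by have [/smoothP/(_ 0%N)/Ck_cont] := tp.
have cdp : continuous (fun x => 'D_(evec R i) phi x).
  by have [/smoothP/(_ 1%N)/(Ck1P i)[]] := tp.
have I1 : intble (fun x => u x * 'D_(evec R i) phi x).
  exact: (powR_loc_intble ga1 mu uL' cdp (test_fun_derive_bdd_supp i tp)).
have I2 : intble (fun x => g i x * phi x).
  exact: sq_loc_intble (Igg i i) (mg i) cp (test_fun_bdd_supp tp).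
have := weak phi tp i; rewrite /= (rintE I1) (rintE I2) -EFinN => -[].
by [].
Qed.

Lemma dirichletE (g : 'I_n -> 'rV[R]_n -> R) :
  (forall i, measurable_fun setT (g i : Bor R n -> R)) ->
  dirichlet g = rI (fun x => \sum_(i < n) g i x ^+ 2).
Proof.
move=> mg; rewrite /dirichlet /rI /Rintegral; congr fine.
apply: (iintE (F := fun x => (\sum_(i < n) g i x ^+ 2)%:E)).
  by apply/measurable_EFinP; apply: measurable_sum => i; exact: measurable_funX.
by move=> x; rewrite lee_fin; apply: sumr_ge0 => i _; exact: sqr_ge0.
Qed.

Lemma sub_powR_lt_pinfty (u v : Bor R n -> R) (q : R) : 0 <= q ->
  measurable_fun setT u -> measurable_fun setT v ->
  (\int[lam]_x (`|u x| `^ q)%:E < +oo)%E -> (\int[lam]_x (`|v x| `^ q)%:E < +oo)%E ->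
  (\int[lam]_x (`|u x - v x| `^ q)%:E < +oo)%E.
Proof.
move=> q0 mu mv uL vL.
have mp (w : Bor R n -> R) : measurable_fun setT w -> measurable_fun setT (fun x => `|w x| `^ q).
  move=> mw; apply: (measurableT_comp (measurable_powR _)).
  by apply: measurableT_comp => //; exact: normr_measurable.
have Ip (w : Bor R n -> R) : measurable_fun setT w ->
    intble (fun x => `|w x| `^ q) <-> (\int[lam]_x (`|w x| `^ q)%:E < +oo)%E.
  move=> mw; rewrite intbleP; last exact: mp.
  by under eq_integral do rewrite ger0_norm ?powR_ge0//.
have muv : measurable_fun setT (fun x => u x - v x) by exact: measurable_funB.
apply/(Ip _ muv); apply: (@intble_le _ _ _
    (fun x => 2 `^ q * (`|u x| `^ q) + 2 `^ q * (`|v x| `^ q))).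
- exact: mp.
- move=> x; rewrite ger0_norm ?powR_ge0//.
  apply: (@le_trans _ _ ((2 * Num.max `|u x| `|v x|) `^ q)).
    rewrite ge0_ler_powR ?nnegrE ?mulr_ge0 ?le_max ?normr_ge0//.
    apply: le_trans (ler_normB _ _) _; rewrite mulr_natl mulr2n lerD// le_max lexx ?orbT//.
  rewrite powRM ?le_max ?normr_ge0// -mulrDr ler_wpM2l ?powR_ge0//.
  by rewrite maxEle; case: ifPn => _; rewrite ?lerDr ?lerDl powR_ge0.
- by apply: intbleD; apply: intbleZ; [apply/(Ip _ mu)|apply/(Ip _ mv)].
Qed.

(** If the power c of the energy is positive, every admissible S is at most [dirichlet g / c], hence
    so is their supremum, the set being nonempty as it contains 0. If c = 0, the left side
    vanishes. *)
Lemma S_HL_le (mu : R) (u : 'rV[R]_n -> R) (g : 'I_n -> 'rV[R]_n -> R) : D12 u g ->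
  S_HL n mu * choquard mu u `^ (1 / two_star_mu n mu) <= dirichlet g.
Proof.
have dir0 g' : 0 <= dirichlet (g' : 'I_n -> 'rV[R]_n -> R).
  apply: fine_ge0.
  have iint0 m (F : 'rV[R]_m -> \bar R) : (forall x, 0 <= F x)%E -> (0 <= iint F)%E.
    by elim: m F => [|m IH] F F0 //=; apply: integral_ge0 => t _; exact: IH.
  by apply: (iint0 n) => x; rewrite lee_fin; apply: sumr_ge0 => i _; exact: sqr_ge0.
move=> Dug; set c := _ `^ _; have c0 : 0 <= c by exact: powR_ge0.
move: c0; rewrite le_eqVlt => /predU1P[<-|c0]; first by rewrite mulr0.
rewrite -ler_pdivlMr//; apply: ge_sup.
  by exists 0 => u' g' _; rewrite mul0r.
by move=> S HS; rewrite ler_pdivlMr//; exact: HS.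
Qed.

Variables (xi : 'rV[R]_n) (l : R).
Hypothesis l0 : 0 < l.

Lemma ae_imply (P Q : Bor R n -> Prop) : (forall x, P x -> Q x) ->
  {ae lam, forall x, P x} -> {ae lam, forall x, Q x}.
Proof.
move=> PQ [A [mA A0 sA]]; exists A; split => // x /= nQ.
by apply: sA => /= Px; apply: nQ; exact: PQ.
Qed.

(** The weak and the classical derivative satisfy the same integration by parts, so their difference
    annihilates all test functions. *)
Lemma bubble_weak_gradient (c : R) (gv : 'I_n -> 'rV[R]_n -> R) :
  let v := fun y => c * bubble0 xi l y in D12 v gv ->
  forall i, {ae lam, forall x : Bor R n, gv i x = 'D_(evec R i) v x}.
Proof.
move=> v /D12P[mv vL mgv Igv weak] i.
have n2R : 2 < n%:R :> R by rewrite ltr_nat.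
have Cv k : Ck k v by exact: Ck_bubble.
have [dv cdv] := Ck1P i (Cv 1%N).
have mdv := continuous_measurable_bor cdv.
have Ig psi : continuous psi -> bdd_supp psi -> intble (fun x => gv i x * psi x).
  exact: sq_loc_intble (Igv i i) (mgv i).
have Id psi : continuous psi -> bdd_supp psi -> intble (fun x => 'D_(evec R i) v x * psi x).
  move=> cp [r Hr]; apply: cont_bdd_supp_intble.
    by move=> x; exact: (cvgM (cdv x) (cp x)).
  by exists r => x j h; rewrite (Hr x j h) mulr0.
have H : {ae lam, forall x : Bor R n, gv i x - 'D_(evec R i) v x = 0}.
  apply: ae_eq0_of_test; first exact: measurable_funB.
    move=> psi cp bp; under eq_fun do rewrite mulrBl.
    by apply: intbleB; [exact: Ig|exact: Id].
  move=> phi tp; under [X in rI X]eq_fun do rewrite mulrBl.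
  have cp : continuous phi by have [/smoothP/(_ 0%N)/Ck_cont] := tp.
  have bp := test_fun_bdd_supp tp.
  rewrite rIB; [|exact: Ig|exact: Id].
  have := weak phi tp i; rewrite (integration_by_parts_C1 i (Cv 1%N) tp) => /oppr_inj ->.
  by rewrite subrr.
by apply: ae_imply H => x /eqP; rewrite subr_eq0 => /eqP.
Qed.

Lemma rI_ae_eq (f g : Bor R n -> R) : measurable_fun setT f -> measurable_fun setT g ->
  {ae lam, forall x, f x = g x} -> intble f -> intble g /\ rI f = rI g.
Proof.
move=> mf mg fg If.
have fge : ae_eq lam setT (EFin \o f) (EFin \o g).
  by apply: filterS fg => x /= -> _.
split; last by congr fine; apply: ae_eq_integral => //; exact/measurable_EFinP.
apply/(intbleP mg); have /(intbleP mf) := If.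
have -> : (\int[lam]_x `|f x|%:E = \int[lam]_x `|g x|%:E)%E.
  apply: ae_eq_integral => //.
  - by apply/measurable_EFinP; apply: measurableT_comp => //; exact: normr_measurable.
  - by apply/measurable_EFinP; apply: measurableT_comp => //; exact: normr_measurable.
  - by apply: filterS fg => x /= -> _.
by [].
Qed.

(* Testing the gradient of u against that of the bubble v = c W0 gives the
   pairing of u with -Delta v = n(n-2) c dens^((n+2)/2). *)
Lemma pairing_bubble (c : R) (u : 'rV[R]_n -> R) (gu gv : 'I_n -> 'rV[R]_n -> R) :
  let v := fun y => c * bubble0 xi l y in D12 v gv -> D12 u gu ->
  (forall i, intble (fun x => gu i x * gv i x)) /\
  \sum_(i < n) rI (fun x => gu i x * gv i x) =
    n%:R * (n%:R - 2) * c * rI (fun x => u x * dens xi l x `^ ((n%:R + 2) / 2)).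
Proof.
move=> v Dv Du; have aegv := bubble_weak_gradient Dv.
have [mv vL mgv Igv weakv] := D12P Dv; have [mu uL mgu Igu weaku] := D12P Du.
have n2R : 2 < n%:R :> R by rewrite ltr_nat.
pose A : R := - (n%:R - 2) * l ^+ 2 * (c * l `^ ((n%:R - 2) / 2)).
pose P i := grad_profile xi l i.
have dvE i x : 'D_(evec R i) v x = A * P i x by exact: bubble_derive.
have mP i : measurable_fun setT (P i : Bor R n -> R).
  exact: (continuous_measurable_bor (Ck_cont (@Ck_grad_profile R n xi l 0 i))).
have Iguv i : intble (fun x => gu i x * gv i x).
  apply: (@intble_le _ _ _ (fun x => gu i x * gu i x + gv i x * gv i x)).
  - exact: measurable_funM.
  - move=> x; have := sqr_ge0 (`|gu i x| - `|gv i x|).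
    have h1 := sqr_ge0 (gu i x); have h2 := sqr_ge0 (gv i x).
    by rewrite normrM sqrrB !real_normK ?num_real// -!expr2; lra.
  - by apply: intbleD.
split => //.
(* Integrability of [gu i * P i] is obtained below by dividing by [A]. When [A = 0] also c = 0, and
   the gradient of the bubble vanishes almost everywhere. *)
have [A0|A0] := eqVneq A 0.
  have c0 : c = 0.
    apply/eqP; move/eqP: A0; rewrite /A !mulf_eq0 oppr_eq0 subr_eq0 (gt_eqF n2R)/=.
    by rewrite (gt_eqF l0) (gt_eqF (powR_gt0 _ l0)) /= orbF.
  rewrite c0 mulr0 mul0r; apply: big1 => i _.
  have ae0 : {ae lam, forall x : Bor R n, gu i x * gv i x = 0}.
    by apply: ae_imply (aegv i) => x ->; rewrite dvE A0 mul0r mulr0.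
  have [_ ->] := rI_ae_eq (measurable_funM (mgu i) (mgv i)) (measurable_cst (0 : R)) ae0 (Iguv i).
  by rewrite /rI /Rintegral integral0_eq.
have step i : intble (fun x => u x * 'D_(evec R i) (P i) x) /\
    rI (fun x => gu i x * gv i x) = - A * rI (fun x => u x * 'D_(evec R i) (P i) x).
  have aeA : {ae lam, forall x : Bor R n, gu i x * gv i x = A * (gu i x * P i x)}.
    by apply: ae_imply (aegv i) => x ->; rewrite dvE mulrCA.
  have m2 : measurable_fun setT (fun x : Bor R n => A * (gu i x * P i x)).
    by apply: measurable_funM => //; exact: measurable_funM.
  have [I1 E1] := rI_ae_eq (measurable_funM (mgu i) (mgv i)) m2 aeA (Iguv i).
  have IP : intble (fun x => gu i x * P i x).
    have := intbleZ A^-1 I1; congr intble; apply/funext => x.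
    by rewrite mulrA mulVf// mul1r.
  have [I2 E2] := weak_derivative_profile l0 n2 mu uL (mgu i) (fun phi tp => weaku phi tp i) IP.
  by split => //; rewrite E1 rIZ// E2 mulrN mulNr.
transitivity (\sum_(i < n) - A * rI (fun x => u x * 'D_(evec R i) (P i) x)).
  by apply: eq_bigr => i _; have [] := step i.
rewrite -mulr_sumr -rI_sum; last by move=> i; have [] := step i.
have E x : \sum_(i < n) u x * 'D_(evec R i) (P i) x =
    n%:R * l `^ (- ((n%:R + 2) / 2)) * (u x * dens xi l x `^ ((n%:R + 2) / 2)).
  rewrite -mulr_sumr sum_derive_grad_profile// densE powRM ?invr_ge0 ?(ltW l0) ?(ltW (bden_gt0 xi l x))//.
  rewrite -(powR_inv1 (ltW (bden_gt0 xi l x))) -powRrM mulN1r.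
  have : l `^ (- ((n%:R + 2) / 2)) * l `^ ((n%:R + 2) / 2) = 1.
    by rewrite -powRD ?addNr ?powRr0// (gt_eqF l0) implybT.
  set a := l `^ _; set b := l `^ _ => ab; set q := _ `^ _.
  by transitivity (n%:R * (a * b) * (u x * q)); [rewrite ab; ring|ring].
under [X in rI X]eq_fun do rewrite E.
have Iu : intble (fun x => u x * dens xi l x `^ ((n%:R + 2) / 2)).
  apply: (@intble_le _ _ _ (fun x => l `^ ((n%:R + 2) / 2) * (`|u x| * bden xi l x `^ (- (n%:R / 2))))).
  - by apply: measurable_funM => //; exact: dens_powR_measurable.
  - move=> x; have b0 := bden_gt0 xi l x.
    rewrite normrM mulrCA ler_wpM2l// ger0_norm ?powR_ge0//.
    rewrite densE powRM ?invr_ge0 ?(ltW l0) ?(ltW b0)// ler_wpM2l ?powR_ge0//.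
    rewrite -(powR_inv1 (ltW b0)) -powRrM; apply: ler_powR; first exact: bden_ge1.
    lra.
  - by apply: intbleZ; exact: (powR_bden_intble xi l0 n2 mu uL).
rewrite rIZ// (_ : - A = (n%:R - 2) * (l ^+ 2 * (c * l `^ ((n%:R - 2) / 2)))); last first.
  by rewrite /A; ring.
(* This power of [l] cancels the one brought in by [E], so the constant of the pairing is free of
   [l]. *)
have -> : l ^+ 2 * (c * l `^ ((n%:R - 2) / 2)) = c * l `^ ((n%:R + 2) / 2).
  rewrite mulrCA -(powR_mulrn 2 (ltW l0)) -powRD; last by rewrite (gt_eqF l0) implybT.
  by congr (_ * powR _ _); field.
have ab : l `^ (- ((n%:R + 2) / 2)) * l `^ ((n%:R + 2) / 2) = 1.
  by rewrite -powRD ?addNr ?powRr0// (gt_eqF l0) implybT.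
set J := rI _.
transitivity (n%:R * (n%:R - 2) * c * (l `^ (- ((n%:R + 2) / 2)) * l `^ ((n%:R + 2) / 2)) * J).
  by ring.
by rewrite ab mulr1.
Qed.

End dirichlet_space.

(** * Assembly of the estimate *)

Lemma final_estimate (R : realType) (m a b c J A B : R) : 0 <= m -> 0 < a ->
  `|c| * a <= A -> `|J| <= b * B -> - (2 * (m * c * J)) <= 2 * m * b / a * A * B.
Proof.
move=> m0 a0 cA JB.
have cA' : `|c| <= A / a by rewrite ler_pdivlMr.
have h := ler_norm (- (c * J)); rewrite normrN normrM in h.
have := ler_pM (normr_ge0 c) (normr_ge0 J) cA' JB => /(le_trans h) h'.
have := ler_wpM2l m0 h'.
rewrite (_ : 2 * m * b / a * A * B = 2 * (m * (A / a * (b * B)))); last by field; rewrite gt_eqF.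
lra.
Qed.

Unset Implicit Arguments.
Set Strict Implicit.
Set Printing Implicit Defensive.

Theorem theorem1p1 (R : realType) (N : nat) (mu : R) :
  (3 <= N)%N -> 0 < mu -> mu < N%:R ->
  exists K L : R, 0 < K /\ 0 < L /\
    forall (u : 'rV[R]_N -> R) (gu : 'I_N -> 'rV[R]_N -> R),
      D12 u gu ->
    forall (v : 'rV[R]_N -> R) (gv : 'I_N -> 'rV[R]_N -> R),
      @Mtilde R N v -> D12 v gv ->
      NLnorm mu u = NLnorm mu v ->
      dirichlet (fun i x => gu i x - gv i x)
        <= K * deficit mu u gu + L * NLnorm mu u * NLnorm mu (fun x => u x - v x).
Proof.
move=> n2 mu0 mun; have [n2R p0 ga1 p1] := two_star_facts n2 mu0 mun.
pose p := two_star_mu N mu.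
pose a : R := ((2 / (1 + N%:R)) ^+ N) `^ p^-1.
have a0 : 0 < a.
  by rewrite powR_gt0// exprn_gt0// divr_gt0// ltr_wpDr.
pose b : R := (pi ^+ N) `^ (1 - p^-1).
have b0 : 0 < b by rewrite powR_gt0// exprn_gt0// pi_gt0.
have nn : 0 < N%:R * (N%:R - 2) :> R by rewrite mulr_gt0//; lra.
(* In the second constant, 2 comes from the cross term, N(N - 2) from the pairing with the bubble, b
   from Hoelder's inequality, and 1/a from the bound on |c|. *)
exists 1, (2 * (N%:R * (N%:R - 2)) * b / a); split; first exact: ltr01.
split; first by rewrite divr_gt0// mulr_gt0// mulr_gt0.
move=> u gu Du v gv [c [xi [l [l0 vE]]]] Dv NLuv.
have [mu' uL mgu Igu _] := D12P n2 Du; have [mv vL mgv Igv _] := D12P n2 Dv.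
have NL0 w : 0 <= NLnorm mu (w : 'rV[R]_N -> R) by exact: powR_ge0.
pose w : Bor R N -> R := fun x => u x - v x.
have mw : measurable_fun setT w by exact: measurable_funB.
have wL : (\int[bor_measure R N]_x (`|w x| `^ two_star R N)%:E < +oo)%E.
  have ga0 : 0 <= two_star R N := le_trans ler01 ga1.
  exact: (sub_powR_lt_pinfty ga0 mu' mv uL vL).
have Dv' := Dv; rewrite vE in Dv'.
have [Iuv Euv] := pairing_bubble n2 l0 Dv' Du; have [Ivv Evv] := pairing_bubble n2 l0 Dv' Dv'.
have mgd i : measurable_fun setT ((fun x => gu i x - gv i x) : Bor R N -> R).
  exact: measurable_funB.
pose d (x : Bor R N) := dens xi l x `^ ((N%:R + 2) / 2).
have md : measurable_fun setT d by exact: dens_powR_measurable.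
have nd (z : Bor R N -> R) x : `|z x * d x| = `|z x| * d x.
  by rewrite normrM (ger0_norm (powR_ge0 _ _)).
have Iabs z : measurable_fun setT (z : Bor R N -> R) ->
    (\int[bor_measure R N]_x (`|z x| `^ two_star R N)%:E < +oo)%E -> intble (fun x => z x * d x).
  move=> mz zL; have [Iz _] := weighted_integral_le_NLnorm n2 mu0 mun xi l0 mz zL.
  apply: intble_le Iz; first by exact: (measurable_funM mz md).
  by move=> x; rewrite nd.
have Dgu : dirichlet gu = \sum_(i < N) rI (fun x => gu i x * gu i x).
  rewrite (dirichletE mgu) -(rI_sum _ (fun i => Igu i i)).
  by congr rI; apply/funext => x; apply: eq_bigr => i _; rewrite expr2.
have Dgv : dirichlet gv = \sum_(i < N) rI (fun x => gv i x * gv i x).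
  rewrite (dirichletE mgv) -(rI_sum _ (fun i => Igv i i)).
  by congr rI; apply/funext => x; apply: eq_bigr => i _; rewrite expr2.
have Dd : dirichlet (fun i x => gu i x - gv i x) = dirichlet gu - dirichlet gv
    - 2 * (N%:R * (N%:R - 2) * c * rI (fun x => w x * d x)).
  have I1 i := intbleB (Igu i i) (Igv i i).
  have I2 i := intbleB (Iuv i) (Ivv i).
  have I3 i := intbleZ 2 (I2 i).
  (* The cross term is kept as (g - h) h, so that after pairing with the bubble only the difference
     u - v appears. *)
  have sqE i : (fun x : Bor R N => (gu i x - gv i x) ^+ 2) =
      (fun x => (gu i x * gu i x - gv i x * gv i x)
        - 2 * (gu i x * gv i x - gv i x * gv i x)).
    by apply/funext => x; ring.
  have Is i : intble (fun x => (gu i x - gv i x) ^+ 2).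
    by rewrite sqE; exact: intbleB (I1 i) (I3 i).
  have Ed i : rI (fun x => (gu i x - gv i x) ^+ 2) = rI (fun x => gu i x * gu i x)
      - rI (fun x => gv i x * gv i x)
      - 2 * (rI (fun x => gu i x * gv i x) - rI (fun x => gv i x * gv i x)).
    rewrite sqE (rIB (I1 i) (I3 i)) (rIB (Igu i i) (Igv i i)) (rIZ 2 (I2 i)).
    by rewrite (rIB (Iuv i) (Ivv i)).
  rewrite (dirichletE mgd) (rI_sum _ Is) Dgu Dgv; under eq_bigr do rewrite Ed.
  have Iud : intble (fun x => u x * d x) by exact: Iabs.
  have Ivd := Iabs v mv vL; rewrite vE in Ivd.
  rewrite !sumrB -mulr_sumr sumrB Euv Evv -mulrBr -(rIB Iud Ivd).
  by congr (_ - _ * (_ * rI _)); apply/funext => x; rewrite /w vE mulrBl.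
have deficit_ge : dirichlet gu - dirichlet gv <= deficit mu u gu.
  rewrite /deficit lerD2l lerN2.
  have -> : choquard mu u `^ (1 / p) = choquard mu v `^ (1 / p).
    have sq z : choquard mu (z : 'rV[R]_N -> R) `^ (1 / p) = NLnorm mu z ^+ 2.
      rewrite /NLnorm -/p; move: (choquard mu z) => C.
      have e : 1 / p = 1 / (2 * p) * 2%:R by field; rewrite (gt_eqF p0).
      by rewrite e powRrM (powR_mulrn 2 (powR_ge0 C _)).
    by rewrite !sq NLuv.
  exact: S_HL_le.
have [Iw Hw] := weighted_integral_le_NLnorm n2 mu0 mun xi l0 mw wL.
have wd : `|rI (fun x => w x * d x)| <= b * NLnorm mu w.
  have le x : `|w x * d x| <= `|w x| * d x by rewrite nd.
  exact: le_trans (rI_norm_le (measurable_funM mw md) le Iw) Hw.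
have ca : `|c| * a <= NLnorm mu u.
  by rewrite NLuv; exact: (NLnorm_lower n2 mu0 mun l0 vE vL).
rewrite Dd mul1r; apply: lerD; first exact: deficit_ge.
exact: (final_estimate (ltW nn) a0 ca wd).
Qed.
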